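(* Let $a>0$ and let $\lambda:E\to[0,\infty)$ be continuous. Suppose there exist constants $y_0\ge0$ and $\lambda_{\min}>0$ such that $\lambda(y,j)\ge\lambda_{\min}$ for all $(y,j)\in E$ with $jy\ge y_0$. Then, for every $(y,j)\in E$, under $\mathbb{P}_{y,j}$ the zig-zag process $(Y,J)$ is a non-explosive strong Markov process with respect to $(\mathcal{F}_t)$, with generator equal to the closure of the operator $L$ on $C_0(E)$ given by $$L\varphi(y,j)=aj\frac{\partial\varphi}{\partial y}(y,j)+\lambda(y,j)\big(\varphi(y,-j)-\varphi(y,j)\big),\quad y\in\mathbb{R},\ j=\pm1,$$ with domain $D(L)=\{\varphi\in C_0(E):\varphi^{\pm}\in C^1(\mathbb{R}),\ (L\varphi)^{\pm}\in C_0(\mathbb{R})\}$.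
   Context: $E=\mathbb{R}\times\{-1,+1\}$ with the product topology; for $\varphi:E\to\mathbb{R}$, $\varphi^{\pm}(y)=\varphi(y,\pm1)$. $C_0(\mathbb{R})$ is the space of continuous functions on $\mathbb{R}$ vanishing at infinity and $C_0(E)$ is the space of $\varphi$ with $\varphi^\pm\in C_0(\mathbb{R})$. For $(y,j)\in E$ let $F(t;y,j)=\exp\left(-\int_0^t\lambda(y+ajs,j)\,ds\right)$, $t\ge0$. The zig-zag process $(Y(t),J(t))$ started from $(y,j)$, with law $\mathbb{P}_{y,j}$, is defined as follows: $T_0=0$, $Y(0)=y$, $J(0)=j$; for $i=1,2,\dots$, $Z_i$ is a random variable with $\mathbb{P}_{y,j}(Z_i>t\mid Z_1,\dots,Z_{i-1})=F(t;Y(T_{i-1}),J(T_{i-1}))$, $T_i=T_{i-1}+Z_i$, $J(t)=J(T_{i-1})$ for $T_{i-1}<t<T_i$, $J(T_i)=-J(T_{i-1})$, and $Y(t)=Y(T_{i-1})+J(T_{i-1})a(t-T_{i-1})$ for $T_{i-1}<t\le T_i$. This defines the process up to $T_\infty=\lim_kT_k$; non-explosive means $T_\infty=\infty$ almost surely. $\mathcal{F}_t=\sigma(\{(Y(s),J(s)):s\le t\})$. *)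

(* Defs.v *)
From HB Require Import structures.
From mathcomp Require Export all_boot all_order all_algebra.
From mathcomp Require Export all_classical all_reals all_analysis.
Export Order.TTheory GRing.Theory Num.Theory.
Export numFieldNormedType.Exports.
#[export] Set Implicit Arguments.
#[export] Unset Strict Implicit.
#[export] Unset Printing Implicit Defensive.


Local Open Scope classical_set_scope.
Local Open Scope ring_scope.

(** The state space is E = R * {-1,+1}; a velocity is encoded as a boolean,
    [true] standing for +1 and [false] for -1, so that [~~ j] is -j.  The
    product topology and the Borel sigma-algebra of E are those that the
    library puts on the product type [R * bool], [bool] being discrete. *)
Definition vel (R : realType) (j : bool) : R := if j then 1 else -1.

Section Operator.
Context {R : realType}.
Implicit Types phi psi : R * bool -> R.

Definition branch phi (j : bool) : R -> R := fun y => phi (y, j).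

Definition C0_line (g : R -> R) : Prop :=
  [/\ continuous g, g x @[x --> +oo] --> 0 & g x @[x --> -oo] --> 0].

Definition C0 phi : Prop := forall j, C0_line (branch phi j).

Definition C1_line (g : R -> R) : Prop :=
  (forall y, derivable g y 1) /\ continuous (derive1 g).

Definition L_op (a : R) (lam : R * bool -> R) phi : R * bool -> R :=
  fun x => a * vel R x.2 * derive1 (branch phi x.2) x.1
           + lam x * (phi (x.1, ~~ x.2) - phi x).

Definition L_dom (a : R) (lam : R * bool -> R) phi : Prop :=
  [/\ C0 phi, forall j, C1_line (branch phi j) & C0 (L_op a lam phi)].

(** Operators on C_0(E), whose norm is the sup norm, are represented by their
    graphs; [{uniform _ -> _}] carries the topology of uniform convergence. *)
Definition op_graph : Type :=
  set ({uniform (R * bool)%type -> R} * {uniform (R * bool)%type -> R}).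

Definition L_graph (a : R) (lam : R * bool -> R) : op_graph :=
  [set p | L_dom a lam p.1 /\ p.2 = L_op a lam p.1].

(** Closure of the graph in C_0(E) x C_0(E). *)
Definition op_closure (G : op_graph) : op_graph :=
  [set p | [/\ C0 p.1, C0 p.2 & closure G p]].

End Operator.

Section CondExp.
Context {R : realType} {d : measure_display} {T : measurableType d}.

(** [V] is a version of the conditional expectation of [U] given the
    sub-sigma-algebra [G]. *)
Definition is_cond_exp (P : probability T R) (G : set_system T) (U V : T -> R)
  : Prop :=
  [/\ P.-integrable setT (EFin \o U), P.-integrable setT (EFin \o V),
      preimage_set_system setT V measurable `<=` G &
      forall A, G A ->
        (\int[P]_(w in A) (V w)%:E = \int[P]_(w in A) (U w)%:E)%E].

End CondExp.

Section ZigZag.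
Context {R : realType}.
Variables (a : R) (lam : R * bool -> R).

Definition flow (s : R) (x : R * bool) : R * bool :=
  (x.1 + a * vel R x.2 * s, x.2).

(** F(t; y, j) *)
Definition survival (t : R) (x : R * bool) : R :=
  expR (- \int[lebesgue_measure]_(s in `[0, t]) lam (flow s x)).

(** [(T_n, (Y(T_n), J(T_n)))], where [z k] is the waiting time Z_{k+1}. *)
Fixpoint jump_chain (x : R * bool) (z : nat -> R) (n : nat) : R * (R * bool) :=
  if n is m.+1 then
    let: (t, u) := jump_chain x z m in
    (t + z m, ((flow (z m) u).1, ~~ u.2))
  else (0, x).

Definition jump_time x z n : R := (jump_chain x z n).1.
Definition jump_state x z n : R * bool := (jump_chain x z n).2.

(** (Y(t), J(t)) for t >= 0: if T_n <= t < T_{n+1}, the state is reached by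
    following the flow from the n-th jump state during a time t - T_n.  When no
    such n exists, i.e. t >= T_infinity, the value is conventionally the
    starting point. *)
Definition zigzag_path (x : R * bool) (z : nat -> R) (t : R) : R * bool :=
  match pselect (exists n, t < jump_time x z n.+1) with
  | left ex => let n := ex_minn ex in
               flow (t - jump_time x z n) (jump_state x z n)
  | right _ => x
  end.

(** Under [P], the waiting times have the conditional law
    P(Z_{n+1} > t | Z_1, ..., Z_n) = F(t; Y(T_n), J(T_n)). *)
Definition waiting_times {d : measure_display} {T : measurableType d}
    (P : probability T R) (x : R * bool) (Z : nat -> {RV P >-> R}) : Prop :=
  forall (n : nat) (t : R), 0 <= t ->
    is_cond_exp P (g_sigma_preimage (fun i : 'I_n => (Z i : T -> R)))
      (\1_[set w | t < Z n w])
      (fun w => survival t (jump_state x (fun k => Z k w) n)).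

Definition zigzag {T : Type} (x : R * bool) (Z : nat -> T -> R)
    (t : R) (w : T) : R * bool :=
  zigzag_path x (fun k => Z k w) t.

Definition non_explosive {d : measure_display} {T : measurableType d}
    (P : probability T R) (x : R * bool) (Z : nat -> T -> R) : Prop :=
  \forall w \ae P, jump_time x (fun k => Z k w) n @[n --> \oo] --> +oo.

End ZigZag.

Section Filtrations.
Context {R : realType} {d : measure_display} {T : measurableType d}.

Definition natural_filtration (X : R -> T -> R * bool) (t : R) : set_system T :=
  <<s \bigcup_(s in `[0, t]) preimage_set_system setT (X s) measurable >>.

Definition stopping_time (Fil : R -> set_system T) (tau : T -> \bar R) : Prop :=
  (forall w, (0 <= tau w)%E) /\
  (forall t, 0 <= t -> Fil t [set w | (tau w <= t%:E)%E]).

(** F_tau, a sub-sigma-algebra of F_oo = sigma(F_t : t >= 0). *)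
Definition stopped_sigma (Fil : R -> set_system T) (tau : T -> \bar R)
  : set_system T :=
  [set A | <<s \bigcup_(t in `[0, +oo[) Fil t >> A /\
           forall t, 0 <= t -> Fil t (A `&` [set w | (tau w <= t%:E)%E])].

End Filtrations.

Section MarkovFamily.
Context {R : realType} {d : measure_display}.
Variables (Omega : R * bool -> measurableType d).
Variables (P : forall x, probability (Omega x) R).
Variables (X : forall x, R -> Omega x -> R * bool).

(** P_t f (x) = E_x[f(X_t)], where [X x] is the process started from [x], and
    is defined on the probability space [(Omega x, P x)]. *)
Definition transition (t : R) (f : R * bool -> R) (x : R * bool) : R :=
  fine 'E_(P x)[fun w => f (X t w)].

(** Under [P x], the process is strong Markov for the filtration [Fil]: it is
    adapted, its transition functions are Borel, and, on {tau < oo},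
    E_x[f(X_{tau + t}) | F_tau] = P_t f (X_tau). *)
Definition strong_markov (x : R * bool) (Fil : R -> set_system (Omega x))
  : Prop :=
  [/\ forall t, 0 <= t ->
        preimage_set_system setT (@X x t) measurable `<=` Fil t,
      forall t (f : R * bool -> R), 0 <= t -> measurable_fun setT f -> bounded_fun f ->
        measurable_fun setT (transition t f) &
      forall tau, stopping_time Fil tau ->
      forall t (f : R * bool -> R), 0 <= t -> measurable_fun setT f -> bounded_fun f ->
        is_cond_exp (P x) (stopped_sigma Fil tau)
          (fun w => \1_[set w | (tau w < +oo)%E] w
                    * f (X (fine (tau w) + t) w))
          (fun w => \1_[set w | (tau w < +oo)%E] w
                    * transition t f (X (fine (tau w)) w))].

(** The operator with graph [A] is the generator of the process on C_0(E):
    (P_t) acts on C_0(E), and A is its infinitesimal generator there. *)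
Definition has_generator (A : @op_graph R) : Prop :=
  (forall t f, 0 <= t -> C0 f -> C0 (transition t f)) /\
  A = [set p | [/\ C0 p.1, C0 p.2 &
        {uniform, (fun h x => h^-1 * (transition h p.1 x - p.1 x)) @ 0^'+
                  --> (p.2 : R * bool -> R)}]].

End MarkovFamily.

(* Main.v *)
From HB Require Import structures.
Require Import Defs.
From mathcomp Require Import ring lra measurable_realfun.
Local Open Scope classical_set_scope.
Local Open Scope ring_scope.

(** Why the theorem holds.

    The waiting time in a state x has the density dens r x = lam (flow r x) *
    surv r x.  As the flow on a branch eventually enters the region where lam is
    bounded below, this density has mass 1.  By one_step, the waiting times and
    jump states form a Markov chain with this jump law, and averages over further
    jumps are computed by iterating the operator kstep, which averages over the
    next jump.

    The speed is finite, so up to time t the process stays in a compact set, where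
    lam is at most some M; an exponential weight then shows that n jumps up to time
    t have probability at most exp (2 M t) / 2^n (iter_nonneg_time_le).  Hence jump
    times tend to infinity almost surely, and the mean of f at time t is a series
    over the number of jumps, the series evolve (expectation_evolve).

    Markov property.  On the event of n jumps up to time s, the past up to time s is
    generated by the first n waiting times (filtration_phase), and surv is
    multiplicative along the flow, so the current waiting time starts afresh at
    time s (jump_mean_restart).  Each term of the series evolve is continuous in
    the starting point when f is, and the tail is uniformly small on compact sets:
    the semigroup P_t preserves bounded continuous functions
    (continuous_transition).  Paths are right-continuous, so the Markov property
    passes from stopping times rounded up to a grid to the stopping times
    themselves, first for continuous f, then for all bounded measurable f, since
    both sides depend on f like an integral (strong_markov_ge0).

    Generator.  Conditioning on the first jump gives a renewal equation for P_t f
    (renewal).  Integrating Lf = k along the flow up to the first jump gives the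
    equation called mild below, which involves no derivative of f.  Four
    implications identify the closure of L with the generator: pairs in the
    graph of L solve the mild equation (L_graph_mild), which survives uniform limits
    (mild_closed); for solutions, the renewal equation shows that (P_h f - f) / h
    converges to k uniformly (mild_generator); conversely this convergence
    determines the right derivative of f along the flow, damped by surv, and
    hence the mild equation (generator_mild); finally solutions of the mild
    equation are continuously differentiable and belong to the graph of L
    (mild_L_graph).  That P_t preserves C_0 follows from the finite speed. *)

(** * Calculus on the real line *)

Section Calculus.
Context {R : realType}.
Local Notation mu := (@lebesgue_measure R).
Implicit Types (g G : R -> R) (a b : R).

Lemma continuous_integrable_itv g a b : continuous g ->
  mu.-integrable `[a, b] (EFin \o g).
Proof.
move=> cg; apply: continuous_compact_integrable; first exact: segment_compact.
exact: continuous_subspaceT.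
Qed.

Lemma Rintegral_cst_itv (t c : R) : 0 <= t -> \int[mu]_(r in `[0, t]) c = c * t.
Proof.
move=> t0; rewrite Rintegral_cst//= lebesgue_measure_itv/= lte_fin.
by case: ltgtP t0 => //= [_|<-] _; rewrite ?subr0.
Qed.

Lemma geometric_small (Q rho e : R) : 0 <= rho -> rho < 1 -> 0 < e ->
  exists n, Q * rho ^+ n <= e.
Proof.
move=> rho0 rho1 e0.
have : Q * rho ^+ n @[n --> \oo] --> (0 : R).
  rewrite -[X in _ --> X](mulr0 Q); apply: cvgM; first exact: cvg_cst.
  by apply: cvg_expr; rewrite ger0_norm.
move=> /cvgrPdist_lt /(_ _ e0) [n _ /(_ n (leqnn n))] /=.
by rewrite sub0r normrN => h; exists n; apply: le_trans (ltW h); exact: ler_norm.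
Qed.

Lemma is_derive_continuous g (g' : R -> R) :
  (forall y, is_derive y (1 : R) g (g' y)) -> continuous g.
Proof.
by move=> dg y; apply/differentiable_continuous/derivable1_diffP; case: (dg y).
Qed.

Lemma integral_primitive g G a b : a <= b -> continuous g ->
  (forall y, is_derive y (1 : R) G (g y)) ->
  (\int[mu]_(x in `[a, b]) (g x)%:E = (G b - G a)%:E)%E.
Proof.
rewrite le_eqVlt => /predU1P[<-|ab] cg dG.
  by rewrite set_itv1 integral_set1 subrr.
have cG := is_derive_continuous dG.
rewrite (@continuous_FTC2 _ g G)//.
- exact: continuous_subspaceT.
- split.
  + by move=> x _; case: (dG x).
  + exact/cvg_at_right_filter/cG.
  + exact/cvg_at_left_filter/cG.
- by move=> x _; rewrite derive1E; case: (dG x).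
Qed.

Lemma Rintegral_primitive g G a b : a <= b -> continuous g ->
  (forall y, is_derive y (1 : R) G (g y)) ->
  \int[mu]_(x in `[a, b]) g x = G b - G a.
Proof. by move=> ab cg dG; rewrite /Rintegral (integral_primitive ab cg dG). Qed.

(** The integrals of g over the intervals [- N, y] with - N <= y are primitives
    near y; the function I N y - I N 0 does not depend on N, which glues them
    into a primitive on the whole line. *)
Lemma continuous_primitive g : continuous g ->
  exists G, forall y, is_derive y (1 : R) G (g y).
Proof.
move=> cg.
pose I N y := \int[mu]_(t in `[- N, y]) g t.
have IE M N y : 0 <= M -> M <= N -> - M <= y -> I N y - I N 0 = I M y - I M 0.
  move=> M0 MN My.
  have IM z : - M <= z -> I M z = I N z - I N (- M).
    move=> Mz; rewrite /I Rintegral_itvB ?bnd_simp//.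
    - rewrite Rintegral_itv_obnd_cbnd//.
      by apply: (integrableS _ _ _ (@continuous_integrable_itv g (- M) z cg)) => //;
        apply: subset_itvr; rewrite bnd_simp.
    - exact: continuous_integrable_itv.
    - by rewrite lerN2.
  rewrite !IM//; [ring|lra].
exists (fun y => I (`|y| + 1) y - I (`|y| + 1) 0) => y.
have [] := @continuous_FTC1_closed R g (- (`|y| + 2)) y (y + 1) _ _ _ (cg y).
- lra.
- exact: continuous_integrable_itv.
- have := ler_norm (- y); rewrite normrN; lra.
rewrite -/(I _) => dI I'.
have dI1 : is_derive y (1 : R) (I (`|y| + 2)) (g y).
  by apply: (DeriveDef dI); rewrite -derive1E.
have := is_deriveB dI1 (is_derive_cst (I (`|y| + 2) 0) y 1).
rewrite subr0; apply: near_eq_is_derive.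
near=> z.
apply: IE; [|near: z|].
- by have := normr_ge0 (z : R); lra.
- near=> z; rewrite -lerBrDr.
  have -> : `|y| + 2 - 1 = `|y| + 1 by ring.
  near: z; apply: (cvgr_le `|y|); last lra.
  exact: (@norm_continuous _ R^o).
- have := ler_norm (- z); rewrite normrN; lra.
Unshelve. all: by end_near. Qed.

End Calculus.

(** * The state space, the flow and the survival function *)

Section StateSpace.
Context {R : realType}.
Local Notation E := (R * bool)%type.

Lemma cvg_state (T : Type) (F : set_system T) {FF : Filter F}
    (f : T -> R) (y : R) (j : bool) :
  f x @[x --> F] --> y -> (f x, j) @[x --> F] --> ((y, j) : E).
Proof. by move=> fy; apply: (@cvg_pair _ _ _ F (nbhs y) (nbhs j)) => //; exact: cvg_cst. Qed.

Lemma continuous_branchP (T : topologicalType) (phi : E -> T) :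
  continuous phi <-> forall j, continuous (fun y => phi (y, j)).
Proof.
split=> [cphi j y|cphi [y j]].
  apply: (@continuous_comp _ _ _ (fun y => (y, j)) phi); last exact: cphi.
  by apply: cvg_state; exact: cvg_id.
move=> U /cphi; rewrite !nbhs_simpl /= => Uy.
exists (((fun y => phi (y, j)) @^-1` U), [set j]) => /=.
  by split=> //; apply/principal_filterP.
by move=> [z k] /= [Uz ->].
Qed.

Lemma measurable_branch d (T : measurableType d) (phi : E -> T) :
  (forall j, measurable_fun setT (fun y => phi (y, j))) ->
  measurable_fun setT phi.
Proof.
move=> mphi.
have -> : phi = fun x => if x.2 then phi (x.1, true) else phi (x.1, false).
  by apply/funext => -[y []].
apply: measurable_fun_ifT; first exact: measurable_snd.
  exact: (measurableT_comp (mphi true) measurable_fst).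
exact: (measurableT_comp (mphi false) measurable_fst).
Qed.

Lemma measurable_time_branch d (T : measurableType d) (phi : R * E -> T) :
  (forall j, measurable_fun setT (fun p : R * R => phi (p.1, (p.2, j)))) ->
  measurable_fun setT phi.
Proof.
move=> mphi.
have -> : phi = fun x => if x.2.2 then phi (x.1, (x.2.1, true))
                          else phi (x.1, (x.2.1, false)).
  by apply/funext => -[t [y []]].
apply: measurable_fun_ifT => //.
- exact: measurableT_comp.
- apply: (measurableT_comp (mphi true) (g := fun x : R * E => (x.1, x.2.1))).
  by apply: measurable_fun_pair => //; exact: measurableT_comp.
- apply: (measurableT_comp (mphi false) (g := fun x : R * E => (x.1, x.2.1))).
  by apply: measurable_fun_pair => //; exact: measurableT_comp.
Qed.

Lemma continuous_measurable_state (phi : E -> R) :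
  continuous phi -> measurable_fun setT phi.
Proof.
move=> /continuous_branchP cphi; apply: measurable_branch => j.
exact: continuous_measurable_fun.
Qed.

End StateSpace.

Section Flow.
Context {R : realType} (a : R).
Local Notation E := (R * bool)%type.
Local Notation flow := (flow a).

Definition flip (x : E) : E := (x.1, ~~ x.2).

Lemma flow0 x : flow 0 x = x.
Proof. by case: x => y j; rewrite /flow/= mulr0 addr0. Qed.

Lemma flowD s t x : flow (s + t) x = flow t (flow s x).
Proof. by rewrite /flow/=; congr pair; ring. Qed.

Lemma flow_dist t x : `|(flow t x).1 - x.1| = `|a| * `|t|.
Proof.
rewrite /flow/= addrAC subrr add0r !normrM.
by rewrite /vel; case: x.2; rewrite ?normrN normr1 mulr1.
Qed.

Lemma is_derive_flow t x :
  is_derive t (1 : R) (fun s => (flow s x).1) (a * vel R x.2).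
Proof.
have h := is_deriveD (is_derive_cst x.1 t 1)
  (is_deriveZ (a * vel R x.2) (is_derive_id t (1 : R))).
rewrite /= add0r in h.
rewrite -[X in is_derive _ _ _ X]mulr1.
exact: h.
Qed.

Lemma continuous_flow_time x : continuous (fun s => (flow s x).1).
Proof. exact: is_derive_continuous (fun t => is_derive_flow t x). Qed.

Lemma continuous_flow (t : R) : continuous (flow t).
Proof.
apply/continuous_branchP => j y; rewrite /flow/=.
apply: cvg_state; by apply: cvgD; [exact: cvg_id|exact: cvg_cst].
Qed.

Lemma continuous_flip : continuous flip.
Proof.
by apply/continuous_branchP => j y; rewrite /flip; apply: cvg_state; exact: cvg_id.
Qed.

Lemma continuous_along_flow (T : topologicalType) (phi : E -> T) x :
  continuous phi -> continuous (fun s => phi (flow s x)).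
Proof.
move=> /continuous_branchP cphi t.
exact: (continuous_comp (@continuous_flow_time x t) (cphi x.2 _)).
Qed.

Lemma measurable_vel : measurable_fun setT (fun x : E => vel R x.2).
Proof. by apply: measurable_branch => j; exact: measurable_cst. Qed.

Lemma measurable_flow : measurable_fun setT (fun p : R * E => flow p.1 p.2).
Proof.
apply: measurable_fun_pair => /=; last exact: measurableT_comp.
apply: measurable_funD; first exact: measurableT_comp.
apply: measurable_funM => //; apply: measurable_funM => //.
exact: (measurableT_comp measurable_vel).
Qed.

Lemma measurable_flip : measurable_fun setT flip.
Proof.
by apply: measurable_fun_pair => //; apply: measurable_neg; exact: measurable_snd.
Qed.

End Flow.

(** The hypotheses on a and lambda, together with a primitive of each branch of
    lambda.  With the primitives the survival function has a closed formula,
    which makes sense for negative times as well and satisfies flow identities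
    without any restriction on the sign of time. *)
Record zigzag_rates (R : realType) := ZigzagRates {
  speed : R;
  rate : R * bool -> R;
  rate_prim : bool -> R -> R;
  rate_thr : R;
  rate_min : R;
  speed_gt0 : 0 < speed;
  rate_continuous : continuous rate;
  rate_ge0 : forall x, 0 <= rate x;
  rate_prim_derive :
    forall j y, is_derive y (1 : R) (rate_prim j) (rate (y, j));
  rate_min_gt0 : 0 < rate_min;
  rate_ge_min : forall y j, rate_thr <= vel R j * y -> rate_min <= rate (y, j)
}.

Section Survival.
Context {R : realType} (m : zigzag_rates R).
Local Notation E := (R * bool)%type.
Local Notation mu := (@lebesgue_measure R).
Local Notation a := (speed m).
Local Notation lam := (rate m).
Local Notation prim := (rate_prim m).
Local Notation flow := (flow a).
Local Notation a_gt0 := (speed_gt0 m).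
Local Notation lam_continuous := (@rate_continuous _ m).
Local Notation lam_ge0 := (@rate_ge0 _ m).
Local Notation prim_derive := (@rate_prim_derive _ m).

(** The integral of the rate along the flow over [0, t].  The position moves with
    speed a in the direction vel x.2, hence the factor in front of the increment
    of the primitive. *)
Definition hazard (t : R) (x : E) : R :=
  vel R x.2 / a * (prim x.2 (flow t x).1 - prim x.2 x.1).

Definition surv (t : R) (x : E) : R := expR (- hazard t x).

(** The density of the first jump time of the process started from x. *)
Definition dens (t : R) (x : E) : R := lam (flow t x) * surv t x.

Lemma is_derive_hazard t x : is_derive t (1 : R) (hazard^~ x) (lam (flow t x)).
Proof.
have h := @is_derive1_comp R (prim x.2) (fun s => (flow s x).1) t _ _
  (prim_derive x.2 (flow t x).1) (is_derive_flow a t x).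
have h1 := is_deriveD h (is_derive_cst (- prim x.2 x.1) t 1).
have h2 := is_deriveZ (vel R x.2 / a) h1.
apply: (is_derive_eq h2).
rewrite /GRing.scale/= addr0 -/(flow t x).
have -> : vel R x.2 / a * (lam ((flow t x).1, x.2) * (a * vel R x.2)) =
   (vel R x.2 * vel R x.2) * (a / a) * lam (flow t x) by rewrite /flow/=; ring.
rewrite divff ?gt_eqF ?a_gt0// mulr1 /vel; case: x.2; by rewrite ?mulrNN mul1r mul1r.
Qed.

Lemma hazard0 x : hazard 0 x = 0.
Proof. by rewrite /hazard flow0 subrr mulr0. Qed.

Lemma hazardE t x : 0 <= t -> \int[mu]_(s in `[0, t]) lam (flow s x) = hazard t x.
Proof.
move=> t0; rewrite (Rintegral_primitive t0 _ (is_derive_hazard^~ x)).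
  by rewrite hazard0 subr0.
exact: continuous_along_flow lam_continuous.
Qed.

Lemma hazardD s t x : hazard (s + t) x = hazard s x + hazard t (flow s x).
Proof. by rewrite /hazard flowD /=; ring. Qed.

Lemma hazard_ge0 t x : 0 <= t -> 0 <= hazard t x.
Proof. by move=> t0; rewrite -hazardE//; apply: Rintegral_ge0 => s _; exact: lam_ge0. Qed.

Lemma survivalE t x : 0 <= t -> survival a lam t x = surv t x.
Proof. by move=> t0; rewrite /survival hazardE. Qed.

Lemma surv0 x : surv 0 x = 1.
Proof. by rewrite /surv hazard0 oppr0 expR0. Qed.

Lemma survD s t x : surv (s + t) x = surv s x * surv t (flow s x).
Proof. by rewrite /surv hazardD opprD expRD. Qed.

Lemma surv_ge0 t x : 0 <= surv t x. Proof. exact: expR_ge0. Qed.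

Lemma surv_le1 t x : 0 <= t -> surv t x <= 1.
Proof. by move=> t0; rewrite /surv -expR0 ler_expR oppr_le0 hazard_ge0. Qed.

Lemma dens_ge0 t x : 0 <= dens t x.
Proof. by rewrite mulr_ge0 ?lam_ge0 ?surv_ge0. Qed.

Lemma densD s t x : dens (s + t) x = surv s x * dens t (flow s x).
Proof. by rewrite /dens survD flowD; ring. Qed.

Lemma is_derive_surv t x : is_derive t (1 : R) (surv^~ x) (- dens t x).
Proof.
have h := @is_derive1_comp R expR (fun s => - hazard s x) t _ _
  (is_derive_expR (- hazard t x))
  (is_deriveN (is_derive_hazard t x)).
by apply: (is_derive_eq h); rewrite /dens /surv; ring.
Qed.

Lemma continuous_surv_time x : continuous (surv^~ x).
Proof. exact: is_derive_continuous (is_derive_surv^~ x). Qed.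

Lemma continuous_dens_time x : continuous (dens^~ x).
Proof.
by move=> t; apply: cvgM; [exact: (continuous_along_flow lam_continuous)|exact: continuous_surv_time].
Qed.

Lemma continuous_surv t : continuous (surv t).
Proof.
apply/continuous_branchP => j y; rewrite /surv /hazard.
have cG : continuous (prim j) by exact: is_derive_continuous (prim_derive j).
apply: (@continuous_comp _ _ _ (fun y => - hazard t (y, j)) expR); last first.
  exact: continuous_expR.
rewrite /hazard /flow/=.
have c1 : {for y, continuous (fun y => prim j (y + a * vel R j * t))}.
  apply: (@continuous_comp _ _ _ (fun y => y + a * vel R j * t) (prim j)).
    by apply: cvgD; [exact: cvg_id|exact: cvg_cst].
  exact: cG.
apply: cvgN; apply: cvgM; [exact: cvg_cst|exact: cvgB (c1) (cG y)].
Qed.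

Lemma continuous_dens t : continuous (dens t).
Proof.
move=> x; apply: cvgM; last exact: continuous_surv.
by apply: continuous_comp; [exact: continuous_flow|exact: lam_continuous].
Qed.

Lemma measurable_surv : measurable_fun setT (fun p : R * E => surv p.1 p.2).
Proof.
apply: measurable_time_branch => j; rewrite /surv /hazard/=.
have mG : measurable_fun setT (prim j).
  exact: continuous_measurable_fun (is_derive_continuous (prim_derive j)).
apply: (measurableT_comp (@measurable_expR R)); apply: measurableT_comp => //.
apply: measurable_funM => //; apply: measurable_funB.
  apply: (measurableT_comp mG); apply: measurable_funD => //.
  exact: measurable_funM.
exact: measurableT_comp.
Qed.

Lemma measurable_dens : measurable_fun setT (fun p : R * E => dens p.1 p.2).
Proof.
apply: measurable_funM; last exact: measurable_surv.
apply: measurableT_comp; last exact: measurable_flow.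
exact: continuous_measurable_state lam_continuous.
Qed.

End Survival.

(** * Countably linear functionals *)

Section CountablyLinear.
Import HBNNSimple.
Context {R : realType} {d : measure_display} {T : measurableType d}.
Implicit Types (h : T -> \bar R) (I : (T -> \bar R) -> \bar R).

Definition ge0_measurable h := measurable_fun setT h /\ forall x, (0 <= h x)%E.

(** Functionals with the properties of an integral.  The functionals to be
    compared are mixtures, over random starting points, of integrals along the
    flow; these properties are easy to check for them, and they are all that
    the extension from indicators to nonnegative measurable functions uses. *)
Definition countably_linear I : Prop :=
  [/\ forall h, (forall x, 0 <= h x)%E -> (0 <= I h)%E,
      forall (c : R) h, 0 <= c -> ge0_measurable h ->
        I (fun x => c%:E * h x)%E = (c%:E * I h)%E &
      forall h_ : nat -> T -> \bar R, (forall n, ge0_measurable (h_ n)) ->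
        I (fun x => \sum_(n <oo) h_ n x)%E = (\sum_(n <oo) I (h_ n))%E].

Lemma ge0_measurable_indic (B : set T) : measurable B ->
  ge0_measurable (fun x => (\1_B x)%:E).
Proof.
move=> mB; split; first by apply/measurable_EFinP; exact: measurable_indic.
by move=> x; rewrite lee_fin indicE.
Qed.

Lemma countably_linear0 I : countably_linear I -> I (fun=> 0%E) = 0%E.
Proof.
move=> [_ IZ _]; have := IZ 0 (fun=> 0%E) (lexx 0).
rewrite !mul0e.
by apply; split => //; exact: measurable_cst.
Qed.

Lemma countably_linearD I h1 h2 : countably_linear I ->
  ge0_measurable h1 -> ge0_measurable h2 ->
  I (fun x => h1 x + h2 x)%E = (I h1 + I h2)%E.
Proof.
move=> lI m1 m2; have I0 := countably_linear0 lI; case: lI => Ige0 _ Isum.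
pose h_ n := if n is 0 then h1 else if n is 1 then h2 else fun=> 0%E.
have mh n : ge0_measurable (h_ n).
  by case: n => [//|[//|n]]; split => //; exact: measurable_cst.
have sum2 (u : nat -> \bar R) : (forall n, 0 <= u n)%E ->
    (forall n, u n.+2 = 0%E) -> (\sum_(n <oo) u n)%E = (u 0%N + u 1%N)%E.
  move=> u0 u2; rewrite (nneseries_split 0 2)// eseries0 ?adde0.
    by rewrite big_ltn// big_nat1.
  by move=> [|[|n]].
have := Isum h_ mh; rewrite sum2; last first.
- by move=> n; exact: I0.
- by move=> n; apply: Ige0; case: (mh n).
move=> <-; congr I; apply/funext => x; rewrite sum2// => n.
by case: (mh n).
Qed.

Lemma countably_linear_sum I (J : Type) (s : seq J) (h_ : J -> T -> \bar R) :
  countably_linear I -> (forall i, ge0_measurable (h_ i)) ->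
  I (fun x => \sum_(i <- s) h_ i x)%E = (\sum_(i <- s) I (h_ i))%E.
Proof.
move=> lI mh; elim: s => [|i s IH].
  rewrite big_nil; apply: etrans (countably_linear0 lI).
  by congr I; apply/funext => x; rewrite big_nil.
rewrite big_cons -IH -countably_linearD//.
  by congr I; apply/funext => x; rewrite big_cons.
split; first by apply: emeasurable_sum => j; case: (mh j).
by move=> x; apply: sume_ge0 => j _; case: (mh j).
Qed.

Lemma countably_linear_nnsfun I1 I2 (f : {nnsfun T >-> R}) :
  countably_linear I1 -> countably_linear I2 ->
  (forall B, measurable B ->
    I1 (fun x => (\1_B x)%:E) = I2 (fun x => (\1_B x)%:E)) ->
  I1 (fun x => (f x)%:E) = I2 (fun x => (f x)%:E).
Proof.
move=> l1 l2 I12.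
have mf (y : R) : measurable (f @^-1` [set y]) by exact: measurable_sfunP.
pose g (y : R) (x : T) := ((Num.max 0 y)%:E * (\1_(f @^-1` [set y]) x)%:E)%E.
have -> : (fun x => (f x)%:E) = fun x => (\sum_(y <- finmap.enum_fset (fset_set (range f))) g y x)%E.
  apply/funext => x; rewrite fimfunE -fsumEFin// fsbig_finite//=.
  apply: eq_bigr => y _; rewrite /g -EFinM; congr (_%:E).
  rewrite indicE; case: (boolP (x \in _)) => [|_]; last by rewrite !mulr0.
  by rewrite inE/= => <-; rewrite max_r.
have mg y : ge0_measurable (g y).
  split => [|x]; last by rewrite mule_ge0// lee_fin ?le_max ?lexx// indicE.
  apply/measurable_EFinP/measurable_funM; [exact: measurable_cst|].
  exact: measurable_indic.
rewrite !countably_linear_sum//; apply: eq_bigr => y _.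
case: l1 l2 => _ Z1 _ [_ Z2 _].
rewrite Z1 ?Z2 ?I12 ?le_max ?lexx//; exact: ge0_measurable_indic.
Qed.

Lemma countably_linear_nondecreasing I (f : nat -> T -> R) h :
  countably_linear I -> (forall n, ge0_measurable (EFin \o f n)) ->
  (forall n x, f n x <= f n.+1 x) ->
  (forall x, (f n x)%:E @[n --> \oo] --> h x) ->
  I h = limn (fun n => I (EFin \o f n)).
Proof.
move=> lI mf fnd fh.
pose g n x := if n is m.+1 then (f m.+1 x - f m x)%:E else (f 0%N x)%:E.
have mg n : ge0_measurable (g n).
  case: n => [|n]; first exact: mf.
  split => [|x]; last by rewrite lee_fin subr_ge0.
  by apply/measurable_EFinP/measurable_funB; apply/measurable_EFinP;
    [case: (mf n.+1)|case: (mf n)].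
have gsum n x : (\sum_(0 <= i < n.+1) g i x = (f n x)%:E)%E.
  elim: n => [|n IH]; first by rewrite big_nat1.
  by rewrite big_nat_recr//= IH -EFinD addrC subrK.
have Isum n : (\sum_(0 <= i < n.+1) I (g i) = I (EFin \o f n))%E.
  rewrite -(countably_linear_sum (index_iota 0 n.+1) lI mg).
  by congr I; apply/funext => x; rewrite gsum.
have -> : h = fun x => (\sum_(n <oo) g n x)%E.
  apply/funext => x; apply/esym/cvg_lim => //.
  rewrite -(cvg_shiftn 1)/=.
  by under eq_fun do rewrite addn1 gsum; exact: fh.
case: (lI) => Ige0 _ ->//.
apply/esym/cvg_lim => //; under eq_fun do rewrite -Isum.
have := @is_cvg_nneseries R (fun n => I (g n)) xpredT 0%N
  (fun n _ _ => Ige0 _ (fun x => (mg n).2 x)).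
by rewrite /= -(cvg_shiftS (fun n => \sum_(0 <= i < n) I (g i))%E).
Qed.

Section Uniqueness.
Variables (G : set (set T)) (cov : nat -> set T).
Hypotheses (mG : measurable = <<s G >>) (GI : setI_closed G).
Hypotheses (Gcov : forall k, G (cov k)) (covT : \bigcup_k cov k = setT).

Section Measure.
Variables (I : (T -> \bar R) -> \bar R) (lI : countably_linear I).

Let m (B : set T) := I (fun x => (\1_B x)%:E).

Let m0 : m set0 = 0%E.
Proof.
apply: etrans (countably_linear0 lI); rewrite /m; congr I; apply/funext => x.
by rewrite indic0.
Qed.

Let m_ge0 B : (0 <= m B)%E.
Proof. by case: lI => + _ _; apply => x; rewrite lee_fin indicE. Qed.

Let m_sigma_additive : semi_sigma_additive m.
Proof.
move=> F mF tF mUF; case: (lI) => Ige0 _ Isum.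
have -> : m (\bigcup_n F n) = (\sum_(n <oo) m (F n))%E.
  rewrite /m -Isum; last by move=> n; exact: ge0_measurable_indic.
  congr I; apply/funext => x.
  apply/esym/cvg_lim => //.
  exact: (@measure_semi_sigma_additive _ _ _ (dirac x) F mF tF mUF).
by apply: is_cvg_nneseries => n _ _; exact: m_ge0.
Qed.

HB.instance Definition _ := isMeasure.Build _ _ _ m m0 m_ge0 m_sigma_additive.

Definition functional_measure : {measure set T -> \bar R} := m.

End Measure.

(** B |-> I(1_B) is a measure, and two measures that agree and are finite on a
    generating pi-system are equal; the functionals then agree on simple
    functions, and monotone limits are series of increments. *)
Lemma countably_linear_unique I1 I2 :
  countably_linear I1 -> countably_linear I2 ->
  (forall B, G B -> I1 (fun x => (\1_B x)%:E) = I2 (fun x => (\1_B x)%:E)) ->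
  (forall k, I1 (fun x => (\1_(cov k) x)%:E) < +oo)%E ->
  forall h, ge0_measurable h -> I1 h = I2 h.
Proof.
move=> l1 l2 I12 I1oo h [mh h0].
have I12m B : measurable B ->
    I1 (fun x => (\1_B x)%:E) = I2 (fun x => (\1_B x)%:E).
  exact: (@measure_unique _ _ _ G cov mG GI Gcov covT
    (functional_measure l1) (functional_measure l2)).
pose f := nnsfun_approx measurableT mh.
have If I : countably_linear I -> I h = limn (fun n => I (EFin \o f n)).
  move=> lI; apply: (countably_linear_nondecreasing lI) => [n|n x|x].
  - by split => [|x]; [exact/measurable_EFinP|rewrite lee_fin].
  - exact/lefP/nd_nnsfun_approx.
  - exact: cvg_nnsfun_approx.
rewrite !If//; congr (limn _); apply/funext => n.
exact: countably_linear_nnsfun.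
Qed.

End Uniqueness.

End CountablyLinear.

Lemma countably_linear_unique_rays (R : realType) (I1 I2 : (R -> \bar R) -> \bar R) :
  countably_linear I1 -> countably_linear I2 ->
  (forall c : R, I1 (fun y => (\1_`]c, +oo[%classic y)%:E) =
    I2 (fun y => (\1_`]c, +oo[%classic y)%:E)) ->
  (forall c : R, I1 (fun y => (\1_`]c, +oo[%classic y)%:E) < +oo)%E ->
  forall h, ge0_measurable h -> I1 h = I2 h.
Proof.
move=> l1 l2 ray fin.
apply: (@countably_linear_unique R _ R (@RGenOInfty.G R)
  (fun k => `]- k%:R, +oo[%classic) _ _ _ _ I1 I2) => //.
- exact: RGenOInfty.measurableE.
- move=> _ _ [c ->] [e ->]; exists (Num.max c e); apply/seteqP; split=> y /=;
    rewrite !in_itv/= !andbT gt_max; first by move=> [-> ->].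
  by move=> /andP.
- by move=> k; exists (- k%:R).
- apply/seteqP; split=> y //= _; exists (Num.trunc `|y|).+1 => //=.
  rewrite in_itv/= andbT ltrNl; apply: le_lt_trans (truncnS_gt _).
  by rewrite -normrN ler_norm.
- by move=> _ [c ->]; exact: ray.
Qed.

(** * The law of the first jump *)

Section Translation.
Context {R : realType}.
Local Notation mu := (@lebesgue_measure R).

Lemma lebesgue_measure_shift (c : R) (A : set R) : measurable A ->
  pushforward mu ((fun x => x + c) : _ -> measurableTypeR R) A = mu A.
Proof.
move=> mA.
have mc : measurable_fun setT ((fun x => x + c) : R -> measurableTypeR R).
  exact: measurable_funD.
apply/esym/lebesgue_measure_unique => //= _ [[b e]] _ <-.
rewrite /pushforward.
have -> : (fun x => x + c) @^-1` `]b, e]%classic = `]b - c, e - c]%classic.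
  by apply/seteqP; split => x /=; rewrite !in_itv/= ltrBlDr lerBrDr.
rewrite !lebesgue_measure_itv/= !lte_fin ltrD2r.
by case: ifP => // _; rewrite -!EFinB; congr (_%:E); ring.
Qed.

Lemma ge0_integral_shift (c : R) (f : R -> \bar R) :
  measurable_fun setT f -> (forall x, 0 <= f x)%E ->
  (\int[mu]_x f (x + c)%R = \int[mu]_x f x)%E.
Proof.
move=> mf f0.
have mc : measurable_fun setT (fun x : R => x + c) by exact: measurable_funD.
rewrite -[RHS](@eq_measure_integral _ _ _ _ _ (pushforward mu ((fun x => x + c) : _ -> measurableTypeR R)))//.
  by rewrite ge0_integral_pushforward//= => y _.
by move=> A mA _; apply: lebesgue_measure_shift.
Qed.

End Translation.

Section FirstJump.
Context {R : realType} (m : zigzag_rates R).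
Local Notation E := (R * bool)%type.
Local Notation mu := (@lebesgue_measure R).
Local Notation a := (speed m).
Local Notation flow := (flow a).
Local Notation a_gt0 := (speed_gt0 m).
Local Notation lam_continuous := (@rate_continuous _ m).

Local Notation y0 := (rate_thr m).
Local Notation lam_min := (rate_min m).
Local Notation lam_min_gt0 := (rate_min_gt0 m).
Local Notation lam_ge_min := (@rate_ge_min _ m).
Local Notation surv := (surv m).
Local Notation dens := (dens m).
Local Notation hazard := (hazard m).

(** The flow never turns: after time t0 it stays in the region where the rate is
    at least lam_min. *)
Lemma hazard_ge_linear x : exists2 t0, 0 <= t0 &
  forall t, t0 <= t -> lam_min * (t - t0) <= hazard t x.
Proof.
exists (Num.max 0 ((y0 - vel R x.2 * x.1) / a)); first by rewrite le_max lexx.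
set t0 := Num.max _ _ => t t0t.
have t0_ge0 : 0 <= t0 by rewrite le_max lexx.
have -> : t = t0 + (t - t0) by ring.
rewrite hazardD [t0 + _ - _]addrAC subrr add0r.
have tt0 : 0 <= t - t0 by rewrite subr_ge0.
apply: (@le_trans _ _ (hazard (t - t0) (flow t0 x))); last first.
  by rewrite lerDr; exact: hazard_ge0.
rewrite -hazardE//.
rewrite -(Rintegral_cst_itv lam_min tt0).
apply: le_Rintegral => //.
- by apply: continuous_integrable_itv => ?; exact: cvg_cst.
- apply: continuous_integrable_itv; exact: (continuous_along_flow lam_continuous).
- move=> s /=; rewrite in_itv/= => /andP[s0 _].
  rewrite -flowD; apply: lam_ge_min => /=.
  rewrite mulrDr !mulrA.
  have -> : vel R x.2 * a * vel R x.2 = a.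
    by rewrite /vel; case: x.2; rewrite ?mulN1r ?mulrN1 ?opprK ?mul1r ?mulr1.
  rewrite -lerBlDl -ler_pdivrMl ?a_gt0// mulrC.
  apply: (@le_trans _ _ t0); first by rewrite le_max lexx orbT.
  by rewrite lerDl.
Qed.

(** The process jumps almost surely: without this, dens would have mass below 1. *)
Lemma surv_cvg0 x : surv t x @[t --> +oo] --> (0 : R).
Proof.
have [t0 t00 ht0] := hazard_ge_linear x.
apply/cvgrPdist_lt => e e0; near=> t.
rewrite sub0r normrN ger0_norm ?surv_ge0//.
have tt0 : t0 + (e * lam_min)^-1 < t by near: t; apply: nbhs_pinfty_gt; exact: num_real.
have el0 : 0 < (e * lam_min)^-1 by rewrite invr_gt0 mulr_gt0// lam_min_gt0.
have h1 : 1 / e < hazard t x.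
  apply: lt_le_trans (ht0 t _); last by lra.
  rewrite -ltr_pdivrMl ?lam_min_gt0//.
  have -> : lam_min^-1 * (1 / e) = (e * lam_min)^-1.
    by rewrite invfM mul1r mulrC.
  lra.
have h2 : 1 / e < expR (hazard t x).
  by apply: (lt_le_trans h1); apply: le_trans (expR_ge1Dx _); rewrite lerDr.
by rewrite /surv expRN invf_plt ?posrE ?expR_gt0// -div1r.
Unshelve. all: by end_near. Qed.

Lemma integral_dens_tail q x : 0 <= q ->
  (\int[mu]_(r in `[q, +oo[) (dens r x)%:E = (surv q x)%:E)%E.
Proof.
move=> q0.
have dS t := is_deriveN (is_derive_surv m t x).
have cS : continuous (fun t => - surv t x).
  by move=> t; apply: cvgN; exact: continuous_surv_time.
rewrite (@ge0_continuous_FTC2y _ (dens^~ x) (fun t => - surv t x) q 0).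
- by rewrite sub0e -EFinN opprK.
- by move=> t _; exact: dens_ge0.
- apply: continuous_subspaceT.
  exact: continuous_dens_time.
- by rewrite -oppr0; apply: cvgN; exact: surv_cvg0.
- by move=> t _; case: (dS t).
- exact/cvg_at_right_filter/cS.
- by move=> t _; rewrite derive1E; case: (dS t) => _ ->; rewrite opprK.
Qed.

(** The mean of h at the first jump time of the process started from x. *)
Definition jump_mean (h : R -> \bar R) (x : E) : \bar R :=
  (\int[mu]_(r in `[0%R, +oo[) (h r * (dens r x)%:E))%E.

Lemma measurable_dens_at x : measurable_fun setT (dens^~ x).
Proof.
apply: continuous_measurable_fun.
exact: continuous_dens_time.
Qed.

Lemma measurable_mul_dens (h : R -> \bar R) x : measurable_fun setT h ->
  measurable_fun setT (fun r => h r * (dens r x)%:E)%E.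
Proof.
move=> mh; apply: emeasurable_funM => //.
by apply/measurable_EFinP; exact: measurable_dens_at.
Qed.

Lemma jump_mean_ge0 h x : (forall r : R, (0 <= r)%R -> 0 <= h r)%E ->
  (0 <= jump_mean h x)%E.
Proof.
move=> h0; apply: integral_ge0 => r /=; rewrite in_itv/= andbT => r0.
by rewrite mule_ge0 ?h0// lee_fin dens_ge0.
Qed.

Lemma eq_jump_mean h1 h2 x : (forall r : R, 0 <= r -> h1 r = h2 r) ->
  jump_mean h1 x = jump_mean h2 x.
Proof.
by move=> h12; apply: eq_integral => r; rewrite inE/= in_itv/= andbT => /h12 ->.
Qed.

Lemma le_jump_mean h1 h2 x :
  measurable_fun setT h1 -> measurable_fun setT h2 ->
  (forall r : R, (0 <= r)%R -> 0 <= h1 r)%E ->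
  (forall r : R, (0 <= r)%R -> h1 r <= h2 r)%E ->
  (jump_mean h1 x <= jump_mean h2 x)%E.
Proof.
move=> m1 m2 h0 h12; apply: ge0_le_integral => //.
- move=> r /=; rewrite in_itv/= andbT => r0.
  by rewrite mule_ge0 ?h0// lee_fin dens_ge0.
- by apply/measurable_funTS; exact: measurable_mul_dens.
- by apply/measurable_funTS; exact: measurable_mul_dens.
- move=> r /=; rewrite in_itv/= andbT => r0.
  by apply: lee_wpmul2r; [rewrite lee_fin dens_ge0|exact: h12].
Qed.

Lemma jump_meanZ (c : \bar R) h x : (0 <= c)%E ->
  measurable_fun setT h -> (forall r, 0 <= h r)%E ->
  jump_mean (fun r => c * h r)%E x = (c * jump_mean h x)%E.
Proof.
move=> c0 mh h0; rewrite /jump_mean -ge0_integralZl//.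
- by apply: eq_integral => r _; rewrite muleA.
- by apply/measurable_funTS; exact: measurable_mul_dens.
- by move=> r _; rewrite mule_ge0// lee_fin dens_ge0.
Qed.

Lemma jump_mean_series (h : nat -> R -> \bar R) x :
  (forall n, measurable_fun setT (h n)) -> (forall n r, 0 <= h n r)%E ->
  jump_mean (fun r => \sum_(n <oo) h n r)%E x =
  (\sum_(n <oo) jump_mean (h n) x)%E.
Proof.
move=> mh h0; rewrite /jump_mean -integral_nneseries//.
- apply: eq_integral => r _; rewrite muleC -nneseriesZl//.
  by apply: eq_eseriesr => n _; rewrite muleC.
- by move=> n; by apply/measurable_funTS; exact: measurable_mul_dens.
- by move=> n r _; rewrite mule_ge0// lee_fin dens_ge0.
Qed.

Lemma jump_meanD h1 h2 x :
  measurable_fun setT h1 -> measurable_fun setT h2 ->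
  (forall r, 0 <= h1 r)%E -> (forall r, 0 <= h2 r)%E ->
  jump_mean (fun r => h1 r + h2 r)%E x = (jump_mean h1 x + jump_mean h2 x)%E.
Proof.
move=> m1 m2 p1 p2; rewrite /jump_mean -ge0_integralD//.
- by apply: eq_integral => r _; rewrite ge0_muleDl.
- by move=> r _; rewrite mule_ge0// lee_fin dens_ge0.
- by apply/measurable_funTS; exact: measurable_mul_dens.
- by move=> r _; rewrite mule_ge0// lee_fin dens_ge0.
- by apply/measurable_funTS; exact: measurable_mul_dens.
Qed.

(** The maximum with 0 accounts for the jump time being positive, so that
    all rays are covered, not only those in the half-line. *)
Lemma jump_mean_gt q x :
  jump_mean (fun r => (\1_`]q, +oo[%classic r)%:E) x = (surv (Num.max q 0) x)%:E.
Proof.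
rewrite -integral_dens_tail ?le_max ?lexx ?orbT//.
rewrite -integral_itv_obnd_cbnd; last first.
  by apply/measurable_funTS/measurable_EFinP; exact: measurable_dens_at.
rewrite /jump_mean.
transitivity (\int[mu]_(r in `[0%R, +oo[ `&` `]q, +oo[) (dens r x)%:E)%E.
  rewrite integral_mkcondr epatch_indic.
  by apply: eq_integral => r _; rewrite muleC.
have mdens (q' : R) : measurable_fun `]q', +oo[ (EFin \o dens^~ x).
  by apply/measurable_funTS/measurable_EFinP; exact: measurable_dens_at.
have [q0|q0] := leP 0 q.
  congr (integral _ _ _); apply/seteqP; split => r /=; rewrite !in_itv/= !andbT.
    by case.
  by move=> h; split => //; lra.
rewrite integral_itv_obnd_cbnd//; congr (integral _ _ _).
apply/seteqP; split => r /=; rewrite !in_itv/= !andbT; first by case.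
by move=> h; split => //; lra.
Qed.

(** Memorylessness: dens r x factors at time q into surv q x and the density of
    the process restarted from flow q x (densD). *)
Lemma jump_mean_shift q h x : 0 <= q ->
  measurable_fun setT h -> (forall r, 0 <= h r)%E ->
  jump_mean (fun r => h r * (\1_`]q, +oo[%classic r)%:E)%E x =
  ((surv q x)%:E * jump_mean (fun r => h (q + r)%R) (flow q x))%E.
Proof.
move=> q0 mh h0; rewrite /jump_mean -ge0_integralZl//; last first.
- by rewrite lee_fin surv_ge0.
- by move=> r _; rewrite mule_ge0// lee_fin dens_ge0.
- apply: measurable_funTS; apply: (@measurable_mul_dens (fun r => h (q + r))).
  by apply: (measurableT_comp mh (g := fun r => q + r)); exact: measurable_funD.
pose f r := (h r * (dens r x)%:E * (\1_`[q, +oo[%classic r)%:E)%E.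
have mf : measurable_fun setT f.
  apply: emeasurable_funM; first exact: measurable_mul_dens.
  by apply/measurable_EFinP; exact: measurable_indic.
have f0 r : (0 <= f r)%E.
  by rewrite !mule_ge0// lee_fin ?indicE ?dens_ge0.
transitivity (\int[mu]_r f r)%E; last first.
  rewrite -(ge0_integral_shift q)// [RHS]integral_mkcond.
  apply: eq_integral => r _; rewrite epatch_indic /f.
  have -> : \1_`[q, +oo[%classic (r + q) = \1_`[0, +oo[%classic r :> R.
    by rewrite !indicE !mem_setE !in_itv/= !andbT lerDr.
  by rewrite addrC densD EFinM; rewrite !muleA; congr (_ * _)%E; rewrite -!muleA; rewrite muleCA.
transitivity (\int[mu]_(r in `]q, +oo[) (h r * (dens r x)%:E))%E.
  transitivity (\int[mu]_(r in `[0%R, +oo[ `&` `]q, +oo[) (h r * (dens r x)%:E))%E.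
    rewrite integral_mkcondr epatch_indic.
    by apply: eq_integral => r _; rewrite muleAC.
  congr (integral _ _ _).
  apply/seteqP; split => r /=; rewrite !in_itv/= !andbT; first by case.
  by move=> rq; split => //; lra.
rewrite integral_itv_obnd_cbnd; last by apply/measurable_funTS; exact: measurable_mul_dens.
by rewrite integral_mkcond epatch_indic.
Qed.

Lemma measurable_jump_mean d (T : measurableType d) (g : R * T -> \bar R)
    (phi : T -> E) : measurable_fun setT g -> (forall p, 0 <= g p)%E ->
  measurable_fun setT phi ->
  measurable_fun setT (fun w => jump_mean (fun r => g (r, w)) (phi w)).
Proof.
move=> mg g0 mphi.
pose f (p : T * R) := (g (p.2, p.1) * (dens p.2 (phi p.1))%:E *
  (\1_`[0, +oo[%classic p.2)%:E)%E.
have mf : measurable_fun setT f.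
  have m1 : measurable_fun setT (fun p : T * R => (p.2, p.1)).
    by apply: measurable_fun_pair; [exact: measurable_snd|exact: measurable_fst].
  have m2 : measurable_fun setT (fun p : T * R => (p.2, phi p.1)).
    apply: measurable_fun_pair; first exact: measurable_snd.
    exact: (measurableT_comp mphi measurable_fst).
  have m3 := measurableT_comp
    (measurable_dens m) m2.
  have m4 := measurableT_comp (@measurable_indic _ _ R setT _
    (measurable_itv `[0%R, +oo[)) (@measurable_snd _ _ T R).
  apply: emeasurable_funM; [apply: emeasurable_funM|].
  - exact: (measurableT_comp mg m1).
  - exact/measurable_EFinP.
  - exact/measurable_EFinP.
have f0 p : (0 <= f p)%E by rewrite !mule_ge0// lee_fin ?indicE ?dens_ge0.
have := @measurable_fun_fubini_tonelli_F _ _ _ _ _ mu f mf f0.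
congr measurable_fun; apply/funext => w.
by rewrite /fubini_F /jump_mean [RHS]integral_mkcond epatch_indic.
Qed.

End FirstJump.

(** * The jump chain *)

Section JumpChain.
Context {R : realType} (m : zigzag_rates R).
Local Notation E := (R * bool)%type.
Local Notation a := (speed m).
Local Notation flow := (flow a).

Definition next_jump (r : R) (c : R * E) : R * E := (c.1 + r, flip (flow r c.2)).

Lemma jump_chainS (x : E) (z : nat -> R) n :
  jump_chain a x z n.+1 = next_jump (z n) (jump_chain a x z n).
Proof. by rewrite /=; case: jump_chain. Qed.

Lemma measurable_next_jump :
  measurable_fun setT (fun p : R * (R * E) => next_jump p.1 p.2).
Proof.
apply: measurable_fun_pair.
  apply: measurable_funD => //.
  exact: (measurableT_comp measurable_fst measurable_snd).
apply: (measurableT_comp measurable_flip).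
apply: (measurableT_comp (measurable_flow a) (g := fun p : R * (R * E) => (p.1, p.2.2))).
apply: measurable_fun_pair; first exact: measurable_fst.
exact: (measurableT_comp measurable_snd measurable_snd).
Qed.

Lemma measurable_jump_chain d (T : measurableType d) (x : E) (z : nat -> T -> R) n :
  (forall k, (k < n)%N -> measurable_fun setT (z k)) ->
  measurable_fun setT (fun w => jump_chain a x (z^~ w) n).
Proof.
elim: n => [|n IH] mz; first exact: measurable_cst.
under eq_fun do rewrite jump_chainS.
apply: (measurableT_comp measurable_next_jump (g := fun w => (z n w, _))).
apply: measurable_fun_pair; first exact: mz.
by apply: IH => k kn; apply: mz; exact: ltnW.
Qed.

Section History.
Context {d} {T : measurableType d} (z : nat -> T -> R).

Definition history (n : nat) : set_system T :=
  g_sigma_preimage (fun i : 'I_n => z i).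

Lemma measurable_history n k : (k < n)%N ->
  measurable_fun setT (z k : g_sigma_algebraType (history n) -> R).
Proof.
move=> kn _ B mB; apply: sub_sigma_algebra; apply: sub_sigma_algebra.
rewrite (bigD1 (Ordinal kn))//=; left.
by exists B.
Qed.

Lemma history_measurable n (A : set (g_sigma_algebraType (history n))) :
  measurable A -> history n A.
Proof.
apply: smallest_sub; first exact: smallest_sigma_algebra.
by move=> B.
Qed.

Lemma history_le n k : (n <= k)%N -> history n `<=` history k.
Proof.
move=> nk; apply: smallest_sub; first exact: smallest_sigma_algebra.
apply: (@big_ind _ (fun B : set_system T => B `<=` history k)) => //.
- by move=> A B hA hB C [/hA|/hB].
- move=> i _ _ [B mB <-].
apply: history_measurable; apply: measurable_history => //.
exact: leq_trans nk.
Qed.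

Lemma history_sub n : (forall k, measurable_fun setT (z k)) ->
  history n `<=` measurable.
Proof.
move=> mz; apply: smallest_sub; first exact: sigma_algebra_measurable.
apply: (@big_ind _ (fun B : set_system T => B `<=` measurable)) => //.
- by move=> A B hA hB C [/hA|/hB].
- by move=> i _ _ [B mB <-]; exact: mz.
Qed.

Lemma history_chain (x : E) n (B : set (R * E)) : measurable B ->
  history n ((fun w => jump_chain a x (z^~ w) n) @^-1` B).
Proof.
move=> mB; rewrite -[X in history _ X]setTI; apply: history_measurable.
apply: measurable_jump_chain => // k kn; exact: measurable_history.
Qed.

Lemma historyI n A B : history n A -> history n B -> history n (A `&` B).
Proof.
move=> hA hB; apply: history_measurable.
by apply: measurableI; exact: sub_sigma_algebra.
Qed.

Lemma historyT n : history n setT.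
Proof. by apply: history_measurable; exact: measurableT. Qed.

End History.

End JumpChain.

Section LinearFunctionals.
Context {R : realType}.

Lemma countably_linear_integral d1 d2 (T : measurableType d1) (Y : measurableType d2)
    (P : {measure set T -> \bar R}) (A : set T) (psi : T -> Y) :
  measurable A -> measurable_fun setT psi ->
  countably_linear (fun h : Y -> \bar R => \int[P]_(w in A) h (psi w))%E.
Proof.
move=> mA mpsi; split=> [h h0|c h c0 [mh h0]|h_ mh].
- by apply: integral_ge0 => w _.
- rewrite ge0_integralZl//; first exact/measurable_funTS/(measurableT_comp mh).
- rewrite integral_nneseries//.
    by move=> n; case: (mh n) => mhn _; exact/measurable_funTS/(measurableT_comp mhn).
  by move=> n w _; case: (mh n).
Qed.

Lemma countably_linear_comp d1 d2 (X : measurableType d1) (Y : measurableType d2)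
    (I : (X -> \bar R) -> \bar R) (pi : X -> Y) :
  countably_linear I -> measurable_fun setT pi ->
  countably_linear (fun h : Y -> \bar R => I (h \o pi)).
Proof.
move=> [I0 IZ Is] mpi; split=> [h h0|c h c0 [mh h0]|h_ mh].
- by apply: I0 => x /=.
- by rewrite -IZ//; split=> [|x /=//]; exact: measurableT_comp mh mpi.
- rewrite -Is// => n; case: (mh n) => mhn hn0.
  by split=> [|x /=//]; exact: measurableT_comp mhn mpi.
Qed.

Lemma countably_linear_jump_mean (m : zigzag_rates R) d1 d2
    (T : measurableType d1) (X : measurableType d2)
    (P : {measure set T -> \bar R}) (A : set T) (c : T -> X) (phi : T -> R * bool) :
  measurable A -> measurable_fun setT c -> measurable_fun setT phi ->
  countably_linear (fun h : R * X -> \bar R =>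
    \int[P]_(w in A) jump_mean m (fun r => h (r, c w)) (phi w))%E.
Proof.
move=> mA mc mphi.
have mhc (h : R * X -> \bar R) : ge0_measurable h ->
    measurable_fun setT (fun p : R * T => h (p.1, c p.2)).
  move=> [mh h0]; apply: (measurableT_comp mh (g := fun p : R * T => (p.1, c p.2))).
  by apply: measurable_fun_pair => //; exact: measurableT_comp.
have mh1 (h : R * X -> \bar R) w : ge0_measurable h ->
    measurable_fun setT (fun r => h (r, c w)).
  move=> [mh h0]; apply: (measurableT_comp mh (g := fun r => (r, c w))).
  exact: measurable_fun_pair.
have mj (h : R * X -> \bar R) : ge0_measurable h ->
    measurable_fun A (fun w => jump_mean m (fun r => h (r, c w)) (phi w)).
  move=> mh; apply: measurable_funTS.
  apply: (@measurable_jump_mean _ m _ _ (fun p => h (p.1, c p.2))) => //.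
    exact: mhc.
  by move=> p; case: mh.
split=> [h h0|k h k0 mh|h_ mh].
- by apply: integral_ge0 => w _; exact: jump_mean_ge0.
- rewrite -ge0_integralZl//; last 2 first.
  + exact: mj.
  + by move=> w _; apply: jump_mean_ge0 => r _; case: mh.
  apply: eq_integral => w _; rewrite jump_meanZ//; first exact: mh1.
  by move=> r; case: mh.
- rewrite -integral_nneseries//; last 2 first.
  + by move=> n; exact: mj.
  + by move=> n w _; apply: jump_mean_ge0 => r _; case: (mh n).
  apply: eq_integral => w _; rewrite jump_mean_series//.
  + by move=> n; exact: mh1.
  + by move=> n r; case: (mh n).
Qed.

End LinearFunctionals.

Section OneStep.
Context {R : realType} (m : zigzag_rates R).
Local Notation E := (R * bool)%type.
Local Notation a := (speed m).
Local Notation lam := (rate m).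
Local Notation surv := (surv m).
Local Notation jump_mean := (jump_mean m).
Context {d} {T : measurableType d} (P : probability T R) (x : E)
  (Z : nat -> {RV P >-> R}).
Hypothesis Z_law : waiting_times a lam x Z.

Local Notation chain n w := (jump_chain a x (fun k => Z k w) n).
Local Notation hist := (history (fun k => Z k : T -> R)).

Lemma measurable_waiting n : measurable_fun setT (Z n : T -> R).
Proof. exact: measurable_funPT. Qed.

Lemma measurable_hist n A : hist n A -> measurable A.
Proof. exact: (history_sub measurable_waiting). Qed.

Lemma measurable_chain n : measurable_fun setT (fun w => chain n w).
Proof. by apply: measurable_jump_chain => k _; exact: measurable_waiting. Qed.

Lemma measurable_chain_state n : measurable_fun setT (fun w => (chain n w).2).
Proof. exact: (measurableT_comp measurable_snd (measurable_chain n)). Qed.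

Lemma measurable_waiting_tail t n :
  measurable_fun setT (fun w => (\1_`]t, +oo[%classic (Z n w))%:E : \bar R).
Proof.
apply/measurable_EFinP; apply: measurableT_comp; last exact: measurable_waiting.
exact: measurable_indic.
Qed.

Lemma waiting_tail_ge0 t n A : 0 <= t -> hist n A ->
  (\int[P]_(w in A) (\1_`]t, +oo[%classic (Z n w))%:E =
   \int[P]_(w in A) (surv t (chain n w).2)%:E)%E.
Proof.
move=> t0 hA; have [_ _ _ law] := Z_law n t0.
transitivity (\int[P]_(w in A) (\1_[set w | t < Z n w] w)%:E)%E.
  apply: eq_integral => w _; congr (_%:E); rewrite !indicE; congr ((nat_of_bool _)%:R).
  by apply/idP/idP; rewrite !inE/= in_itv/= andbT.
rewrite -law//; apply: eq_integral => w _; by rewrite survivalE.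
Qed.

(** The law of the waiting times is given for t >= 0; at t = 0 it says that Z_n is
    positive almost surely, which settles negative t. *)
Lemma waiting_tail t n A : hist n A ->
  (\int[P]_(w in A) (\1_`]t, +oo[%classic (Z n w))%:E =
   \int[P]_(w in A) (surv (Num.max t 0) (chain n w).2)%:E)%E.
Proof.
move=> hA; have mA := measurable_hist hA.
have [t0|t0] := leP 0 t; first exact: waiting_tail_ge0.
rewrite -(waiting_tail_ge0 (lexx 0))//.
apply/eqP; rewrite eq_le; apply/andP; split; last first.
  apply: ge0_le_integral => //.
  - exact/measurable_funTS/measurable_waiting_tail.
  - exact/measurable_funTS/measurable_waiting_tail.
  - move=> w _; rewrite lee_fin !indicE ler_nat !mem_setE !in_itv/= !andbT.
    by case: (ltP 0 (Z n w)) => // Z0; rewrite (lt_trans t0).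
rewrite waiting_tail_ge0//.
under [X in (_ <= X)%E]eq_integral do rewrite surv0.
apply: ge0_le_integral => //.
- exact/measurable_funTS/measurable_waiting_tail.
- by move=> w _; rewrite lee_fin indicE lern1; case: (_ \in _).
Qed.

(** The law of Z_n given the past is prescribed on rays, which determine it on all
    functions of Z_n alone.  An event about the current chain state belongs to
    the past and can be absorbed into A; products of the two kinds of events
    generate the functions of both variables. *)
Lemma one_step n A (h : R * (R * E) -> \bar R) : hist n A -> ge0_measurable h ->
  (\int[P]_(w in A) h (Z n w, chain n w) =
   \int[P]_(w in A) jump_mean (fun r => h (r, chain n w)) (chain n w).2)%E.
Proof.
move: A => A0 + mh.
pose I1 A (h : R * (R * E) -> \bar R) := (\int[P]_(w in A) h (Z n w, chain n w))%E.
pose I2 A (h : R * (R * E) -> \bar R) :=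
  (\int[P]_(w in A) jump_mean (fun r => h (r, chain n w)) (chain n w).2)%E.
have l1 A : hist n A -> countably_linear (I1 A).
  move=> /measurable_hist mA; apply: countably_linear_integral => //.
  by apply: measurable_fun_pair; [exact: measurable_waiting|exact: measurable_chain].
have l2 A : hist n A -> countably_linear (I2 A).
  move=> /measurable_hist mA; apply: countably_linear_jump_mean => //.
  - exact: measurable_chain.
  - exact: measurable_chain_state.
have I1_le1 A g : hist n A -> measurable_fun setT g -> (forall p, 0 <= g p <= 1)%E ->
    (I1 A g < +oo)%E.
  move=> hA mg g01; apply: (@le_lt_trans _ _ (\int[P]_(w in A) 1)%E).
    apply: ge0_le_integral => //.
    - exact: measurable_hist hA.
    - by move=> w _; case/andP: (g01 (Z n w, chain n w)).
    - apply/measurable_funTS/(measurableT_comp mg).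
      by apply: measurable_fun_pair; [exact: measurable_waiting|exact: measurable_chain].
    - by move=> w _; case/andP: (g01 (Z n w, chain n w)).
  rewrite integral_cst ?mul1e; last exact: measurable_hist hA.
  by rewrite ltey_eq fin_num_measure//; exact: measurable_hist hA.
have step1 A (u : R -> \bar R) : hist n A -> ge0_measurable u ->
    I1 A (u \o fst) = I2 A (u \o fst).
  move=> hA; move: u.
  apply: (@countably_linear_unique_rays R (fun u => I1 A (u \o fst)) (fun u => I2 A (u \o fst))).
  - by apply: countably_linear_comp; [exact: l1|exact: measurable_fst].
  - by apply: countably_linear_comp; [exact: l2|exact: measurable_fst].
  - move=> t; rewrite /I1 /I2/= waiting_tail//.
    by apply: eq_integral => w _; rewrite jump_mean_gt.
  - move=> t; apply: I1_le1 => //.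
      apply: measurableT_comp; last exact: measurable_fst.
      by apply/measurable_EFinP; exact: measurable_indic.
    by move=> p /=; rewrite !lee_fin indicE ler0n lern1; case: (_ \in _).
move=> hA.
pose G := [set B | exists U D, [/\ measurable U, measurable D & B = U `*` D]] : set_system (R * (R * E)).
apply: (@countably_linear_unique _ _ _ G (fun=> setT) _ _ _ _ (I1 A0) (I2 A0)) => //.
- rewrite measurable_prod_measurableType; congr (<<s _ >>).
  apply/seteqP; split => [_ [U mU [D mD <-]]|_ [U [D [mU mD ->]]]].
    by exists U, D.
  by exists U => //; exists D.
- move=> _ _ [U1 [D1 [mU1 mD1 ->]]] [U2 [D2 [mU2 mD2 ->]]].
  exists (U1 `&` U2), (D1 `&` D2); split; [exact: measurableI|exact: measurableI|].
  by rewrite setXI.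
- by move=> _; exists setT, setT; split => //; rewrite setXTT.
- by rewrite bigcup_const.
- exact: l1.
- exact: l2.
- move=> _ [U [D [mU mD ->]]].
  have hAD := historyI hA (@history_chain _ m _ _ (fun k => Z k : T -> R) x n _ mD).
  have := step1 _ (fun r => (\1_U r)%:E) hAD (ge0_measurable_indic mU).
  rewrite /I1 /I2 !integral_mkcondr => e.
  transitivity (\int[P]_(w in A0) (((fun w => (\1_U (Z n w))%:E) \_
     ((fun w => chain n w) @^-1` D)) w))%E.
    apply: eq_integral => w _; rewrite patchE/=.
    have -> : (w \in (fun w => chain n w) @^-1` D) = (chain n w \in D).
      by apply/idP/idP; rewrite !inE.
    rewrite !indicE in_setX/=; case: (chain n w \in D); rewrite ?andbT ?andbF//.
  rewrite e; apply: eq_integral => w _; rewrite patchE/=.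
  have -> : (w \in (fun w => chain n w) @^-1` D) = (chain n w \in D).
    by apply/idP/idP; rewrite !inE.
  case: ifPn => [wD|/negbTE wD].
    by apply: eq_jump_mean => r _; rewrite !indicE in_setX/= wD andbT.
  apply/esym; rewrite -[RHS](_ : jump_mean (fun=> 0%E) (chain n w).2 = 0%E).
    by apply: eq_jump_mean => r _; rewrite !indicE in_setX/= wD andbF.
  by rewrite /jump_mean integral0_eq// => r _; rewrite mul0e.
- move=> k; apply: I1_le1 => //.
    by apply/measurable_EFinP; exact: measurable_indic.
  by move=> p /=; rewrite !lee_fin indicE ler0n lern1; case: (_ \in _).
Qed.

End OneStep.

(** * Paths *)

Section Paths.
Context {R : realType} (m : zigzag_rates R).
Local Notation E := (R * bool)%type.
Local Notation a := (speed m).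
Local Notation flow := (flow a).
Implicit Types (x : E) (z : nat -> R) (r s t : R) (n k : nat).
Local Notation chain x z n := (jump_chain a x z n).

(** The number n of jumps up to time t, as zigzag_path computes it.  It is phrased
    through all earlier jump times because z is an arbitrary real sequence, whose
    jump times need not be monotone. *)
Definition phase x z t n : Prop :=
  t < (chain x z n.+1).1 /\ forall i, (i < n)%N -> (chain x z i.+1).1 <= t.

Lemma phase_path x z t n : phase x z t n ->
  zigzag_path a x z t = flow (t - (chain x z n).1) (chain x z n).2.
Proof.
move=> [tn nmin]; rewrite /zigzag_path; case: pselect => [ex|]; last first.
  by case; exists n.
case: ex_minnP => k tk kmin /=.
suff -> : k = n by [].
apply/eqP; rewrite eqn_leq kmin//= leqNgt; apply/negP => kn.
by have := nmin _ kn; rewrite leNgt [_ < _]tk.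
Qed.

Lemma no_phase_path x z t : (forall n, (chain x z n.+1).1 <= t) ->
  zigzag_path a x z t = x.
Proof.
move=> h; rewrite /zigzag_path; case: pselect => // -[n] tn.
by have := h n; rewrite leNgt [_ < _]tn.
Qed.

Lemma phase_le x z t n : t < (chain x z n.+1).1 ->
  exists2 k, (k <= n)%N & phase x z t k.
Proof.
move=> tn; have ex : exists n, t < (chain x z n.+1).1 by exists n.
case: (ex_minnP ex) => k tk kmin; exists k; first exact: kmin.
split=> // i ik; rewrite leNgt; apply/negP => ti.
by have := kmin _ ti; rewrite leqNgt ik.
Qed.

Lemma phase_exists x z t :
  (exists n, phase x z t n) \/ (forall n, (chain x z n.+1).1 <= t).
Proof.
have [[n tn]|h] := pselect (exists n, t < (chain x z n.+1).1).
  by left; have [k _ ?] := phase_le tn; exists k.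
by right => n; rewrite leNgt; apply/negP => tn; apply: h; exists n.
Qed.

Lemma phase_unique x z t n k : phase x z t n -> phase x z t k -> n = k.
Proof.
move=> [tn nmin] [tk kmin]; have [nk|kn|//] := ltngtP n k.
  by have := kmin _ nk; rewrite leNgt tn.
by have := nmin _ kn; rewrite leNgt tk.
Qed.

(** The number of jumps is locally constant to the right, and between jumps the
    path follows the flow; from the explosion time on the path is constant by
    convention, so no exceptional paths have to be excluded. *)
Lemma path_right_continuous x z t :
  zigzag_path a x z s @[s --> t^'+] --> (zigzag_path a x z t : E).
Proof.
have [[n tn]|h] := phase_exists x z t; last first.
  rewrite (no_phase_path h).
  have : cst x s @[s --> t^'+] --> x by exact: cvg_cst.
  apply: cvg_trans; apply: near_eq_cvg; near=> s => /=.
  rewrite no_phase_path// => n; apply: (le_trans (h n)).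
  by apply: ltW; near: s; exact: nbhs_right_gt.
rewrite (phase_path tn).
have : flow (s - (chain x z n).1) (chain x z n).2 @[s --> t^'+] -->
    flow (t - (chain x z n).1) (chain x z n).2.
  rewrite {2}/flow /flow; apply: cvg_state; apply: cvg_at_right_filter.
  apply: cvgD; first exact: cvg_cst.
  apply: cvgM; first exact: cvg_cst.
  by apply: cvgB; [exact: cvg_id|exact: cvg_cst].
apply: cvg_trans; apply: near_eq_cvg; near=> s => /=.
rewrite (@phase_path _ _ s n)//; split.
  by near: s; apply: nbhs_right_lt; case: (tn).
move=> i /(proj2 tn) h; apply: (le_trans h).
by apply: ltW; near: s; exact: nbhs_right_gt.
Unshelve. all: by end_near. Qed.

Lemma eq_chain x z z' n : (forall i, (i < n)%N -> z i = z' i) ->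
  chain x z n = chain x z' n.
Proof.
elim: n => [//|n IH] zz'; rewrite !jump_chainS zz'// IH// => i i_n.
by apply: zz'; exact: ltnW.
Qed.

(** At any time r <= s at most n jumps have occurred, for both sequences, and the
    first n jumps are determined by the common waiting times. *)
Lemma path_local x z z' n r s : phase x z s n ->
  (forall i, (i < n)%N -> z i = z' i) -> s < (chain x z' n.+1).1 -> r <= s ->
  zigzag_path a x z r = zigzag_path a x z' r.
Proof.
move=> [sn _] zz' sn' rs.
have [k kn [rk kmin]] := phase_le (le_lt_trans rs sn).
have ck i : (i <= n)%N -> chain x z i = chain x z' i.
  by move=> i_n; apply: eq_chain => j ji; apply: zz'; exact: leq_trans i_n.
have phk' : phase x z' r k.
  split.
    move: kn rk; rewrite leq_eqVlt => /predU1P[->|kn] rk.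
      exact: le_lt_trans sn'.
    by rewrite -ck.
  by move=> i ik; rewrite -ck ?kmin//; exact: leq_trans kn.
by rewrite (phase_path (conj rk kmin)) (phase_path phk') ck.
Qed.

(** Makes the path up to time s a function of the first n waiting times: when there
    are n jumps up to time s, waiting until s + 1 for the next one changes nothing
    before s. *)
Definition cut_waiting x s n z (i : nat) : R :=
  if (i < n)%N then z i else s + 1 - (chain x z n).1.

Lemma path_cut_waiting x z n r s : phase x z s n -> r <= s ->
  zigzag_path a x z r = zigzag_path a x (cut_waiting x s n z) r.
Proof.
move=> sn; apply: (path_local sn) => [i i_n|].
  by rewrite /cut_waiting i_n.
rewrite jump_chainS /= -(@eq_chain _ z) => [|i i_n]; last by rewrite /cut_waiting i_n.
by rewrite /cut_waiting ltnn; lra.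
Qed.

Section Measurability.
Context {d} {T : measurableType d} (x : E) (z : nat -> T -> R).
Hypothesis mz : forall n, measurable_fun setT (z n).

Let mchain n : measurable_fun setT (fun w => chain x (z^~ w) n).
Proof. by apply: measurable_jump_chain => k _. Qed.

Lemma measurable_jump_time n : measurable_fun setT (fun w => (chain x (z^~ w) n).1).
Proof. exact: (measurableT_comp measurable_fst (mchain n)). Qed.

Lemma measurable_jump_gt t n : measurable [set w | t < (chain x (z^~ w) n).1].
Proof.
rewrite -[X in measurable X]setTI.
have -> : [set w | t < (chain x (z^~ w) n).1] =
  (fun w => (chain x (z^~ w) n).1) @^-1` `]t, +oo[%classic.
  by apply/seteqP; split => w /=; rewrite in_itv/= andbT.
exact: measurable_jump_time.
Qed.

Lemma measurable_jump_le t n : measurable [set w | (chain x (z^~ w) n).1 <= t].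
Proof.
have -> : [set w | (chain x (z^~ w) n).1 <= t] =
  ~` [set w | t < (chain x (z^~ w) n).1].
  by apply/seteqP; split => w /=; rewrite leNgt => /negP.
exact/measurableC/measurable_jump_gt.
Qed.

Lemma measurable_phase t n : measurable [set w | phase x (z^~ w) t n].
Proof.
have -> : [set w | phase x (z^~ w) t n] = [set w | t < (chain x (z^~ w) n.+1).1] `&`
    \bigcap_(i in `I_n) [set w | (chain x (z^~ w) i.+1).1 <= t].
  by apply/seteqP; split => w [h1 h2]; split => // i /h2.
apply: measurableI; first exact: measurable_jump_gt.
by apply: bigcap_measurableType => i _; exact: measurable_jump_le.
Qed.

Lemma measurable_path t : measurable_fun setT (fun w => zigzag_path a x (z^~ w) t).
Proof.
move=> _ B mB; rewrite setTI.
pose X n w := flow (t - (chain x (z^~ w) n).1) (chain x (z^~ w) n).2.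
have mX n : measurable_fun setT (X n).
  apply: (measurableT_comp (measurable_flow a)
    (g := fun w => (t - (chain x (z^~ w) n).1, (chain x (z^~ w) n).2))).
  apply: measurable_fun_pair; first by apply: measurable_funB => //; exact: measurable_jump_time.
  exact: (measurableT_comp measurable_snd (mchain n)).
have -> : (fun w => zigzag_path a x (z^~ w) t) @^-1` B =
  \bigcup_n ([set w | phase x (z^~ w) t n] `&` X n @^-1` B) `|`
  (\bigcap_n [set w | (chain x (z^~ w) n.+1).1 <= t] `&` [set _ | B x]).
  apply/seteqP; split => w /=.
    have [[n tn]|h] := phase_exists x (z^~ w) t.
      by rewrite (phase_path tn) => BX; left; exists n.
    by rewrite no_phase_path// => Bx; right; split => // n _; exact: h.
  move=> [[n _ [tn]]|[h Bx]]; first by rewrite (phase_path tn).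
  by rewrite no_phase_path// => n; exact: h.
apply: measurableU.
  apply: bigcup_measurable => n _; apply: measurableI; first exact: measurable_phase.
  by rewrite -[X in measurable X]setTI; exact: mX.
apply: measurableI.
  by apply: bigcapT_measurable => n; exact: measurable_jump_le.
have [Bx|nBx] := pselect (B x).
  by rewrite (_ : [set _ | _] = setT)//; apply/seteqP; split.
by rewrite (_ : [set _ | _] = set0)//; apply/seteqP; split.
Qed.

End Measurability.

End Paths.

(** * The jump operator *)

Section JumpOperator.
Context {R : realType} (m : zigzag_rates R).
Local Notation E := (R * bool)%type.
Local Notation mu := (@lebesgue_measure R).
Local Notation a := (speed m).
Local Notation lam := (rate m).
Local Notation flow := (flow a).
Local Notation dens := (dens m).
Local Notation jump_mean := (jump_mean m).
Implicit Types (g : R * E -> \bar R) (p : R * E).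

(** The first component of p is the time that is left and the second one the
    current state: kstep averages g over the next jump, which uses up its waiting
    time and flips the velocity. *)
Definition kstep g p : \bar R :=
  jump_mean (fun r => g (p.1 - r, flip (flow r p.2))) p.2.

Lemma measurable_after_jump :
  measurable_fun setT (fun q : R * (R * E) => (q.2.1 - q.1, flip (flow q.1 q.2.2))).
Proof.
apply: measurable_fun_pair.
  apply: measurable_funB => //.
  exact: (measurableT_comp measurable_fst measurable_snd).
apply: (measurableT_comp measurable_flip).
apply: (measurableT_comp (measurable_flow a) (g := fun q : R * (R * E) => (q.1, q.2.2))).
apply: measurable_fun_pair; first exact: measurable_fst.
exact: (measurableT_comp measurable_snd measurable_snd).
Qed.

Lemma measurable_after_jump_at g p : ge0_measurable g ->
  measurable_fun setT (fun r : R => g (p.1 - r, flip (flow r p.2))).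
Proof.
move=> [mg _]; apply: (measurableT_comp (measurableT_comp mg measurable_after_jump)
  (g := fun r : R => (r, p))).
exact: measurable_fun_pair.
Qed.

Lemma ge0_measurable_kstep g : ge0_measurable g -> ge0_measurable (kstep g).
Proof.
move=> [mg g0]; split; last by move=> p; apply: jump_mean_ge0 => r _; exact: g0.
have mg' : measurable_fun setT
    (fun q : R * (R * E) => g (q.2.1 - q.1, flip (flow q.1 q.2.2))).
  exact: (measurableT_comp mg measurable_after_jump).
exact: (@measurable_jump_mean _ m _ _ _ snd mg' (fun q => g0 _) measurable_snd).
Qed.

Lemma ge0_measurable_iter n g : ge0_measurable g -> ge0_measurable (iter n kstep g).
Proof. by move=> mg; elim: n => //= n IH; exact: ge0_measurable_kstep. Qed.

Lemma iter_kstep_lt0 n g p : (forall q, q.1 < 0 -> g q = 0%E) -> p.1 < 0 ->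
  iter n kstep g p = 0%E.
Proof.
move=> g0; elim: n p => [|n IH] p p0 /=; first exact: g0.
rewrite /kstep -[RHS](_ : jump_mean (fun=> 0%E) p.2 = 0%E).
  by apply: eq_jump_mean => r r0; rewrite IH//=; lra.
by rewrite /jump_mean integral0_eq// => r _; rewrite mul0e.
Qed.

Lemma kstep_series (h : nat -> R * E -> \bar R) p :
  (forall n, ge0_measurable (h n)) ->
  kstep (fun q => \sum_(n <oo) h n q)%E p = (\sum_(n <oo) kstep (h n) p)%E.
Proof.
move=> mh; rewrite /kstep jump_mean_series//.
  by move=> n; exact: measurable_after_jump_at.
by move=> n r; case: (mh n).
Qed.

(** Its n-th iterate under kstep is the probability that n jumps fit into the time
    that is left. *)
Definition nonneg_time p : \bar R := (\1_[set q : R * E | 0 <= q.1] p)%:E.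

Lemma nonneg_timeE p : nonneg_time p = ((0 <= p.1)%R%:R)%:E.
Proof.
by rewrite /nonneg_time indicE; congr ((nat_of_bool _)%:R%:E); apply/idP/idP;
  rewrite !inE.
Qed.

Lemma ge0_measurable_nonneg_time : ge0_measurable nonneg_time.
Proof.
apply: ge0_measurable_indic; rewrite -[X in measurable X]setTI.
have -> : [set q : R * E | 0 <= q.1] = fst @^-1` `[0, +oo[%classic.
  by apply/seteqP; split => q /=; rewrite in_itv/= andbT.
exact: measurable_fst.
Qed.

(** Continuity on a compact set.  Since the speed is finite, the process stays in
    such a set up to any given time. *)
Lemma rate_bounded (c : R) : exists2 M, 0 < M &
  forall x : E, `|x.1| <= c -> lam x <= M.
Proof.
have [c0|c0] := ltP c 0.
  by exists 1 => // x xc; have := normr_ge0 x.1; lra.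
have bnd j : exists M, forall y : R, `|y| <= c -> lam (y, j) <= M.
  have [||y _ hy] := @EVT_max R (fun y => lam (y, j)) (- c) c; first lra.
    apply: continuous_subspaceT.
    by have /continuous_branchP := @rate_continuous _ m; exact.
  by exists (lam (y, j)) => z; rewrite ler_norml => zc; apply: hy; rewrite in_itv.
have [M1 h1] := bnd true; have [M2 h2] := bnd false.
exists (`|M1| + `|M2| + 1); first by rewrite ltr_wpDl.
have n1 := ler_norm M1; have n2 := ler_norm M2.
have := normr_ge0 M1; have := normr_ge0 M2 => ? ?.
by move=> [y []] /= yc; [have := h1 _ yc|have := h2 _ yc]; lra.
Qed.

Lemma flow_bound c t r x : `|x.1| + a * t <= c -> 0 <= r ->
  `|(flow r x).1| + a * (t - r) <= c.
Proof.
move=> xc r0; have := flow_dist a r x.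
rewrite (ger0_norm r0) (gtr0_norm (speed_gt0 m)) => e.
have := ler_distD x.1 (flow r x).1 0; rewrite !subr0 e.
rewrite mulrBr; lra.
Qed.

(** Up to time t the density of the next jump is at most M.  The weight
    exp(2 M t) turns this into a factor one half for each jump, as the integral of
    M exp(2 M (t - r)) over [0, t] is at most exp(2 M t) / 2. *)
Lemma iter_nonneg_time_le (M c : R) n (t : R) x : 0 < M ->
  (forall x : E, `|x.1| <= c -> lam x <= M) ->
  0 <= t -> `|x.1| + a * t <= c ->
  (iter n kstep nonneg_time (t, x) <= (expR (2 * M * t) * 2^-1 ^+ n)%:E)%E.
Proof.
move=> M0 lamM; elim: n t x => [|n IH] t x t0 xc.
  rewrite /= nonneg_timeE /= t0 lee_fin expr0 mulr1 -expR0 ler_expR.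
  by rewrite !mulr_ge0// ltW.
rewrite iterS.
pose h r := iter n kstep nonneg_time (t - r, flip (flow r x)).
have mh : measurable_fun setT h.
  exact: (@measurable_after_jump_at _ (t, x)
    (ge0_measurable_iter n ge0_measurable_nonneg_time)).
have h0 r : (0 <= h r)%E by exact: (ge0_measurable_iter n ge0_measurable_nonneg_time).2.
have -> : kstep (iter n kstep nonneg_time) (t, x) =
  (\int[mu]_(r in `[0%R, +oo[) (h r * (dens r x)%:E))%E by [].
pose k r := M * (expR (2 * M * (t - r)) * 2^-1 ^+ n).
have ck : continuous k.
  move=> r; apply: cvgM; first exact: cvg_cst.
  apply: cvgM; last exact: cvg_cst.
  apply: (@continuous_comp _ _ _ (fun r => 2 * M * (t - r)) expR); last exact: continuous_expR.
  apply: cvgM; first exact: cvg_cst.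
  by apply: cvgB; [exact: cvg_cst|exact: cvg_id].
pose K r := - 2^-1 ^+ n.+1 * expR (2 * M * (t - r)).
have dK r : is_derive r (1 : R) K (k r).
  have d0 := is_deriveB (is_derive_cst t r (1 : R)) (is_derive_id r (1 : R)).
  have d1 := @is_derive1_comp R expR (fun r => 2 * M * (t - r)) r _ _
    (is_derive_expR _) (is_deriveZ (2 * M) d0).
  apply: (is_derive_eq (is_deriveZ (- 2^-1 ^+ n.+1) d1)).
  by rewrite /k /GRing.scale/= exprS; field.
have k0 r : 0 <= k r by rewrite /k !mulr_ge0 ?expR_ge0 ?exprn_ge0// ltW.
apply: (@le_trans _ _ (\int[mu]_(r in `[0%R, t]) (k r)%:E)%E).
  rewrite [leRHS]integral_mkcond [leLHS]integral_mkcond.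
  apply: ge0_le_integral => //.
  - move=> r _; rewrite patchE; case: ifPn => // _.
    by rewrite mule_ge0// lee_fin dens_ge0.
  - apply/(measurable_restrictT _ _).1 => //.
    by apply/measurable_funTS; exact: measurable_mul_dens.
  - apply/(measurable_restrictT _ _).1 => //.
    by apply/measurable_funTS/measurable_EFinP; exact: continuous_measurable_fun.
  - move=> r _; rewrite !patchE !mem_setE !in_itv/= andbT.
    have [r0|r0] := leP 0 r; last by [].
    case: (leP r t) => rt; last first.
      rewrite /h iter_kstep_lt0 ?mul0e//=; last by rewrite subr_lt0.
      by move=> q q0; rewrite nonneg_timeE leNgt q0.
    rewrite /= /k muleC [leRHS]EFinM; apply: lee_pmul => //.
    + by rewrite lee_fin dens_ge0.
    + rewrite lee_fin /dens -[leRHS]mulr1 ler_pM ?rate_ge0 ?surv_ge0 ?surv_le1//.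
      apply: lamM; have := flow_bound xc r0.
      have : 0 <= a * (t - r) by rewrite mulr_ge0 ?subr_ge0// ltW// speed_gt0.
      lra.
    + by apply: IH; [rewrite subr_ge0|exact: flow_bound].
rewrite (integral_primitive t0 ck dK) lee_fin /K subrr mulr0 expR0 subr0.
have : 0 <= 2^-1 ^+ n.+1 :> R by rewrite exprn_ge0.
rewrite mulr1 mulNr opprK [expR _ * _]mulrC; lra.
Qed.

End JumpOperator.

(** * Non-explosion *)

Section Evolution.
Context {R : realType} (m : zigzag_rates R).
Local Notation E := (R * bool)%type.
Local Notation a := (speed m).
Local Notation flow := (flow a).
Local Notation surv := (surv m).
Local Notation jump_mean := (jump_mean m).
Local Notation kstep := (kstep m).

Lemma jump_mean0 (y : E) : jump_mean (fun=> 0%E) y = 0%E.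
Proof. by rewrite /jump_mean integral0_eq// => r _; rewrite mul0e. Qed.

Variable f : E -> \bar R.
Hypothesis mf : ge0_measurable f.

(** The part of the mean of f at time p.1 that comes from the paths without any jump. *)
Definition no_jump (p : R * E) : \bar R :=
  (nonneg_time p * ((surv p.1 p.2)%:E * f (flow p.1 p.2)))%E.

Lemma measurable_f_flow : measurable_fun setT (fun p : R * E => f (flow p.1 p.2)).
Proof. exact: (measurableT_comp mf.1 (measurable_flow a)). Qed.

Lemma ge0_measurable_no_jump : ge0_measurable no_jump.
Proof.
have [mn n0] := @ge0_measurable_nonneg_time R; split => [|p]; last first.
  by rewrite mule_ge0// mule_ge0 ?lee_fin ?surv_ge0//; case: mf => _; exact.
apply: emeasurable_funM => //; apply: emeasurable_funM.
  by apply/measurable_EFinP; exact: measurable_surv.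
exact: measurable_f_flow.
Qed.

Lemma no_jump_lt0 p : p.1 < 0 -> no_jump p = 0%E.
Proof. by move=> p0; rewrite /no_jump nonneg_timeE leNgt p0 mul0e. Qed.

Lemma no_jumpE p : 0 <= p.1 -> no_jump p = ((surv p.1 p.2)%:E * f (flow p.1 p.2))%E.
Proof. by move=> p0; rewrite /no_jump nonneg_timeE p0 mul1e. Qed.

(** The mean of f at time p.1 for the process started from p.2, as a series over the
    number of jumps.  It is defined without reference to probability spaces, which
    makes its joint measurability and its functional equations accessible. *)
Definition evolve (p : R * E) : \bar R := (\sum_(n <oo) iter n kstep no_jump p)%E.

Lemma ge0_measurable_evolve_term n : ge0_measurable (iter n kstep no_jump).
Proof. exact/ge0_measurable_iter/ge0_measurable_no_jump. Qed.

Lemma ge0_measurable_evolve : ge0_measurable evolve.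
Proof.
split; last first.
  by move=> p; apply: nneseries_ge0 => n _ _; case: (ge0_measurable_evolve_term n).
apply: ge0_emeasurable_sum => n => [p _ _|_]; case: (ge0_measurable_evolve_term n) => //.
Qed.

Lemma evolve_renewal p : evolve p = (no_jump p + kstep evolve p)%E.
Proof.
rewrite /evolve (nneseries_split 0 1); last first.
  by move=> n _; case: (ge0_measurable_evolve_term n).
rewrite add0n big_nat1 /=; congr (_ + _)%E.
rewrite kstep_series; last exact: ge0_measurable_evolve_term.
rewrite -(@nneseries_addn _ (fun n => iter n kstep no_jump p) 1).
  by apply: eq_eseriesr => n _; rewrite addn1.
by move=> n; case: (ge0_measurable_evolve_term n).
Qed.

(** The value of f at time t if that time falls between the jump with time and
    state q.2 and the next one, which comes q.1 later; else 0. *)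
Definition sojourn (t : R) (q : R * (R * E)) : \bar R :=
  (nonneg_time (t - q.2.1, q.2.2)%R * (\1_`](t - q.2.1)%R, +oo[%classic q.1)%:E *
   f (flow (t - q.2.1)%R q.2.2))%E.

Lemma measurable_remaining t :
  measurable_fun setT (fun q : R * (R * E) => (t - q.2.1, q.2.2)).
Proof.
apply: measurable_fun_pair; last exact: (measurableT_comp measurable_snd measurable_snd).
apply: measurable_funB => //.
exact: (measurableT_comp measurable_fst measurable_snd).
Qed.

Lemma ge0_measurable_sojourn t : ge0_measurable (sojourn t).
Proof.
have [mn n0] := @ge0_measurable_nonneg_time R; split => [|p]; last first.
  by rewrite mule_ge0 ?mule_ge0 ?lee_fin ?indicE//; case: mf => _; exact.
apply: emeasurable_funM; first apply: emeasurable_funM.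
- exact: (measurableT_comp mn (measurable_remaining t)).
- apply/measurable_EFinP.
  have ma : measurable_fun setT (fun q : R * (R * E) => q.1 + q.2.1).
    apply: measurable_funD => //.
    exact: (measurableT_comp measurable_fst measurable_snd).
  have mi : measurable_fun setT (\1_`]t, +oo[%classic : R -> R).
    exact: measurable_indic.
  apply: eq_measurable_fun (measurableT_comp mi ma) => q _ /=.
  rewrite !indicE; congr ((nat_of_bool _)%:R).
  by apply/idP/idP; rewrite !inE/= !in_itv/= !andbT ltrBlDr.
- exact: (measurableT_comp measurable_f_flow (measurable_remaining t)).
Qed.

Lemma jump_mean_sojourn t c :
  jump_mean (fun r => sojourn t (r, c)) c.2 = no_jump (t - c.1, c.2).
Proof.
rewrite /sojourn /no_jump /= nonneg_timeE /=.
have [tc|tc] := leP 0 (t - c.1); last first.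
  rewrite mul0e -[RHS](jump_mean0 c.2); apply: eq_jump_mean => r _.
  by rewrite !mul0e.
rewrite mul1e.
transitivity (jump_mean (fun r => (f (flow (t - c.1)%R c.2) *
    (\1_`](t - c.1)%R, +oo[%classic r)%:E)%E) c.2).
  by apply: eq_jump_mean => r _; rewrite mul1e muleC.
have c0 : (0 <= f (flow (t - c.1)%R c.2))%E by case: mf.
have mi : measurable_fun setT (fun r : R => (\1_`](t - c.1)%R, +oo[%classic r : R)%:E).
  by apply/measurable_EFinP; exact: measurable_indic.
by rewrite jump_meanZ// jump_mean_gt max_l// muleC.
Qed.

End Evolution.

Section Law.
Context {R : realType} (m : zigzag_rates R).
Local Notation E := (R * bool)%type.
Local Notation a := (speed m).
Local Notation lam := (rate m).
Local Notation kstep := (kstep m).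
Context {d} {T : measurableType d} (P : probability T R) (x : E)
  (Z : nat -> {RV P >-> R}).
Hypothesis Z_law : waiting_times a lam x Z.

Local Notation chain n w := (jump_chain a x (fun k => Z k w) n).
Local Notation hist := (history (fun k => Z k : T -> R)).

(** The last n jumps are integrated out one after the other by one_step. *)
Lemma integral_iter n k A (g : R * E -> \bar R) t : hist k A -> ge0_measurable g ->
  (\int[P]_(w in A) g (t - (chain (k + n) w).1, (chain (k + n) w).2)%R =
   \int[P]_(w in A) iter n kstep g (t - (chain k w).1, (chain k w).2)%R)%E.
Proof.
move=> + mg; elim: n k A => [|n IH] k A hA; first by rewrite addn0.
rewrite addnS -addSn IH; last exact: history_le hA.
have [mi i0] := ge0_measurable_iter m n mg.
pose h (q : R * (R * E)) :=
  iter n kstep g (t - (next_jump m q.1 q.2).1, (next_jump m q.1 q.2).2).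
have mh : ge0_measurable h.
  split; last by move=> q; exact: i0.
  apply: (measurableT_comp mi (g := fun q : R * (R * E) =>
    (t - (next_jump m q.1 q.2).1, (next_jump m q.1 q.2).2))).
  have mn := measurable_next_jump m.
  apply: measurable_fun_pair; last exact: (measurableT_comp measurable_snd mn).
  by apply: measurable_funB => //; exact: (measurableT_comp measurable_fst mn).
transitivity (\int[P]_(w in A) h (Z k w, chain k w))%E.
  by apply: eq_integral => w _; rewrite /h jump_chainS.
rewrite (one_step Z_law hA mh); apply: eq_integral => w _.
by apply: eq_jump_mean => r _; rewrite /h /= opprD addrA.
Qed.

Lemma jump_time_le_prob n t :
  P [set w | (chain n w).1 <= t] = iter n kstep nonneg_time (t, x).
Proof.
have := @integral_iter n 0 setT (@nonneg_time R) t (@historyT _ _ _ (fun k => Z k : T -> R) 0)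
  (@ge0_measurable_nonneg_time R).
rewrite /= subr0 integral_cst// => h.
rewrite [X in _ = (_ * X)%E](@probability_setT _ _ _ P) mule1 in h.
rewrite -h add0n; under eq_integral do rewrite nonneg_timeE/= subr_ge0.
have mA : measurable [set w | (chain n w).1 <= t].
  by apply: measurable_jump_le => k; exact: measurable_waiting.
have := @integral_indic _ _ _ P setT measurableT _ mA; rewrite setIT => <-.
apply: eq_integral => w _; rewrite indicE; congr ((nat_of_bool _)%:R%:E).
by apply/idP/idP; rewrite inE.
Qed.

Definition regular (w : T) : Prop :=
  (forall k, 0 < Z k w) /\ forall t, exists n, t < (chain n w).1.

Lemma waiting_gt0_ae : \forall w \ae P, forall k, 0 < Z k w.
Proof.
apply: ae_foralln => k; exists [set w | Z k w <= 0]; split.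
- rewrite -[X in measurable X]setTI.
  rewrite (_ : [set w | _] = Z k @^-1` `]-oo, 0]%classic).
    exact: measurable_waiting.
  by apply/seteqP; split => w /=; rewrite in_itv.
- have mZ : measurable [set w | 0 < Z k w].
    rewrite -[X in measurable X]setTI.
    rewrite (_ : [set w | _] = Z k @^-1` `]0, +oo[%classic).
      exact: measurable_waiting.
    by apply/seteqP; split => w /=; rewrite in_itv/= andbT.
  rewrite (_ : [set w | _] = ~` [set w | 0 < Z k w]); last first.
    by apply/seteqP; split => w /=; rewrite leNgt => /negP.
  rewrite [LHS]probability_setC//.
  suff -> : P [set w | 0 < Z k w] = 1%E by rewrite subee.
  have := @integral_indic _ _ _ P setT measurableT _ mZ; rewrite setIT => <-.
  have := waiting_tail_ge0 Z_law (lexx 0) (@historyT _ _ _ (fun k => Z k : T -> R) k).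
  under [X in _ = X]eq_integral do rewrite surv0.
  rewrite integral_cst// [X in _ = (_ * X)%E](@probability_setT _ _ _ P) mule1 => <-.
  apply: eq_integral => w _; rewrite !indicE; congr ((nat_of_bool _)%:R%:E).
  by apply/idP/idP; rewrite !inE/= in_itv/= andbT.
- by move=> w /= /negP; rewrite -leNgt.
Qed.

(** If infinitely many jumps occur before N, then n jumps do for every n, and
    the probability of that decays geometrically in n. *)
Lemma unbounded_ae : \forall w \ae P, forall N : nat, exists n, N%:R < (chain n w).1.
Proof.
apply: ae_foralln => N.
have mT n : measurable [set w | (chain n w).1 <= N%:R].
  by apply: measurable_jump_le => k; exact: measurable_waiting.
exists (\bigcap_n [set w | (chain n w).1 <= N%:R]); split.
- exact: bigcapT_measurable.
- set B := \bigcap_n _.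
  have mB : measurable B by exact: bigcapT_measurable.
  have [M M0 hM] := rate_bounded m (`|x.1| + a * N%:R).
  pose C := expR (2 * M * N%:R) : R.
  have PB n : (P B <= (C * 2^-1 ^+ n)%:E)%E.
    apply: (@le_trans _ _ (P [set w | (chain n w).1 <= N%:R])).
      by apply: le_measure; rewrite ?inE// => w; exact.
    by rewrite jump_time_le_prob; apply: iter_nonneg_time_le hM _ _ => //.
  have fB : P B \is a fin_num by exact: fin_num_measure.
  suff : P B = 0%E by [].
  have PB0 : (0 <= P B)%E by exact: measure_ge0.
  move: PB0 PB fB; case: (P B) => // v; rewrite lee_fin => v0 PB _.
  congr (_%:E); apply/eqP; rewrite eq_le v0 andbT.
  apply/ler_addgt0Pr => e e0; rewrite add0r.
  have half_ge0 : 0 <= 2^-1 :> R by rewrite invr_ge0.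
  have half_lt1 : 2^-1 < 1 :> R by rewrite invf_lt1// ltr1n.
  have [n hn] := geometric_small C half_ge0 half_lt1 e0.
  by apply: le_trans hn; rewrite -lee_fin.
- move=> w /= h n _ /=; rewrite leNgt; apply/negP => hn; apply: h.
  by exists n.
Qed.

Lemma regular_ae : \forall w \ae P, regular w.
Proof.
move: waiting_gt0_ae unbounded_ae; apply: filterS2 => w Z0 unb; split => // t.
have [n hn] := unb (Num.trunc `|t|).+1; exists n.
apply: lt_trans hn; apply: le_lt_trans (ler_norm t) _; exact: truncnS_gt.
Qed.

Lemma regular_nondecreasing w : regular w ->
  nondecreasing_seq (fun n => (chain n w).1).
Proof.
move=> [Z0 _]; apply/nondecreasing_seqP => n.
by rewrite jump_chainS /= lerDl ltW.
Qed.

Lemma non_explosive_zigzag : non_explosive a P x Z.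
Proof.
move: regular_ae; apply: filterS => w reg.
apply/cvgryPgt => A; have [n hn] := reg.2 A.
near=> k; apply: (lt_le_trans hn).
by apply: (regular_nondecreasing reg); near: k; exact: nbhs_infty_ge.
Unshelve. all: by end_near. Qed.

End Law.

(** * The Markov property at fixed times *)

Lemma nneseries_single (R : realType) (u : nat -> \bar R) n :
  (forall k, 0 <= u k)%E -> (forall k, k != n -> u k = 0%E) ->
  (\sum_(k <oo) u k = u n)%E.
Proof.
move=> u0 un; rewrite (nneseries_split 0 n.+1) => [|k _]; last exact: u0.
rewrite eseries0; last first.
  by move=> k nk _; apply: un; rewrite gtn_eqF// -[n.+1]add0n.
rewrite add0n adde0 big_nat_recr//= big_nat big1 ?add0e// => k /andP[_ kn].
by apply: un; rewrite ltn_eqF.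
Qed.

Lemma ae_eq_integral_domain d (T : measurableType d) (R : realType)
    (P : {measure set T -> \bar R}) (D1 D2 : set T) (g1 g2 : T -> \bar R) :
  measurable D1 -> measurable D2 -> measurable_fun setT g1 ->
  measurable_fun setT g2 ->
  (\forall w \ae P, (D1 w <-> D2 w) /\ (D1 w -> g1 w = g2 w)) ->
  (\int[P]_(w in D1) g1 w = \int[P]_(w in D2) g2 w)%E.
Proof.
move=> m1 m2 mg1 mg2 h.
rewrite integral_mkcond [RHS]integral_mkcond; apply: ae_eq_integral => //.
- by apply/(measurable_restrictT _ _).1 => //; exact: measurable_funTS.
- by apply/(measurable_restrictT _ _).1 => //; exact: measurable_funTS.
apply: filterS h => w [D12 g12] _; rewrite !patchE.
case: ifPn => [|/negP w1]; first by rewrite inE => w1; rewrite mem_set ?g12//; apply/D12.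
by rewrite ifN//; apply/negP => /set_mem /D12 /mem_set.
Qed.

Section Markov.
Context {R : realType} (m : zigzag_rates R).
Local Notation E := (R * bool)%type.
Local Notation a := (speed m).
Local Notation lam := (rate m).
Local Notation flow := (flow a).
Local Notation surv := (surv m).
Local Notation jump_mean := (jump_mean m).
Local Notation kstep := (kstep m).
Local Notation evolve := (evolve m).
Local Notation sojourn := (sojourn m).
Local Notation no_jump := (no_jump m).

Variable f : E -> \bar R.
Hypothesis mf : ge0_measurable f.

Let evolve_ge0 p : (0 <= evolve f p)%E.
Proof. by case: (ge0_measurable_evolve m mf). Qed.

Let msoj t : ge0_measurable (sojourn f t) := ge0_measurable_sojourn m mf t.

(** The mean of f at time t once the jump that follows q.2 after a wait q.1 has occurred. *)
Definition after_next (t : R) (q : R * (R * E)) : \bar R :=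
  evolve f (t - (next_jump m q.1 q.2).1, (next_jump m q.1 q.2).2).

Lemma ge0_measurable_after_next t : ge0_measurable (after_next t).
Proof.
split; last by move=> q; exact: evolve_ge0.
have mn := measurable_next_jump m.
apply: (measurableT_comp (ge0_measurable_evolve m mf).1 (g := fun q : R * (R * E) =>
  (t - (next_jump m q.1 q.2).1, (next_jump m q.1 q.2).2))).
apply: measurable_fun_pair; last exact: (measurableT_comp measurable_snd mn).
by apply: measurable_funB => //; exact: (measurableT_comp measurable_fst mn).
Qed.

(** Memorylessness: a waiting time that is known to exceed s - c.1 does so by a
    first jump time of the process started from the current state. *)
Lemma jump_mean_restart s t (c : R * E) : 0 <= t -> c.1 <= s ->
  jump_mean (fun r => ((sojourn f (s + t)%R (r, c) + after_next (s + t)%R (r, c)) *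
    (\1_`](s - c.1)%R, +oo[%classic r)%:E)%E) c.2 =
  ((surv (s - c.1)%R c.2)%:E * evolve f (t, flow (s - c.1)%R c.2))%E.
Proof.
move=> t0 cs; set q := s - c.1; set y := flow q c.2.
have q0 : 0 <= q by rewrite subr_ge0.
have [ms s0] := msoj (s + t); have [ma a0] := ge0_measurable_after_next (s + t).
have mr (c' : R * E) : measurable_fun setT (fun r : R => (r, c')).
  exact: measurable_fun_pair.
rewrite jump_mean_shift//; last 2 first.
- by apply: emeasurable_funD; [exact: (measurableT_comp ms (mr c))|exact: (measurableT_comp ma (mr c))].
- by move=> r; rewrite adde_ge0.
congr (_ * _)%E; rewrite evolve_renewal//.
have -> : no_jump f (t, y) = no_jump f (t - (0 : R, y).1, (0 : R, y).2) by rewrite /= subr0.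
rewrite -jump_mean_sojourn// /kstep /= -jump_meanD//.
- apply: eq_jump_mean => r r0; congr (_ + _)%E.
    rewrite /sojourn/= !nonneg_timeE/= subr0 t0.
    have -> : 0 <= s + t - c.1 by rewrite /q in q0; lra.
    have -> : s + t - c.1 = q + t by rewrite /q; ring.
    rewrite flowD -/y; congr (_ * _ * _)%E; congr (_%:E).
    by rewrite !indicE; congr ((nat_of_bool _)%:R); apply/idP/idP;
      rewrite !inE/= !in_itv/= !andbT ltrD2l.
  rewrite /after_next /= flowD -/y; congr (evolve f (_, _)).
  by rewrite /q; ring.
- exact: (measurableT_comp (msoj t).1 (mr (0 : R, y))).
- have := @measurable_after_jump_at _ m _ (t, y) (ge0_measurable_evolve m mf).
  exact.
- by move=> r; case: (msoj t).
Qed.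

Context {d} {T : measurableType d} (P : probability T R) (x : E)
  (Z : nat -> {RV P >-> R}).
Hypothesis Z_law : waiting_times a lam x Z.

Local Notation chain n w := (jump_chain a x (fun k => Z k w) n).
Local Notation hist := (history (fun k => Z k : T -> R)).
Local Notation X := (zigzag a x Z).
Local Notation Phase n s := [set w | phase m x (fun k => Z k w) s n].

Lemma measurable_zigzag t : measurable_fun setT (X t).
Proof. by apply: (@measurable_path _ m) => k; exact: measurable_waiting. Qed.

Lemma measurable_Phase n s : measurable (Phase n s).
Proof. by apply: measurable_phase => k; exact: measurable_waiting. Qed.

Lemma regular_phase w n s : regular m x Z w -> 0 <= s ->
  phase m x (fun k => Z k w) s n <->
  (chain n w).1 <= s /\ s < (chain n.+1 w).1.
Proof.
move=> reg s0; have nd := regular_nondecreasing reg; split.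
  by move=> [h1 h2]; split => //; case: n h1 h2 => [//|n] _; apply.
move=> [h1 h2]; split => // i i_n; apply: le_trans h1; exact: nd.
Qed.

Lemma sojournE t n w : sojourn f t (Z n w, chain n w) =
  if ((chain n w).1 <= t) && (t < (chain n.+1 w).1)
  then f (flow (t - (chain n w).1) (chain n w).2) else 0%E.
Proof.
rewrite /sojourn nonneg_timeE [chain n.+1 w](jump_chainS m) /= indicE.
rewrite subr_ge0 mem_setE in_itv/= andbT ltrBlDl.
by case: (_ <= _) => /=; rewrite ?mul0e// mul1e; case: (_ < _); rewrite ?mul0e ?mul1e.
Qed.

(** On a regular path exactly one sojourn contains t, so one term of the series
    survives. *)
Lemma regular_sojourn t w : regular m x Z w -> 0 <= t ->
  f (X t w) = (\sum_(n <oo) sojourn f t (Z n w, chain n w))%E.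
Proof.
move=> reg t0; have nd := regular_nondecreasing reg.
have [[n tn]|h] := phase_exists m x (fun k => Z k w) t; last first.
  have [n hn] := reg.2 t; have := h n; rewrite leNgt; case/negP.
  by apply: (lt_le_trans hn); apply: nd.
have [h1 h2] := (regular_phase n reg t0).1 tn.
rewrite (@nneseries_single _ _ n).
- by rewrite sojournE h1 h2 /= /zigzag (phase_path tn).
- by move=> k; case: (msoj t).
- move=> k kn; rewrite sojournE; case: ifPn => // /andP[k1 k2].
  have tk := (regular_phase k reg t0).2 (conj k1 k2).
  by rewrite (phase_unique tk tn) eqxx in kn.
Qed.

Lemma measurable_sojourn_at t n : measurable_fun setT (fun w => sojourn f t (Z n w, chain n w)).
Proof.
apply: (measurableT_comp (msoj t).1 (g := fun w => (Z n w, chain n w))).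
by apply: measurable_fun_pair; [exact: measurable_waiting|exact: measurable_chain].
Qed.

Lemma integral_sojourns k A t : hist k A ->
  (\int[P]_(w in A) (\sum_(n <oo) sojourn f t (Z (k + n)%N w, chain (k + n) w)) =
   \int[P]_(w in A) evolve f (t - (chain k w).1, (chain k w).2)%R)%E.
Proof.
move=> hA; have mA := measurable_hist hA.
rewrite integral_nneseries//; last 2 first.
- by move=> n; apply: measurable_funTS; exact: measurable_sojourn_at.
- by move=> n w _; case: (msoj t).
rewrite /evolve integral_nneseries//; last 2 first.
- move=> n; apply: measurable_funTS.
  apply: (measurableT_comp (ge0_measurable_evolve_term m mf n).1
    (g := fun w => (t - (chain k w).1, (chain k w).2))).
  have mc := measurable_chain m x Z k.
  apply: measurable_fun_pair; last exact: (measurableT_comp measurable_snd mc).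
  by apply: measurable_funB => //; exact: (measurableT_comp measurable_fst mc).
- by move=> n w _; case: (ge0_measurable_evolve_term m mf n).
apply: eq_eseriesr => n _.
rewrite (one_step Z_law _ (msoj t)); last exact: history_le (leq_addr _ _) _ hA.
rewrite -(integral_iter Z_law n t hA (ge0_measurable_no_jump m mf)).
by apply: eq_integral => w _; rewrite jump_mean_sojourn.
Qed.

Lemma expectation_evolve t : 0 <= t ->
  (\int[P]_w f (X t w) = evolve f (t, x))%E.
Proof.
move=> t0.
transitivity (\int[P]_w (\sum_(n <oo) sojourn f t (Z (0 + n)%N w, chain (0 + n) w)))%E.
  apply: ae_eq_integral => //.
  - exact: (measurableT_comp mf.1 (measurable_zigzag t)).
  - apply: ge0_emeasurable_sum => n => [w _ _|_]; first by case: (msoj t).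
    exact: measurable_sojourn_at.
  apply: filterS (regular_ae Z_law) => w reg _.
  by rewrite regular_sojourn//; under [RHS]eq_eseriesr do rewrite add0n.
rewrite integral_sojourns; last exact: historyT.
rewrite /= subr0 integral_cst//.
by rewrite [X in (_ * X)%E](@probability_setT _ _ _ P) mule1.
Qed.

End Markov.

Section Filtration.
Context {R : realType} {d} {T : measurableType d} (X : R -> T -> R * bool).
Local Notation Fil := (natural_filtration X).

Lemma filtration_sigma_algebra s : sigma_algebra setT (Fil s).
Proof. exact: smallest_sigma_algebra. Qed.

Lemma filtration_adapted r s : 0 <= r -> r <= s ->
  preimage_set_system setT (X r) measurable `<=` Fil s.
Proof.
move=> r0 rs A hA; apply: sub_sigma_algebra; exists r => //=.
by rewrite in_itv/= r0.
Qed.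

Lemma filtration_le r s : r <= s -> Fil r `<=` Fil s.
Proof.
move=> rs; apply: smallest_sub; first exact: filtration_sigma_algebra.
move=> A [q /=]; rewrite in_itv/= => /andP[q0 qr]; apply: filtration_adapted => //.
exact: le_trans rs.
Qed.

Lemma filtration_measurable s : (forall t, measurable_fun setT (X t)) ->
  Fil s `<=` measurable.
Proof.
move=> mX; apply: smallest_sub; first exact: sigma_algebra_measurable.
by move=> A [q _ [B mB <-]]; exact: mX.
Qed.

End Filtration.

Section Markov.
Context {R : realType} (m : zigzag_rates R).
Local Notation E := (R * bool)%type.
Local Notation a := (speed m).
Local Notation lam := (rate m).
Local Notation flow := (flow a).
Local Notation jump_mean := (jump_mean m).
Local Notation evolve := (evolve m).
Local Notation sojourn := (sojourn m).
Context {d} {T : measurableType d} (P : probability T R) (x : E)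
  (Z : nat -> {RV P >-> R}).
Hypothesis Z_law : waiting_times a lam x Z.

Local Notation chain n w := (jump_chain a x (fun k => Z k w) n).
Local Notation hist := (history (fun k => Z k : T -> R)).
Local Notation X := (zigzag a x Z).
Local Notation Phase n s := [set w | phase m x (fun k => Z k w) s n].

(** While there are n jumps up to s, the path up to s is the path of the cut
    waiting times, and these are functions of the first n waiting times. *)
Lemma filtration_phase s n A : natural_filtration X s A ->
  exists2 B, hist n B & A `&` Phase n s = B `&` Phase n s.
Proof.
pose C := [set A | exists2 B, hist n B & A `&` Phase n s = B `&` Phase n s] : set_system T.
have hsig : sigma_algebra setT (hist n) by exact: smallest_sigma_algebra.
suff : natural_filtration X s `<=` C by exact.
apply: smallest_sub.
  split.
  - exists set0; last by [].
    by case: hsig.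
  - move=> D [B hB DB]; exists (setT `\` B); first by case: hsig => _ + _; exact.
    apply/seteqP; split => w [[_ h] ph]; split => //; split => // h2; apply: h.
      by have : (B `&` Phase n s) w by []; rewrite -DB => -[].
    by have : (D `&` Phase n s) w by []; rewrite DB => -[].
  - move=> D hD; have /choice[B hB] : forall k, exists B, hist n B /\
        D k `&` Phase n s = B `&` Phase n s.
      by move=> k; have [B ? ?] := hD k; exists B.
    exists (\bigcup_k B k).
      by case: hsig => _ _; apply => k; case: (hB k).
    rewrite !setI_bigcupl; apply: eq_bigcupr => k _; by case: (hB k).
move=> A' [r /=]; rewrite in_itv/= => /andP[r0 rs] [B mB <-].
pose zc (i : nat) (w : T) := cut_waiting m x s n (fun k => Z k w) i.
exists ((fun w => zigzag_path a x (zc^~ w) r) @^-1` B).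
  rewrite -[X in hist n X]setTI; apply: history_measurable.
  apply: (@measurable_path _ m _ _ x (zc : nat -> g_sigma_algebraType (hist n) -> R)) => // i.
  rewrite /zc /cut_waiting; case: (boolP (i < n)%N) => i_n; first exact: measurable_history.
  apply: measurable_funB => //; apply: (measurableT_comp measurable_fst).
  apply: (measurable_jump_chain m x
    (z := (fun k => Z k : g_sigma_algebraType (hist n) -> R))) => k kn.
  exact: (@measurable_history _ _ _ (fun k => Z k : T -> R)).
rewrite setTI; apply/seteqP; split => w [h ph]; split => //; move: h;
  by rewrite /= /zigzag (path_cut_waiting ph rs).
Qed.

Variable f : E -> \bar R.
Hypothesis mf : ge0_measurable f.

Let evolve_ge0 p : (0 <= evolve f p)%E.
Proof. by case: (ge0_measurable_evolve m mf). Qed.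

Let msoj t : ge0_measurable (sojourn f t) := ge0_measurable_sojourn m mf t.

Let mevolve t : ge0_measurable (fun y => evolve f (t, y)).
Proof.
have [me e0] := ge0_measurable_evolve m mf; split => //.
apply: (measurableT_comp me (g := fun y => (t, y))).
exact: measurable_fun_pair.
Qed.

Let mfX t : measurable_fun setT (fun w => f (X t w)).
Proof. exact: (measurableT_comp mf.1 (measurable_zigzag m x Z t)). Qed.

Let meX t s : measurable_fun setT (fun w => evolve f (t, X s w)).
Proof. exact: (measurableT_comp (mevolve t).1 (measurable_zigzag m x Z s)). Qed.

Let mwc n : measurable_fun setT (fun w => (Z n w, chain n w)).
Proof.
by apply: measurable_fun_pair; [exact: measurable_waiting|exact: measurable_chain].
Qed.

Section Phase.
Variables (s t : R) (s_ge0 : 0 <= s) (t_ge0 : 0 <= t) (n : nat) (B : set T).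
Hypothesis hB : hist n B.

Let B1 := B `&` [set w | (chain n w).1 <= s].
Let B2 := B1 `&` [set w | s < (chain n.+1 w).1].

Let hB1 : hist n B1.
Proof.
apply: historyI => //.
have := @history_chain _ m _ _ (fun k => Z k : T -> R) x n
  [set c : R * E | c.1 <= s].
apply.
rewrite -[X in measurable X]setTI (_ : [set c | _] = fst @^-1` `]-oo, s]%classic).
  exact: measurable_fst.
by apply/seteqP; split => c /=; rewrite in_itv.
Qed.

Let hB2 : hist n.+1 B2.
Proof.
apply: historyI; first exact: history_le hB1.
have := @history_chain _ m _ _ (fun k => Z k : T -> R) x n.+1
  [set c : R * E | s < c.1].
apply.
rewrite -[X in measurable X]setTI (_ : [set c | _] = fst @^-1` `]s, +oo[%classic).
  exact: measurable_fst.
by apply/seteqP; split => c /=; rewrite in_itv/= andbT.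
Qed.

Let mB1 : measurable B1. Proof. exact: measurable_hist hB1. Qed.
Let mB2 : measurable B2. Proof. exact: measurable_hist hB2. Qed.

Let integral_B2 (h : R * (R * E) -> \bar R) : ge0_measurable h ->
  (\int[P]_(w in B2) h (Z n w, chain n w) =
   \int[P]_(w in B1) jump_mean (fun r => h (r, chain n w) *
     (\1_`](s - (chain n w).1)%R, +oo[%classic r)%:E) (chain n w).2)%E.
Proof.
move=> [mh h0].
pose h' (q : R * (R * E)) :=
  (h q * (\1_`](s - q.2.1)%R, +oo[%classic q.1)%:E)%E.
have mh' : ge0_measurable h'.
  split => [|q]; last by rewrite mule_ge0// lee_fin indicE.
  apply: emeasurable_funM => //; apply/measurable_EFinP.
  have ma : measurable_fun setT (fun q : R * (R * E) => q.1 + q.2.1).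
    apply: measurable_funD => //.
    exact: (measurableT_comp measurable_fst measurable_snd).
  have mi : measurable_fun setT (\1_`]s, +oo[%classic : R -> R).
    exact: measurable_indic.
  apply: eq_measurable_fun (measurableT_comp mi ma) => q _ /=.
  rewrite !indicE; congr ((nat_of_bool _)%:R).
  by apply/idP/idP; rewrite !inE/= !in_itv/= !andbT ltrBlDr.
rewrite -(one_step Z_law hB1 mh') /B2 integral_mkcondr.
apply: eq_integral => w _; rewrite patchE /h' /= indicE.
have -> : (w \in [set w | s < (chain n.+1 w).1]) =
    (Z n w \in `](s - (chain n w).1)%R, +oo[%classic).
  have cS := jump_chainS m x (fun k => Z k w) n.
  by apply/idP/idP; rewrite !inE /mkset cS /= in_itv/= andbT ltrBlDl.
by case: (_ \in _); rewrite ?mule1 ?mule0.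
Qed.

(** Given n jumps up to time s, the next waiting time exceeds s - T_n, and
    jump_mean_restart applies to it; the later jumps are integrated out by
    integral_sojourns. *)
Lemma markov_phase :
  (\int[P]_(w in B `&` Phase n s) f (X (s + t)%R w) =
   \int[P]_(w in B `&` Phase n s) evolve f (t, X s w))%E.
Proof.
have mBP : measurable (B `&` Phase n s).
  by apply: measurableI; [exact: measurable_hist hB|exact: measurable_Phase].
have BP w : regular m x Z w -> (B `&` Phase n s) w <-> B2 w.
  move=> reg; have h := regular_phase n reg s_ge0.
  split=> [[Bw ph]|[[Bw h1] h2]]; last by split; [|exact: (h.2 (conj h1 h2))].
  by have [h1 h2] := h.1 ph.
have mS k : measurable_fun setT (fun w => sojourn f (s + t) (Z k w, chain k w)).
  exact: measurable_sojourn_at.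
transitivity (\int[P]_(w in B2) (sojourn f (s + t)%R (Z n w, chain n w) +
    \sum_(k <oo) sojourn f (s + t)%R (Z (n.+1 + k)%N w, chain (n.+1 + k) w)))%E.
  apply: ae_eq_integral_domain => //.
    apply: emeasurable_funD => //.
    by apply: ge0_emeasurable_sum => k => [w _ _|_] //; case: (msoj (s + t)).
  apply: filterS (regular_ae Z_law) => w reg; split; first exact: BP.
  move=> /(BP _ reg) B2w.
  rewrite regular_sojourn ?addr_ge0// (nneseries_split 0 n.+1); last first.
    by move=> k _; case: (msoj (s + t)).
  rewrite add0n big_nat_recr//= big_nat big1 ?add0e; last first.
    move=> k /andP[_ kn]; rewrite sojournE// ifF//.
    apply/negbTE; rewrite negb_and -!ltNge -leNgt; apply/orP; right.
    apply: (@le_trans _ _ s); last by rewrite lerDl.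
    apply: (@le_trans _ _ (chain n w).1); last by case: B2w => -[].
    exact: regular_nondecreasing.
  rewrite -(@nneseries_addn _ (fun k => sojourn f (s + t) (Z k w, chain k w)) n.+1).
    by congr (_ + _)%E; apply: eq_eseriesr => k _; rewrite addnC.
  by move=> k; case: (msoj (s + t)).
transitivity (\int[P]_(w in B2)
    (sojourn f (s + t)%R (Z n w, chain n w) +
     after_next m f (s + t)%R (Z n w, chain n w)))%E.
  rewrite !ge0_integralD//.
  - congr (_ + _)%E; rewrite integral_sojourns//.
    by apply: eq_integral => w _; rewrite (jump_chainS m).
  - by move=> w _; case: (msoj (s + t)).
  - exact: measurable_funTS.
  - by move=> w _; case: (ge0_measurable_after_next m mf (s + t)).
  - apply: measurable_funTS.
    exact: (measurableT_comp (ge0_measurable_after_next m mf (s + t)).1 (mwc n)).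
  - by move=> w _; case: (msoj (s + t)).
  - exact: measurable_funTS.
  - by move=> w _; apply: nneseries_ge0 => k _ _; case: (msoj (s + t)).
  - apply: measurable_funTS.
    by apply: ge0_emeasurable_sum => k => [w _ _|_] //; case: (msoj (s + t)).
rewrite (integral_B2 (h := fun q => sojourn f (s + t) q + after_next m f (s + t) q)%E); last first.
  split => [|q]; last first.
    by rewrite adde_ge0//; [case: (msoj (s + t))|case: (ge0_measurable_after_next m mf (s + t))].
  by apply: emeasurable_funD; [case: (msoj (s + t))|case: (ge0_measurable_after_next m mf (s + t))].
pose h3 (q : R * (R * E)) := evolve f (t, flow (s - q.2.1) q.2.2).
have mh3 : ge0_measurable h3.
  split => [|q]; last exact: evolve_ge0.
  apply: (measurableT_comp (mevolve t).1
    (g := fun q : R * (R * E) => flow (s - q.2.1) q.2.2)).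
  exact: (measurableT_comp (measurable_flow a) (measurable_remaining s)).
transitivity (\int[P]_(w in B2) h3 (Z n w, chain n w))%E.
  rewrite integral_B2//; apply: eq_integral => w; rewrite inE => -[_ /= cs].
  rewrite jump_mean_restart// /h3 /=.
  rewrite jump_meanZ//.
    by rewrite jump_mean_gt max_l ?subr_ge0// muleC.
  by apply/measurable_EFinP; exact: measurable_indic.
apply: ae_eq_integral_domain => //.
  exact: (measurableT_comp mh3.1 (mwc n)).
apply: filterS (regular_ae Z_law) => w reg; split; first exact: iff_sym (BP _ reg).
by move=> /(BP _ reg)[_ ph]; rewrite /h3 /zigzag (phase_path ph).
Qed.

End Phase.

(** The event A is cut according to the number of jumps up to time s; on each piece
    the past is generated by finitely many waiting times. *)
Lemma markov_property s t A : 0 <= s -> 0 <= t -> natural_filtration X s A ->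
  (\int[P]_(w in A) f (X (s + t)%R w) =
   \int[P]_(w in A) evolve f (t, X s w))%E.
Proof.
move=> s0 t0 hA.
have mA : measurable A.
  by apply: filtration_measurable hA => r; exact: measurable_zigzag.
pose F n := A `&` Phase n s.
have mF n : measurable (F n) by apply: measurableI => //; exact: measurable_Phase.
have split_phase (g : T -> \bar R) : measurable_fun setT g -> (forall w, 0 <= g w)%E ->
    (\int[P]_(w in A) g w = \sum_(n <oo) \int[P]_(w in F n) g w)%E.
  move=> mg g0; rewrite -ge0_integral_bigcup//; last 2 first.
  - exact: measurable_funTS.
  - move=> i j _ _ [w [[_ wi] [_ wj]]]; exact: phase_unique wi wj.
  apply: ae_eq_integral_domain => //; first exact: bigcup_measurable.
  apply: filterS (regular_ae Z_law) => w reg; split => //; split => [Aw|[n _ []]//].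
  have [[n wn]|h] := phase_exists m x (fun k => Z k w) s; first by exists n.
  have [n hn] := reg.2 s; have := h n; rewrite leNgt; case/negP.
  by apply: (lt_le_trans hn); exact: regular_nondecreasing.
rewrite !split_phase//.
- apply: eq_eseriesr => n _.
  have [B hB AB] := filtration_phase n hA.
  by rewrite /F AB; exact: markov_phase.
- by move=> w; case: mf.
Qed.

End Markov.

(** * The semigroup and its renewal equation *)

Section SpeedLimit.
Context {R : realType} (m : zigzag_rates R).
Local Notation E := (R * bool)%type.
Local Notation a := (speed m).
Local Notation chain x z n := (jump_chain a x z n).

Lemma chain_dist (x : E) (z : nat -> R) n : (forall k, 0 <= z k) ->
  `|(chain x z n).2.1 - x.1| <= a * (chain x z n).1.
Proof.
move=> z0; elim: n => [|n IH]; first by rewrite /= subrr normr0 mulr0.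
rewrite (jump_chainS m) /= -/(flow a (z n) (chain x z n).2).
have := flow_dist a (z n) (chain x z n).2.
rewrite (ger0_norm (z0 n)) (gtr0_norm (speed_gt0 m)) => h.
have := ler_distD (chain x z n).2.1
  (flow a (z n) (chain x z n).2).1 x.1; rewrite /= in h * => ?.
rewrite mulrDr; lra.
Qed.

End SpeedLimit.

Section Semigroup.
Context {R : realType} (m : zigzag_rates R).
Local Notation E := (R * bool)%type.
Local Notation a := (speed m).
Local Notation lam := (rate m).
Local Notation flow := (flow a).
Local Notation evolve := (evolve m).
Context {d : measure_display} (Omega : E -> measurableType d)
  (P : forall x, probability (Omega x) R) (Z : forall x, nat -> {RV (P x) >-> R}).
Hypothesis Z_law : forall x, waiting_times a lam x (Z x).

Local Notation X x := (zigzag a x (Z x)).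
Local Notation Pt := (transition P (fun x => X x)).
Implicit Types (f : E -> R) (x y : E) (t C : R).

Lemma path_dist x t w : regular m x (Z x) w -> 0 <= t ->
  `|(X x t w).1 - x.1| <= a * t.
Proof.
move=> reg t0.
have [[n tn]|h] := phase_exists m x (fun k => Z x k w) t; last first.
  have [n hn] := reg.2 t; have := h n; rewrite leNgt; case/negP.
  by apply: (lt_le_trans hn); exact: regular_nondecreasing.
rewrite /zigzag (phase_path tn).
have [h1 h2] := (regular_phase n reg t0).1 tn.
set c := jump_chain _ _ _ _ in h1 h2 *.
have hc : `|c.2.1 - x.1| <= a * c.1 by apply: chain_dist => k; apply: ltW; case: reg.
have := flow_dist a (t - c.1) c.2.
rewrite (gtr0_norm (speed_gt0 m)) [`|t - _|]ger0_norm ?subr_ge0// => h.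
have := ler_distD c.2.1 (flow (t - c.1) c.2).1 x.1; rewrite h => h3.
apply: (le_trans h3); rewrite mulrBr; lra.
Qed.

Lemma transition_Rintegral t f x :
  Pt t f x = \int[P x]_w f (X x t w).
Proof. by rewrite /transition unlock. Qed.

Lemma measurable_observable t f x : measurable_fun setT f ->
  measurable_fun setT (fun w => f (X x t w)).
Proof. by move=> mf; exact: (measurableT_comp mf (measurable_zigzag m x (Z x) t)). Qed.

Lemma integrable_observable t f C x : measurable_fun setT f ->
  (forall y, `|f y| <= C) -> (P x).-integrable setT (fun w => (f (X x t w))%:E).
Proof.
move=> mf fC; apply: measurable_bounded_integrable => //.
- by rewrite [U in (U < _)%E](@probability_setT _ _ _ (P x)) ltry.
- exact: measurable_observable.
- by exists C; split; [exact: num_real|move=> M CM w _ /=; rewrite (le_trans (fC _))// ltW].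
Qed.

Lemma Rintegral_prob x (c : R) : \int[P x]_w c = c.
Proof.
by rewrite Rintegral_cst// [U in fine U](@probability_setT _ _ _ (P x)) mulr1.
Qed.

Lemma transitionDc t f C x c : measurable_fun setT f -> (forall y, `|f y| <= C) ->
  Pt t (fun y => f y + c) x = Pt t f x + c.
Proof.
move=> mf fC; rewrite !transition_Rintegral RintegralD//.
- by rewrite Rintegral_prob.
- exact: integrable_observable mf fC.
- by apply: (@integrable_observable t (fun=> c) `|c|) => //.
Qed.

Lemma transitionN t f C x : measurable_fun setT f -> (forall y, `|f y| <= C) ->
  Pt t (fun y => - f y) x = - Pt t f x.
Proof.
move=> mf fC; rewrite !transition_Rintegral -[RHS]mulN1r -RintegralZl//.
  by apply: eq_Rintegral => w _; rewrite mulN1r.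
exact: integrable_observable mf fC.
Qed.

(** The speed is a, so that the process is almost surely within distance a t of x
    at time t. *)
Lemma transition_le t f C x M : measurable_fun setT f -> (forall y, `|f y| <= C) ->
  0 <= t -> (forall y, `|y.1 - x.1| <= a * t -> f y <= M) -> Pt t f x <= M.
Proof.
move=> mf fC t0 fM.
pose h w := Num.min (f (X x t w)) M.
have mfX : measurable_fun setT (fun w => f (X x t w)) by exact: measurable_observable.
have mh : measurable_fun setT h by apply: measurable_minr.
have ih : (P x).-integrable setT (EFin \o h).
  apply: measurable_bounded_integrable => //.
    by rewrite [U in (U < _)%E](@probability_setT _ _ _ (P x)) ltry.
  exists (C + `|M|); split; first exact: num_real.
  move=> N CN w _ /=; rewrite ltW//; apply: le_lt_trans CN.
  have := fC (X x t w); have := ler_norm M; have := ler_norm (- M).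
  rewrite normrN /h; move: (f _) => u; rewrite !ler_norml.
  by case: (leP u M) => uM h1 h2 /andP[h3 h4]; apply/andP; split; lra.
have -> : Pt t f x = \int[P x]_w h w.
  rewrite transition_Rintegral; congr fine; apply: ae_eq_integral => //.
  - exact/measurable_EFinP.
  - exact/measurable_EFinP.
  apply: filterS (regular_ae (Z_law x)) => w reg _; congr EFin.
  by rewrite /h min_l//; apply: fM; exact: path_dist.
rewrite -[leRHS](Rintegral_prob x); apply: le_Rintegral => //.
- by apply: (@integrable_observable t (fun=> M) `|M|).
- by move=> w _; rewrite /h ge_min lexx orbT.
Qed.

Lemma transition_norm_le t f C x M : measurable_fun setT f -> (forall y, `|f y| <= C) ->
  0 <= t -> (forall y, `|y.1 - x.1| <= a * t -> `|f y| <= M) -> `|Pt t f x| <= M.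
Proof.
move=> mf fC t0 fM; rewrite ler_norml; apply/andP; split; last first.
  by apply: (transition_le mf fC t0) => y /fM; rewrite ler_norml => /andP[].
rewrite lerNl -(@transitionN t f C)//.
apply: (@transition_le t _ C) => //; first exact: (measurableT_comp (@oppr_measurable R setT) mf).
- by move=> y; rewrite normrN.
- by move=> y /fM; rewrite ler_norml => /andP[+ _]; rewrite lerNl.
Qed.

Lemma transition_evolve t f x : measurable_fun setT f -> (forall y, 0 <= f y) ->
  0 <= t -> (\int[P x]_w (f (X x t w))%:E = evolve (EFin \o f) (t, x))%E.
Proof.
move=> mf f0 t0; rewrite -(expectation_evolve _ (Z_law x))//.
by split => [|y]; [exact/measurable_EFinP|rewrite lee_fin].
Qed.

Lemma evolve_transition t f C x : measurable_fun setT f -> (forall y, 0 <= f y) ->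
  (forall y, `|f y| <= C) -> 0 <= t -> evolve (EFin \o f) (t, x) = (Pt t f x)%:E.
Proof.
move=> mf f0 fC t0; rewrite -(transition_evolve x mf f0 t0) transition_Rintegral.
rewrite /Rintegral fineK//; apply: integrable_fin_num => //.
exact: integrable_observable mf fC.
Qed.

End Semigroup.

Section Renewal.
Context {R : realType} (m : zigzag_rates R).
Local Notation E := (R * bool)%type.
Local Notation mu := (@lebesgue_measure R).
Local Notation a := (speed m).
Local Notation lam := (rate m).
Local Notation flow := (flow a).
Local Notation surv := (surv m).
Local Notation dens := (dens m).
Local Notation jump_mean := (jump_mean m).
Local Notation kstep := (kstep m).
Local Notation evolve := (evolve m).
Context {d : measure_display} (Omega : E -> measurableType d)
  (P : forall x, probability (Omega x) R) (Z : forall x, nat -> {RV (P x) >-> R}).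
Hypothesis Z_law : forall x, waiting_times a lam x (Z x).

Local Notation Xx x := (zigzag a x (Z x)).
Local Notation Pt := (transition P (fun x => Xx x)).
Implicit Types (f : E -> R) (x y : E) (t C : R).

Definition jump_point r x : E := flip (flow r x).

Lemma continuous_jump_point r : continuous (jump_point r).
Proof.
move=> x; apply: continuous_comp; [exact: continuous_flow|exact: continuous_flip].
Qed.

Lemma continuous_jump_point_time (f : E -> R) x : continuous f ->
  continuous (fun r => f (jump_point r x)).
Proof.
move=> cf; apply: (@continuous_along_flow _ a _ (f \o @flip R)) => y.
by apply: continuous_comp; [exact: continuous_flip|exact: cf].
Qed.

Lemma integral_dens t x : 0 <= t ->
  \int[mu]_(r in `[0, t]) dens r x = 1 - surv t x.
Proof.
move=> t0.
have dS r : is_derive r (1 : R) (fun r => - surv r x) (dens r x).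
  by apply: is_derive_eq (is_deriveN (is_derive_surv m r x)) _; rewrite opprK.
rewrite (Rintegral_primitive t0 (@continuous_dens_time _ m x) dS).
by rewrite surv0; ring.
Qed.

Lemma integrable_dens_mul (u : R -> R) C t x : measurable_fun `[0, t] u ->
  (forall r, 0 <= r <= t -> `|u r| <= C) ->
  mu.-integrable `[0, t] (fun r => (dens r x * u r)%:E).
Proof.
move=> mu_ uC; apply: (@le_integrable _ _ _ mu _ _ _ (fun r => (dens r x * C)%:E)) => //.
- apply/measurable_EFinP/measurable_funM => //.
  by apply: measurable_funTS; exact: measurable_dens_at.
- move=> r /=; rewrite in_itv/= => rt; rewrite lee_fin !normrM.
  by rewrite ler_wpM2l// (le_trans (uC _ rt))// ler_norm.
- apply: continuous_integrable_itv => r.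
  by apply: cvgM; [exact: continuous_dens_time|exact: cvg_cst].
Qed.

(** The series evolve is jointly measurable; adding C to f brings f into the
    nonnegative functions for which evolve is meaningful. *)
Lemma measurable_transition_joint f C : measurable_fun setT f -> (forall y, `|f y| <= C) ->
  exists2 U : R * E -> R, measurable_fun setT U &
    forall t x, 0 <= t -> Pt t f x = U (t, x).
Proof.
move=> mf fC; pose h y := f y + C.
have h0 y : 0 <= h y by have := fC y; rewrite ler_norml => /andP[]; rewrite /h; lra.
have mh : measurable_fun setT h by apply: measurable_funD.
have gh : ge0_measurable (EFin \o h).
  by split=> [|y]; [exact/measurable_EFinP|rewrite lee_fin].
exists (fun p => fine (evolve (EFin \o h) p) - C).
  apply: measurable_funB => //; apply: (measurableT_comp (fine_measurable measurableT)).
  by case: (ge0_measurable_evolve m gh).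
move=> t x t0; rewrite -(transition_evolve Z_law x mh h0 t0).
rewrite -/(Rintegral (P x) setT (fun w => h (Xx x t w))) -transition_Rintegral.
by rewrite (transitionDc m Z t x C mf fC) addrK.
Qed.

Lemma measurable_transition t f C : measurable_fun setT f -> (forall y, `|f y| <= C) ->
  0 <= t -> measurable_fun setT (Pt t f).
Proof.
move=> mf fC t0; have [U mU UE] := measurable_transition_joint mf fC.
have -> : Pt t f = fun x => U (t, x) by apply/funext => x; rewrite UE.
by apply: (measurableT_comp mU (g := fun x => (t, x))); exact: measurable_fun_pair.
Qed.

Lemma measurable_transition_time t f C x : measurable_fun setT f -> (forall y, `|f y| <= C) ->
  measurable_fun `[0, t] (fun r => Pt (t - r) f (jump_point r x)).
Proof.
move=> mf fC; have [U mU UE] := measurable_transition_joint mf fC.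
have := @measurable_after_jump R m.
move=> mj; have mr : measurable_fun setT (fun r : R => (r, (t, x))).
  exact: measurable_fun_pair.
apply: eq_measurable_fun (measurable_funTS (measurableT_comp mU (measurableT_comp mj mr))).
by move=> r; rewrite inE/= in_itv/= => /andP[r0 rt]; rewrite UE// subr_ge0.
Qed.

Lemma transition_bounded t f C x : measurable_fun setT f -> (forall y, `|f y| <= C) ->
  0 <= t -> `|Pt t f x| <= C.
Proof. by move=> mf fC t0; apply: (transition_norm_le Z_law mf fC t0) => y _. Qed.

Lemma evolve_lt0 (F : E -> \bar R) p : p.1 < 0 -> evolve F p = 0%E.
Proof.
move=> p0; rewrite /evolve eseries0// => n _ _.
by apply: iter_kstep_lt0 => // q; exact: no_jump_lt0.
Qed.

Lemma renewal_ge0 t f C x : measurable_fun setT f -> (forall y, `|f y| <= C) ->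
  (forall y, 0 <= f y) -> 0 <= t ->
  Pt t f x = surv t x * f (flow t x) +
    \int[mu]_(r in `[0, t]) (dens r x * Pt (t - r) f (jump_point r x)).
Proof.
move=> mf fC f0 t0.
have gf : ge0_measurable (EFin \o f).
  by split=> [|y]; [exact/measurable_EFinP|rewrite lee_fin].
have evE s y : 0 <= s -> evolve (EFin \o f) (s, y) = (Pt s f y)%:E.
  exact: (evolve_transition Z_law y mf f0 fC).
have kE : kstep (evolve (EFin \o f)) (t, x) =
    (\int[mu]_(r in `[0%R, t]) (dens r x * Pt (t - r) f (jump_point r x))%:E)%E.
  rewrite /kstep /jump_mean integral_mkcond [RHS]integral_mkcond.
  apply: eq_integral => r _; rewrite !patchE !mem_setE !in_itv/= andbT.
  have [r0|//] := leP 0 r; have [rt|rt] := leP r t.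
    by rewrite /= evE ?subr_ge0// muleC.
  by rewrite evolve_lt0 ?mul0e//= subr_lt0.
have := evolve_renewal m gf (t, x); rewrite evE// no_jumpE//= kE.
have ifn : (\int[mu]_(r in `[0%R, t]) (dens r x * Pt (t - r) f (jump_point r x))%:E)%E
    \is a fin_num.
  apply: integrable_fin_num => //; apply: (@integrable_dens_mul _ C).
    exact: measurable_transition_time mf fC.
  by move=> r /andP[r0 rt]; apply: transition_bounded mf fC _; rewrite subr_ge0.
by rewrite -(fineK ifn) -EFinM -EFinD; case.
Qed.

(** Conditioning on the first jump. *)
Lemma renewal t f C x : measurable_fun setT f -> (forall y, `|f y| <= C) ->
  0 <= t ->
  Pt t f x = surv t x * f (flow t x) +
    \int[mu]_(r in `[0, t]) (dens r x * Pt (t - r) f (jump_point r x)).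
Proof.
move=> mf fC t0; pose h y := f y + C.
have h0 y : 0 <= h y by have := fC y; rewrite ler_norml => /andP[]; rewrite /h; lra.
have mh : measurable_fun setT h by apply: measurable_funD.
have hC y : `|h y| <= C + `|C|.
  by rewrite (le_trans (ler_normD _ _))// lerD.
have := renewal_ge0 x mh hC h0 t0.
have hE s y : Pt s h y = Pt s f y + C by exact: (transitionDc m Z s y C mf fC).
rewrite hE /h.
have -> : \int[mu]_(r in `[0, t]) (dens r x * Pt (t - r) h (jump_point r x)) =
    \int[mu]_(r in `[0, t]) (dens r x * Pt (t - r) f (jump_point r x)) +
    (1 - surv t x) * C.
  rewrite -integral_dens// -RintegralZr//; last first.
    exact/continuous_integrable_itv/continuous_dens_time.
  rewrite -RintegralD//.
  - by apply: eq_Rintegral => r _; rewrite hE mulrDr.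
  - apply: (@integrable_dens_mul _ C).
      exact: measurable_transition_time mf fC.
    by move=> r /andP[r0 rt]; apply: transition_bounded mf fC _; rewrite subr_ge0.
  - by apply: (@integrable_dens_mul (fun=> C) `|C|) => //.
lra.
Qed.

(** A jump before t has probability 1 - surv t x. *)
Lemma renewal_dist t f C x : measurable_fun setT f -> (forall y, `|f y| <= C) ->
  0 <= t -> `|Pt t f x - surv t x * f (flow t x)| <= C * (1 - surv t x).
Proof.
move=> mf fC t0; rewrite (renewal x mf fC t0) addrC addKr.
have iI : mu.-integrable `[0, t] (fun r => (dens r x * Pt (t - r) f (jump_point r x))%:E).
  apply: (@integrable_dens_mul _ C).
    exact: measurable_transition_time mf fC.
  by move=> r /andP[r0 rt]; apply: transition_bounded mf fC _; rewrite subr_ge0.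
rewrite (le_trans (le_normr_Rintegral _ iI))// mulrC -integral_dens//.
rewrite -RintegralZr//; last exact/continuous_integrable_itv/continuous_dens_time.
apply: le_Rintegral => //.
- by have := integrable_norm iI.
- by apply: (@integrable_dens_mul (fun=> C) `|C|) => //.
- move=> r /=; rewrite in_itv/= => /andP[r0 rt].
  rewrite normrM ger0_norm ?dens_ge0// ler_wpM2l ?dens_ge0//.
  by apply: transition_bounded mf fC _; rewrite subr_ge0.
Qed.

End Renewal.

(** * The Feller property *)

Section IterateMore.
Context {R : realType} (m : zigzag_rates R).
Local Notation E := (R * bool)%type.
Local Notation kstep := (kstep m).
Implicit Types (g : R * E -> \bar R) (p : R * E).

Lemma iter_kstep_le n g1 g2 p : ge0_measurable g1 -> ge0_measurable g2 ->
  (forall q, g1 q <= g2 q)%E -> (iter n kstep g1 p <= iter n kstep g2 p)%E.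
Proof.
move=> m1 m2 g12; elim: n p => [|n IH] p /=; first exact: g12.
have i1 := ge0_measurable_iter m n m1; have i2 := ge0_measurable_iter m n m2.
apply: le_jump_mean.
- exact: measurable_after_jump_at.
- exact: measurable_after_jump_at.
- by move=> r _; case: i1.
- by move=> r _; exact: IH.
Qed.

Lemma iter_kstepZ n (c : R) g p : 0 <= c -> ge0_measurable g ->
  iter n kstep (fun q => c%:E * g q)%E p = (c%:E * iter n kstep g p)%E.
Proof.
move=> c0 mg; elim: n p => [//|n IH] p /=.
have i1 := ge0_measurable_iter m n mg.
rewrite /kstep -jump_meanZ//.
- by apply: eq_jump_mean => r _; rewrite IH.
- exact: measurable_after_jump_at.
- by move=> r; case: i1.
Qed.

Lemma iter_kstep_series n (h : nat -> R * E -> \bar R) p :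
  (forall k, ge0_measurable (h k)) ->
  iter n kstep (fun q => \sum_(k <oo) h k q)%E p = (\sum_(k <oo) iter n kstep (h k) p)%E.
Proof.
move=> mh; elim: n p => [//|n IH] p /=; rewrite -kstep_series; last first.
  by move=> k; exact: ge0_measurable_iter.
by apply: eq_jump_mean => r _; rewrite IH.
Qed.

End IterateMore.

Section Feller.
Context {R : realType} (m : zigzag_rates R).
Local Notation E := (R * bool)%type.
Local Notation mu := (@lebesgue_measure R).
Local Notation a := (speed m).
Local Notation lam := (rate m).
Local Notation flow := (flow a).
Local Notation surv := (surv m).
Local Notation dens := (dens m).
Local Notation kstep := (kstep m).
Local Notation evolve := (evolve m).
Local Notation no_jump := (no_jump m).
Local Notation jump_point := (jump_point m).
Context {d : measure_display} (Omega : E -> measurableType d)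
  (P : forall x, probability (Omega x) R) (Z : forall x, nat -> {RV (P x) >-> R}).
Hypothesis Z_law : forall x, waiting_times a lam x (Z x).
Local Notation Xx x := (zigzag a x (Z x)).
Local Notation Pt := (transition P (fun x => Xx x)).

Lemma dens_le (c M t r : R) (x : E) : (forall x : E, `|x.1| <= c -> lam x <= M) ->
  0 <= r <= t -> `|x.1| + a * t <= c -> dens r x <= M.
Proof.
move=> hM /andP[r0 rt] xc; rewrite -[leRHS]mulr1 ler_pM ?rate_ge0 ?surv_ge0 ?surv_le1//.
apply: hM; have := flow_bound xc r0.
have : 0 <= a * (t - r) by rewrite mulr_ge0 ?subr_ge0// ltW// speed_gt0.
lra.
Qed.

Section Nonnegative.
Variables (f : E -> R) (C : R).
Hypotheses (cf : continuous f) (f_ge0 : forall y, 0 <= f y)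
  (f_le : forall y, f y <= C).

Let mf : measurable_fun setT f := continuous_measurable_state cf.

Let gf : ge0_measurable (EFin \o f).
Proof. by split=> [|y]; [exact/measurable_EFinP|rewrite lee_fin]. Qed.

Let fC y : `|f y| <= C.
Proof. by rewrite ger0_norm. Qed.

Let C_ge0 : 0 <= C.
Proof. exact: le_trans (f_ge0 (0, true)) _. Qed.

Let evolveE s y : 0 <= s -> evolve (EFin \o f) (s, y) = (Pt s f y)%:E.
Proof. exact: (evolve_transition Z_law). Qed.

Let evolve_le p : (evolve (EFin \o f) p <= C%:E * nonneg_time p)%E.
Proof.
case: p => t x; rewrite nonneg_timeE /=; have [t0|t0] := leP 0 t.
  rewrite mule1 evolveE// lee_fin.
  exact: le_trans (ler_norm _) (transition_bounded Z_law x mf fC t0).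
by rewrite mule0 evolve_lt0.
Qed.

Let term n p : \bar R := iter n kstep (no_jump (EFin \o f)) p.

Let mterm n : ge0_measurable (term n) := ge0_measurable_evolve_term m gf n.

Let term_le n p : (term n p <= C%:E)%E.
Proof.
apply: (@le_trans _ _ (evolve (EFin \o f) p)).
  rewrite /evolve (nneseries_split 0 n.+1); last by move=> k _; exact: (mterm k).2.
  have A0 : (0 <= \sum_(0 <= k < n) term k p)%E.
    by apply: sume_ge0 => k _; exact: (mterm k).2.
  have B0 : (0 <= \sum_(0 + n.+1 <= k <oo) term k p)%E.
    by apply: nneseries_ge0 => k _ _; exact: (mterm k).2.
  rewrite [in X in (_ <= X + _)%E]add0n big_nat_recr//= addeAC leeDr//.
  exact: adde_ge0.
apply: (le_trans (evolve_le p)); rewrite nonneg_timeE -EFinM lee_fin.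
by case: (0 <= p.1); rewrite ?mulr1 ?mulr0.
Qed.

(** The contribution to P_t f(x) of the paths with exactly n jumps. *)
Let w n t x : R := fine (term n (t, x)).

Let wE n t x : (w n t x)%:E = term n (t, x).
Proof.
rewrite /w fineK// ge0_fin_numE; last by exact: (mterm n).2.
exact: le_lt_trans (term_le n (t, x)) (ltry _).
Qed.

Let w_norm_le n t x : `|w n t x| <= C.
Proof.
have w0 : 0 <= w n t x by rewrite -lee_fin wE; exact: (mterm n).2.
by rewrite ger0_norm// -lee_fin wE.
Qed.

Let mw n (t : R) (x : E) : measurable_fun setT (fun r : R => w n (t - r) (jump_point r x)).
Proof.
apply: (measurableT_comp (fine_measurable measurableT)).
exact: (@measurable_after_jump_at _ m _ (t, x) (mterm n)).
Qed.

Let w_step n t x : 0 <= t ->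
  w n.+1 t x = \int[mu]_(r in `[0, t]) (dens r x * w n (t - r) (jump_point r x)).
Proof.
move=> t0; rewrite /Rintegral; congr fine.
have -> : term n.+1 (t, x) = (\int[mu]_(r in `[0%R, +oo[)
    (term n (t - r, jump_point r x)%R * (dens r x)%:E))%E by [].
rewrite [LHS]integral_mkcond [RHS]integral_mkcond.
apply: eq_integral => r _; rewrite !patchE !mem_setE !in_itv/= andbT.
have [r0|//] := leP 0 r; have [rt|rt] := leP r t.
  by rewrite -wE -EFinM mulrC.
rewrite /term iter_kstep_lt0 ?mul0e//=; last by rewrite subr_lt0.
by move=> q; exact: no_jump_lt0.
Qed.

(** By induction on n: the first jump time is integrated out, under a bound on the
    density that is uniform for nearby starting points. *)
Let w_continuous n t : continuous (w n t).
Proof.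
elim: n t => [|n IH] t.
  have t0E x : term 0 (t, x) = no_jump (EFin \o f) (t, x) by [].
  have [t0|t0] := leP 0 t; last first.
    have -> : w 0 t = cst 0 by apply/funext => x; rewrite /w t0E no_jump_lt0.
    by move=> x; exact: cvg_cst.
  have -> : w 0 t = fun x => surv t x * f (flow t x).
    by apply/funext => x; rewrite /w t0E no_jumpE.
  move=> x; apply: cvgM; first exact: continuous_surv.
  by apply: continuous_comp; [exact: continuous_flow|exact: cf].
have [t0|t0] := leP 0 t; last first.
  have -> : w n.+1 t = cst 0.
    apply/funext => x; rewrite /w /term iter_kstep_lt0// => q; exact: no_jump_lt0.
  by move=> x; exact: cvg_cst.
apply/continuous_branchP => j y.
have -> : (fun y => w n.+1 t (y, j)) = (fun y => \int[mu]_(r in `[0, t])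
    (dens r (y, j) * w n (t - r) (jump_point r (y, j)))).
  by apply/funext => z; rewrite w_step.
have [M M0 hM] := rate_bounded m (`|y| + 1 + a * t).
apply: (@continuity_under_integral R _ _ mu
  (fun y r => dens r (y, j) * w n (t - r) (jump_point r (y, j))) `[0, t] _
  (y - 1) (y + 1) _ _ (fun=> M * C)) => //.
- move=> z _; apply: (@integrable_dens_mul _ _ _ C) => //.
  by apply: measurable_funTS; exact: mw.
- apply: aeW => r _ z _.
  have c1 : continuous (fun y => dens r (y, j)).
    by have /continuous_branchP := @continuous_dens _ m r; exact.
  have c2 : continuous (fun y => w n (t - r) (jump_point r (y, j))).
    have := @continuous_branchP R R (fun x => w n (t - r) (jump_point r x)).
    case=> + _; apply => x.
    by apply: continuous_comp; [exact: continuous_jump_point|exact: IH].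
  by apply: cvgM; [exact: c1|exact: c2].
- by apply: continuous_integrable_itv => r; exact: cvg_cst.
- move=> z; rewrite /= in_itv/= => zy; apply: aeW => r.
  rewrite /= in_itv/= => rt; rewrite normrM ler_pM//.
  rewrite ger0_norm ?dens_ge0//; apply: dens_le hM rt _ => /=.
  have : `|z| <= `|y| + 1; last by lra.
  rewrite ler_norml; have := ler_norm y; have := ler_norm (- y); rewrite normrN; lra.
- by rewrite inE/= in_itv/=; lra.
Qed.

(** P_t f is the sum of the continuous functions w n t.  The tail of the series is
    at most C times the probability of n jumps, which is small uniformly for
    starting points near x. *)
Lemma continuous_transition_ge0 t : 0 <= t -> continuous (Pt t f).
Proof.
move=> t0 x; apply/cvgrPdist_le => e e0.
have [M M0 hM] := rate_bounded m (`|x.1| + 1 + a * t).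
have tail n y : `|y.1| <= `|x.1| + 1 ->
    `|Pt t f y - \sum_(0 <= k < n) w k t y| <= C * (expR (2 * M * t) * 2^-1 ^+ n).
  move=> yx.
  have tailE : ((Pt t f y)%:E = (\sum_(0 <= k < n) w k t y)%:E +
      iter n kstep (evolve (EFin \o f)) (t, y))%E.
    rewrite -evolveE// {1}/evolve (nneseries_split 0 n); last first.
      by move=> k _; exact: (mterm k).2.
    rewrite add0n -sumEFin; congr (_ + _)%E.
      by apply: eq_bigr => k _; rewrite wE.
    rewrite iter_kstep_series; last exact: mterm.
    rewrite -(@nneseries_addn _ (fun k => term k (t, y)) n).
      by apply: eq_eseriesr => k _; rewrite /term addnC iterD.
    by move=> k; exact: (mterm k).2.
  have me := ge0_measurable_evolve m gf.
  have mn := @ge0_measurable_nonneg_time R.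
  have mCn : ge0_measurable (fun q : R * E => C%:E * nonneg_time q)%E.
    split=> [|q]; last by rewrite mule_ge0//; case: mn.
    by apply: emeasurable_funM => //; case: mn.
  have i0 : (0 <= iter n kstep (evolve (EFin \o f)) (t, y))%E.
    by case: (ge0_measurable_iter m n me).
  have i1 : (iter n kstep (evolve (EFin \o f)) (t, y) <=
      (C * (expR (2 * M * t) * 2^-1 ^+ n))%:E)%E.
    apply: (le_trans (iter_kstep_le m n (t, y) me mCn evolve_le)).
    rewrite iter_kstepZ// EFinM lee_wpmul2l ?lee_fin//.
    by apply: iter_nonneg_time_le hM t0 _ => //; rewrite lerD2r.
  move: tailE i0 i1; case: (iter _ _ _ _) => // v.
  rewrite -EFinD => -[->]; rewrite !lee_fin addrAC subrr add0r => v0.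
  by rewrite ger0_norm.
have [n hn] : exists n, C * (expR (2 * M * t) * 2^-1 ^+ n) <= e / 3.
  have e3 : 0 < e / 3 by rewrite divr_gt0.
  have half_ge0 : 0 <= 2^-1 :> R by rewrite invr_ge0.
  have half_lt1 : 2^-1 < 1 :> R by rewrite invf_lt1// ltr1n.
  have [n hn] := geometric_small (C * expR (2 * M * t)) half_ge0 half_lt1 e3.
  by exists n; rewrite mulrA.
have cS : continuous (fun y => \sum_(0 <= k < n) w k t y).
  move=> y; elim: n {hn} => [|n IHn].
    have -> : (fun y => \sum_(0 <= k < 0) w k t y) = cst 0.
      by apply/funext => z; rewrite big_nil.
    exact: cvg_cst.
  have -> : (fun y => \sum_(0 <= k < n.+1) w k t y) =
      (fun y => \sum_(0 <= k < n) w k t y + w n t y).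
    by apply/funext => z; rewrite big_nat_recr.
  by apply: cvgD; [exact: IHn|exact: w_continuous].
have := cS x; move=> /cvgrPdist_le /(_ (e / 3)); rewrite divr_gt0// => /(_ isT) cSx.
have cn : continuous (fun y : E => `|y.1|).
  by apply/continuous_branchP => j z; exact: (@norm_continuous _ R^o).
near=> y.
have yx : `|y.1| <= `|x.1| + 1.
  near: y; apply: (cvgr_le `|x.1|); first exact: cn.
  by rewrite ltrDl.
have xx : `|x.1| <= `|x.1| + 1 by rewrite lerDl.
have h1 := le_trans (tail n y yx) hn; have h2 := le_trans (tail n x xx) hn.
have h3 : `|\sum_(0 <= k < n) w k t x - \sum_(0 <= k < n) w k t y| <= e / 3.
  by near: y.
move: h1 h2 h3; move: (Pt t f x) (Pt t f y) => u v.
set s1 := \sum_(0 <= k < n) _; set s2 := \sum_(0 <= k < n) _.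
rewrite !ler_norml => /andP[? ?] /andP[? ?] /andP[? ?]; apply/andP; split; lra.
Unshelve. all: by end_near. Qed.

End Nonnegative.

Lemma continuous_transition f C t : continuous f -> (forall y, `|f y| <= C) ->
  0 <= t -> continuous (Pt t f).
Proof.
move=> cf fC t0; pose h y := f y + C.
have h0 y : 0 <= h y by have := fC y; rewrite ler_norml => /andP[]; rewrite /h; lra.
have hC y : h y <= 2 * C by have := fC y; rewrite ler_norml => /andP[]; rewrite /h; lra.
have ch : continuous h by move=> y; apply: cvgD; [exact: cf|exact: cvg_cst].
have -> : Pt t f = fun x => Pt t h x - C.
  apply/funext => x.
  by rewrite (transitionDc m Z t x C (continuous_measurable_state cf) fC) addrK.
by move=> x; apply: cvgB; [exact: (continuous_transition_ge0 ch h0 hC t0)|exact: cvg_cst].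
Qed.

End Feller.

(** * The mild form of the generator equation *)

Section C0Facts.
Context {R : realType}.
Local Notation E := (R * bool)%type.
Implicit Types (phi : E -> R).

Lemma C0_continuous phi : C0 phi -> continuous phi.
Proof. by move=> h; apply/continuous_branchP => j; case: (h j). Qed.

Lemma C0_vanish phi (e : R) : C0 phi -> 0 < e ->
  exists2 M, 0 <= M & forall x : E, M <= `|x.1| -> `|phi x| <= e.
Proof.
move=> h e0.
have vanish j : exists2 M, 0 <= M & forall y : R, M <= `|y| -> `|phi (y, j)| <= e.
  have [_ hp hm] := h j.
  have [A [_ hA]] : \forall y \near +oo, `|phi (y, j)| <= e.
    move/cvgrPdist_le : hp => /(_ e e0); apply: filterS => y.
    by rewrite sub0r normrN.
  have [B [_ hB]] : \forall y \near -oo, `|phi (y, j)| <= e.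
    move/cvgrPdist_le : hm => /(_ e e0); apply: filterS => y.
    by rewrite sub0r normrN.
  exists (`|A| + `|B| + 1) => [|y hy]; first by rewrite !addr_ge0.
  have := ler_norm A; have := ler_norm (- B); have := normr_ge0 A; have := normr_ge0 B.
  rewrite normrN => ? ? ? ?.
  have [y0|y0] := leP 0 y.
    by apply: hA; rewrite (ger0_norm y0) in hy; rewrite /=; lra.
  by apply: hB; rewrite (ltr0_norm y0) in hy; rewrite /=; lra.
have [M1 M10 h1] := vanish true; have [M2 M20 h2] := vanish false.
exists (M1 + M2); first exact: addr_ge0.
by move=> [y []] /= hy; [apply: h1|apply: h2]; lra.
Qed.

Lemma C0_bounded phi : C0 phi -> exists2 C, 0 <= C & forall x, `|phi x| <= C.
Proof.
move=> h; have [M M0 hM] := C0_vanish h ltr01.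
have bnd j : exists2 C, 0 <= C & forall y : R, `|y| <= M -> `|phi (y, j)| <= C.
  have [||y _ hy] := @EVT_max R (fun y => `|phi (y, j)|) (- M) M; first lra.
    apply: continuous_subspaceT => y.
    have /continuous_branchP cphi := C0_continuous h.
    by apply: cvg_norm; exact: cphi.
  exists `|phi (y, j)| => // z; rewrite ler_norml => zM; apply: hy.
  by rewrite in_itv.
have [C1 C10 h1] := bnd true; have [C2 C20 h2] := bnd false.
exists (C1 + C2 + 1) => [|[y j]]; first by rewrite !addr_ge0.
have [yM|yM] := leP M `|y|; first by apply: le_trans (hM (y, j) yM) _; lra.
by case: j; [apply: le_trans (h1 _ (ltW yM)) _|apply: le_trans (h2 _ (ltW yM)) _]; lra.
Qed.

End C0Facts.

Section MildEquation.
Context {R : realType} (m : zigzag_rates R).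
Local Notation E := (R * bool)%type.
Local Notation mu := (@lebesgue_measure R).
Local Notation a := (speed m).
Local Notation lam := (rate m).
Local Notation flow := (flow a).
Local Notation surv := (surv m).
Local Notation dens := (dens m).
Local Notation jump_point := (jump_point m).
Implicit Types (f k : E -> R).

(** Lf = k, integrated along the flow.  It makes sense for functions f that are
    merely continuous, passes to uniform limits, and compares directly with
    the renewal equation of the semigroup. *)
Definition mild f k : Prop := forall t x, 0 <= t ->
  f x = surv t x * f (flow t x) + \int[mu]_(r in `[0, t])
    (dens r x * f (jump_point r x) - surv r x * k (flow r x)).

Lemma continuous_mild_integrand f k x : continuous f -> continuous k ->
  continuous (fun r => dens r x * f (jump_point r x) - surv r x * k (flow r x)).
Proof.
move=> cf ck r; apply: cvgB; apply: cvgM.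
- exact: continuous_dens_time.
- exact: continuous_jump_point_time.
- exact: continuous_surv_time.
- exact: (continuous_along_flow ck).
Qed.

Lemma mild_integral_bound f k e t x : continuous f -> continuous k ->
  0 <= t -> (forall y, `|f y| <= e) -> (forall y, `|k y| <= e) ->
  `|\int[mu]_(r in `[0, t]) (dens r x * f (jump_point r x) - surv r x * k (flow r x))|
  <= e * (1 + t).
Proof.
move=> cf ck t0 fe ke.
have e0 : 0 <= e by apply: le_trans (fe (0, true)).
have ci := @continuous_mild_integrand f k x cf ck.
have ii := @continuous_integrable_itv R _ 0 t ci.
rewrite (le_trans (le_normr_Rintegral _ ii))//.
have -> : e * (1 + t) = e * (surv t x + t) + \int[mu]_(r in `[0, t]) (dens r x * e).
  rewrite RintegralZr//; last exact/continuous_integrable_itv/continuous_dens_time.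
  by rewrite integral_dens//; ring.
have -> : e * (surv t x + t) = e * surv t x + \int[mu]_(r in `[0, t]) e.
  by rewrite Rintegral_cst_itv// mulrDr.
rewrite -addrA -RintegralD//; last 2 first.
- by apply: continuous_integrable_itv => r; exact: cvg_cst.
- apply: continuous_integrable_itv => r.
  by apply: cvgM; [exact: continuous_dens_time|exact: cvg_cst].
apply: (@le_trans _ _ (\int[mu]_(r in `[0, t]) (e + dens r x * e))); last first.
  by rewrite lerDr mulr_ge0// surv_ge0.
apply: le_Rintegral => //.
- by apply: continuous_integrable_itv => r; apply: cvg_norm; exact: ci.
- apply: continuous_integrable_itv => r; apply: cvgD; first exact: cvg_cst.
  by apply: cvgM; [exact: continuous_dens_time|exact: cvg_cst].
move=> r /=; rewrite in_itv/= => /andP[r0 _].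
apply: (le_trans (ler_normB _ _)); rewrite addrC lerD// normrM.
  rewrite (ger0_norm (surv_ge0 _ _ _)) -[leRHS]mul1r ler_pM ?surv_ge0//.
  exact: surv_le1.
by rewrite (ger0_norm (dens_ge0 _ _ _)) ler_wpM2l// dens_ge0.
Qed.

(** For each t and x both sides of the mild equation are continuous in (f, k) for
    the uniform norms. *)
Lemma mild_closed f k : continuous f -> continuous k ->
  (forall e, 0 < e -> exists f' k', [/\ mild f' k', continuous f', continuous k',
    (forall y, `|f y - f' y| <= e) & (forall y, `|k y - k' y| <= e)]) ->
  mild f k.
Proof.
move=> cf ck appr t x t0; apply/eqP; rewrite -subr_eq0 -normr_le0.
apply/ler_addgt0Pr => e e0; rewrite add0r.
(* Of the 3 + t parts, one bounds the error in f x, one that in the survival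
   term, and 1 + t that in the integral. *)
have d0 : 0 < e / (3 + t) by rewrite divr_gt0//; lra.
have [f' [k' [mfk' cf' ck' ff' kk']]] := appr _ d0.
have := mfk' t x t0.
pose F y := f y - f' y; pose K y := k y - k' y.
have cF : continuous F by move=> y; apply: cvgB; [exact: cf|exact: cf'].
have cK : continuous K by move=> y; apply: cvgB; [exact: ck|exact: ck'].
have := mild_integral_bound x cF cK t0 ff' kk'.
have -> : \int[mu]_(r in `[0, t]) (dens r x * F (jump_point r x) - surv r x * K (flow r x)) =
  \int[mu]_(r in `[0, t]) (dens r x * f (jump_point r x) - surv r x * k (flow r x)) -
  \int[mu]_(r in `[0, t]) (dens r x * f' (jump_point r x) - surv r x * k' (flow r x)).
  rewrite -RintegralB//.
  - by apply: eq_Rintegral => r _; rewrite /F /K; ring.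
  - exact/continuous_integrable_itv/continuous_mild_integrand.
  - exact/continuous_integrable_itv/continuous_mild_integrand.
set I := Rintegral _ _ _; set I' := Rintegral _ _ _ => hI e'.
have h1 := ff' x.
have h2 : `|surv t x * (f (flow t x) - f' (flow t x))| <= e / (3 + t).
  rewrite normrM (ger0_norm (surv_ge0 _ _ _)) -[leRHS]mul1r.
  by apply: ler_pM; rewrite ?surv_ge0// surv_le1.
have -> : f x - (surv t x * f (flow t x) + I) =
   (f x - f' x) - surv t x * (f (flow t x) - f' (flow t x)) - (I - I').
  by rewrite [in RHS]e'; ring.
have -> : e = e / (3 + t) + e / (3 + t) + e / (3 + t) * (1 + t) by field; lra.
apply: (le_trans (ler_normB _ _)); rewrite lerD//.
by apply: (le_trans (ler_normB _ _)); rewrite lerD.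
Qed.

(** By the definition of L, the integrand is the derivative of
    r |-> - surv r x * f(flow r x). *)
Lemma L_graph_mild f k : L_dom a lam f -> k = L_op a lam f -> mild f k.
Proof.
move=> [Cf C1f CL] -> t x t0.
have cf := C0_continuous Cf; have cL := C0_continuous CL.
have dB r : is_derive r (1 : R) (fun r => - (surv r x * f (flow r x)))
    (dens r x * f (jump_point r x) - surv r x * L_op a lam f (flow r x)).
  have db : is_derive (flow r x).1 (1 : R) (branch f x.2) (derive1 (branch f x.2) (flow r x).1).
    by rewrite derive1E; apply: derivableP; case: (C1f x.2).
  have d1 := @is_derive1_comp R (branch f x.2) (fun s => (flow s x).1) r _ _ db
     (is_derive_flow a r x).
  have d2 := is_deriveN (is_deriveM (is_derive_surv m r x) d1).
  apply: (is_derive_eq d2).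
  rewrite /L_op /dens /jump_point /GRing.scale/= /branch /flip /=.
  by rewrite /flow /=; ring.
rewrite (Rintegral_primitive t0 (@continuous_mild_integrand _ _ x cf cL) dB).
by rewrite surv0 flow0; ring.
Qed.

(** The mild equation expresses f along the flow through the integral of a
    continuous function; the flow moves at speed a > 0 on each branch, so f is C^1
    there, and differentiating the equation gives Lf = k. *)
Lemma mild_L_graph f k : C0 f -> C0 k -> mild f k ->
  L_dom a lam f /\ k = L_op a lam f.
Proof.
move=> Cf Ck mfk; have cf := C0_continuous Cf; have ck := C0_continuous Ck.
pose D (z : E) : R := k z - lam z * (f (flip z) - f z).
have df j y : is_derive y (1 : R) (branch f j) (vel R j / a * D (y, j)).
  (* The equation holds for nonnegative times only: z is reached at the interior
     time 1 of a trajectory that starts behind it. *)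
  pose z : E := (y, j); pose x := flow (-1) z.
  have zx : flow 1 x = z by rewrite /x -flowD addrC subrr flow0.
  have cb := @continuous_mild_integrand f k x cf ck.
  have [B dB] := continuous_primitive cb.
  pose H t := (f x + B 0 - B t) * expR (hazard m t x).
  have fH t : 0 <= t -> f (flow t x) = H t.
    move=> t0; have := mfk t x t0; rewrite (Rintegral_primitive t0 cb dB) => e.
    rewrite /H (_ : f x + B 0 - B t = surv t x * f (flow t x)); last by rewrite e; ring.
    by rewrite mulrAC /surv -expRD addNr expR0 mul1r.
  have dH : is_derive (1 : R) (1 : R) H (D z).
    have d1 := is_deriveB (is_derive_cst (f x + B 0) (1 : R) (1 : R)) (dB 1).
    have d2 := @is_derive1_comp R expR (fun t => hazard m t x) 1 _ _
      (is_derive_expR _) (is_derive_hazard m 1 x).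
    apply: (is_derive_eq (is_deriveM d1 d2)).
    have := fH 1 ler01; rewrite zx /H /D /GRing.scale/= => ->.
    rewrite /dens /jump_point zx /surv.
    have e1 : expR (hazard m 1 x) * expR (- hazard m 1 x) = 1.
      by rewrite -expRD subrr expR0.
    have -> : (cst (f x + B 0) - B) 1 = f x + B 0 - B 1 by [].
    move: e1; move: (expR (hazard m 1 x)) (expR (- hazard m 1 x)) => u v e1.
    apply/eqP; rewrite -subr_eq0; apply/eqP.
    transitivity ((u * v - 1) * (k z - lam z * f (flip z))); first ring.
    by rewrite e1 subrr mul0r.
  pose tau y' := 1 + (vel R j / a) * (y' - y).
  have tauE y' : flow (tau y') x = (y', j).
    rewrite /tau flowD zx /flow /=; congr pair.
    have -> : a * vel R j * (vel R j / a * (y' - y)) =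
      (vel R j * vel R j) * (a / a) * (y' - y) by ring.
    rewrite divff ?gt_eqF ?speed_gt0// /vel; case: (j); ring.
  have tauy : tau y = 1 by rewrite /tau subrr mulr0 addr0.
  have dtau : is_derive y (1 : R) tau (vel R j / a).
    have d1 := is_deriveB (is_derive_id y (1 : R)) (is_derive_cst y y (1 : R)).
    have d2 := is_deriveD (is_derive_cst (1 : R) y (1 : R)) (is_deriveZ (vel R j / a) d1).
    by apply: (is_derive_eq d2); rewrite /GRing.scale/=; ring.
  have dH' : is_derive (tau y) (1 : R) H (D z) by rewrite tauy.
  have dc := is_derive1_comp dH' dtau.
  rewrite mulrC; apply: near_eq_is_derive dc.
  have ctau : {for y, continuous tau}.
    by apply/differentiable_continuous/derivable1_diffP; case: dtau.
  near=> y'; rewrite /= /branch -fH ?tauE//.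
  near: y'; apply: (cvgr_ge 1); last exact: ltr01.
  by rewrite -tauy.
have dfE j y : derive1 (branch f j) y = vel R j / a * D (y, j).
  by rewrite derive1E; case: (df j y).
have Lf : L_op a lam f = k.
  apply/funext => -[y j]; rewrite /L_op /= dfE /D /flip/=.
  have -> : a * vel R j * (vel R j / a * (k (y, j) - lam (y, j) * (f (y, ~~ j) - f (y, j)))) =
    (vel R j * vel R j) * (a / a) * (k (y, j) - lam (y, j) * (f (y, ~~ j) - f (y, j))) by ring.
  rewrite divff ?gt_eqF ?speed_gt0// /vel; case: j; ring.
split=> //; split=> //; last by rewrite Lf.
move=> j; split; first by move=> y; case: (df j y).
have -> : derive1 (branch f j) = fun y => vel R j / a * D (y, j).
  by apply/funext => y; rewrite dfE.
have cD : continuous D.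
  move=> z; apply: cvgB; first exact: ck.
  apply: cvgM; first exact: rate_continuous.
  apply: cvgB; last exact: cf.
  by apply: continuous_comp; [exact: continuous_flip|exact: cf].
move=> y; apply: cvgM; first exact: cvg_cst.
by have /continuous_branchP := cD; exact.
Unshelve. all: by end_near. Qed.

End MildEquation.

(** * Identification of the generator *)

Section RightDerivative.
Context {R : realType}.
Local Notation mu := (@lebesgue_measure R).

(** The largest t such that |v s - v 0| <= e s for all s <= t is attained by
    continuity, and it cannot be less than T, since the right derivative of v
    vanishes there. *)
Lemma right_derivative0_cst (v : R -> R) (T : R) : 0 <= T -> continuous v ->
  (forall t, 0 <= t < T -> forall e, 0 < e -> exists2 dlt, 0 < dlt &
    forall h, 0 < h < dlt -> `|v (t + h) - v t| <= e * h) ->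
  v T = v 0.
Proof.
move=> T0 cv dv; apply/eqP; rewrite -subr_eq0 -normr_le0.
apply/ler_addgt0Pr => e0 e0_gt0; rewrite add0r.
pose e := e0 / (T + 1).
have e_gt0 : 0 < e by rewrite divr_gt0//; lra.
suff : `|v T - v 0| <= e * T.
  move=> h; apply: (le_trans h); rewrite /e mulrAC ler_pdivrMr; last lra.
  by rewrite ler_wpM2l ?ltW//; lra.
pose S := [set t | 0 <= t <= T /\ forall s, 0 <= s <= t -> `|v s - v 0| <= e * s].
have S0 : S 0.
  split; first by rewrite lexx.
  by move=> s s0; rewrite (_ : s = 0) ?subrr ?normr0 ?mulr0//; lra.
have ubS : ubound S T by move=> t [/andP[]].
have hS : has_sup S by split; [exists 0|exists T].
pose c := sup S.
have c0 : 0 <= c by exact: sup_upper_bound.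
have cT : c <= T by apply: ge_sup => //; exists 0.
have ltc s : 0 <= s -> s < c -> `|v s - v 0| <= e * s.
  move=> s0 sc; have pos : 0 < c - s by rewrite subr_gt0.
  have [t [_ ht] st] := sup_adherent pos hS.
  by apply: ht; rewrite s0 /=; rewrite -/c in st; lra.
have cc : `|v c - v 0| <= e * c.
  have [->|cpos] := eqVneq c 0; first by rewrite subrr normr0 mulr0.
  have {}cpos : 0 < c by rewrite lt_neqAle eq_sym cpos.
  apply/ler_addgt0Pr => eta eta0.
  have /cvgrPdist_le /(_ eta eta0) [r /= r0 hr] := cv c.
  pose s := Num.max 0 (c - r / 2).
  have sc : s < c by rewrite gt_max cpos/=; lra.
  have s0 : 0 <= s by rewrite le_max lexx.
  have sr : c - r / 2 <= s by rewrite le_max lexx orbT.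
  have h1 : `|v c - v s| <= eta by apply: hr; rewrite /= ger0_norm; lra.
  have h2 := ltc s s0 sc.
  have h3 : e * s <= e * c by rewrite ler_wpM2l ?ltW.
  have := ler_distD (v s) (v c) (v 0); lra.
have [ceT|cneT] := eqVneq c T; first by rewrite -ceT.
have ltcT : c < T by rewrite lt_neqAle cneT.
have c0T : 0 <= c < T by rewrite c0.
have [dlt dlt0 hd] := dv c c0T e e_gt0.
pose t := c + Num.min (dlt / 2) (T - c).
have mpos : 0 < Num.min (dlt / 2) (T - c) by rewrite lt_min divr_gt0//= subr_gt0.
have : S t.
  split.
    rewrite /t; have : Num.min (dlt / 2) (T - c) <= T - c by rewrite ge_min lexx orbT.
    by move=> ?; apply/andP; split; lra.
  move=> s /andP[s0 st]; have [sc|cs] := leP s c.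
    by move: sc; rewrite le_eqVlt => /predU1P[->//|]; exact: ltc.
  have : Num.min (dlt / 2) (T - c) <= dlt / 2 by rewrite ge_min lexx.
  rewrite /t in st => hm.
  have h1 : `|v (c + (s - c)) - v c| <= e * (s - c) by apply: hd; lra.
  have cs' : c + (s - c) = s by ring.
  rewrite cs' in h1.
  have := ler_distD (v c) (v s) (v 0); rewrite mulrBr in h1; lra.
move=> /(sup_upper_bound hS); rewrite -/c /t; lra.
Qed.

Lemma Rintegral_near_cst (u : R -> R) (h c e : R) : 0 <= h ->
  mu.-integrable `[0, h] (EFin \o u) ->
  (forall r, 0 <= r <= h -> `|u r - c| <= e) ->
  `|\int[mu]_(r in `[0, h]) u r - h * c| <= h * e.
Proof.
move=> h0 iu uc.
have cstE (k : R) : \int[mu]_(r in `[0, h]) k = h * k.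
  by rewrite Rintegral_cst_itv// mulrC.
have icst (k : R) : mu.-integrable `[0, h] (EFin \o cst k).
  by apply: continuous_integrable_itv => ?; exact: cvg_cst.
have iuc : mu.-integrable `[0, h] (EFin \o (fun r => u r - c)).
  by refine (integrableB _ iu (icst c)).
rewrite -cstE -RintegralB//; last exact: (icst c).
rewrite (le_trans (le_normr_Rintegral _ iuc))// -cstE.
apply: le_Rintegral => //.
- by have := integrable_norm iuc.
- exact: (icst e).
Qed.

End RightDerivative.

Section Generator.
Context {R : realType} (m : zigzag_rates R).
Local Notation E := (R * bool)%type.
Local Notation mu := (@lebesgue_measure R).
Local Notation a := (speed m).
Local Notation lam := (rate m).
Local Notation flow := (flow a).
Local Notation surv := (surv m).
Local Notation dens := (dens m).
Local Notation jump_point := (jump_point m).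
Local Notation mild := (mild m).
Context {d : measure_display} (Omega : E -> measurableType d)
  (P : forall x, probability (Omega x) R) (Z : forall x, nat -> {RV (P x) >-> R}).
Hypothesis Z_law : forall x, waiting_times a lam x (Z x).
Local Notation Xx x := (zigzag a x (Z x)).
Local Notation Pt := (transition P (fun x => Xx x)).

Lemma surv_ge (c M t : R) (x : E) : 0 <= t ->
  (forall x : E, `|x.1| <= c -> lam x <= M) -> `|x.1| + a * t <= c ->
  expR (- (M * t)) <= surv t x.
Proof.
move=> t0 hM xc; rewrite /surv ler_expR lerN2 -hazardE//.
rewrite -(Rintegral_cst_itv M t0).
apply: le_Rintegral => //.
- apply: continuous_integrable_itv.
  exact: (continuous_along_flow (@rate_continuous _ m)).
- by apply: continuous_integrable_itv => ?; exact: cvg_cst.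
- move=> r /=; rewrite in_itv/= => /andP[r0 rt]; apply: hM.
  have := flow_bound xc r0.
  have : 0 <= a * (t - r) by rewrite mulr_ge0 ?subr_ge0// ltW// speed_gt0.
  lra.
Qed.

Lemma surv_dist (c M t : R) (x : E) : 0 <= t ->
  (forall x : E, `|x.1| <= c -> lam x <= M) -> `|x.1| + a * t <= c ->
  0 <= 1 - surv t x <= M * t.
Proof.
move=> t0 hM xc; rewrite subr_ge0 surv_le1//=.
have := surv_ge t0 hM xc; have := expR_ge1Dx (- (M * t)); lra.
Qed.

Lemma transition_mild f k C t x : mild f k -> continuous f -> continuous k ->
  (forall y, `|f y| <= C) -> 0 <= t ->
  Pt t f x - f x = \int[mu]_(r in `[0, t])
    (dens r x * (Pt (t - r) f (jump_point r x) - f (jump_point r x)) +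
     surv r x * k (flow r x)).
Proof.
move=> mfk cf ck fC t0; have mf := continuous_measurable_state cf.
rewrite (renewal Z_law x mf fC t0) [X in _ - X](mfk t x t0).
rewrite opprD addrACA subrr add0r -RintegralB//.
- by apply: eq_Rintegral => r _; ring.
- apply: (@integrable_dens_mul _ _ _ C).
    exact: measurable_transition_time mf fC.
  by move=> r /andP[r0 rt]; apply: (transition_bounded Z_law _ mf fC); rewrite subr_ge0.
- exact/continuous_integrable_itv/continuous_mild_integrand.
Qed.

Lemma integrable_transition_mild f k C t x : continuous f -> continuous k ->
  (forall y, `|f y| <= C) ->
  mu.-integrable `[0, t] (EFin \o (fun r =>
    dens r x * (Pt (t - r) f (jump_point r x) - f (jump_point r x)) +
    surv r x * k (flow r x))).
Proof.
move=> cf ck fC; have mf := continuous_measurable_state cf.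
have i1 : mu.-integrable `[0, t] (EFin \o (fun r =>
    dens r x * (Pt (t - r) f (jump_point r x) - f (jump_point r x)))).
  apply: (@integrable_dens_mul _ _ _ (C + C)).
    apply: measurable_funB; first exact: measurable_transition_time mf fC.
    apply: measurable_funTS; apply: continuous_measurable_fun.
    exact: continuous_jump_point_time.
  move=> r /andP[r0 rt]; apply: (le_trans (ler_normB _ _)); rewrite lerD//.
  by apply: (transition_bounded Z_law _ mf fC); rewrite subr_ge0.
have i2 : mu.-integrable `[0, t] (EFin \o (fun r => surv r x * k (flow r x))).
  apply: continuous_integrable_itv => r.
  by apply: cvgM; [exact: continuous_surv_time|exact: (continuous_along_flow ck)].
by refine (integrableD _ i1 i2).
Qed.

(** M2 t solves the equation of transition_mild with M2 in place of k, so the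
    excess of P_t f - f over M2 t solves a homogeneous renewal inequality.  Its
    kernel has mass at most rho = 1 - exp(- M t) < 1 as long as the process cannot
    leave the region where the rates are at most M; iteration shows that the excess
    is at most 0. *)
Lemma transition_mild_le f k C M2 t x : mild f k -> continuous f -> continuous k ->
  (forall y, `|f y| <= C) -> 0 <= t ->
  (forall y, `|y.1 - x.1| <= a * t -> k y <= M2) -> Pt t f x - f x <= M2 * t.
Proof.
move=> mfk cf ck fC t0 kM; have mf := continuous_measurable_state cf.
have [M M0 hM] := rate_bounded m (`|x.1| + a * t).
pose rho := 1 - expR (- (M * t)).
have rho0 : 0 <= rho.
  by rewrite subr_ge0 -expR0 ler_expR oppr_le0 mulr_ge0// ltW.
have rho1 : rho < 1 by rewrite /rho; have := expR_gt0 (- (M * t)); lra.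
pose Q := C + C + `|M2| * t.
have C0 : 0 <= C by apply: le_trans (fC x).
have Q0 : 0 <= Q by rewrite !addr_ge0// mulr_ge0.
(* The induction runs over all points z from which the process cannot leave, within
   the time s that is left, the region reachable from x. *)
have excess n s z : 0 <= s <= t -> `|z.1 - x.1| <= a * (t - s) ->
    Pt s f z - f z <= M2 * s + Q * rho ^+ n.
  elim: n s z => [|n IH] s z /andP[s0 st] zx.
    rewrite expr0 mulr1.
    have h1 := transition_bounded Z_law z mf fC s0.
    have h2 := fC z; move: h1 h2; rewrite !ler_norml => /andP[_ h1] /andP[h2 _].
    have h3 : - (M2 * s) <= `|M2| * t.
      rewrite -mulNr; apply: (@le_trans _ _ (`|M2| * s)).
        by rewrite ler_wpM2r// -normrN ler_norm.
      by rewrite ler_wpM2l.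
    rewrite /Q; lra.
  pose I2 r := dens r z * (M2 * (s - r)) + surv r z * M2.
  have cI2 : continuous I2.
    move=> r; apply: cvgD; apply: cvgM.
    - exact: continuous_dens_time.
    - apply: cvgM; first exact: cvg_cst.
      by apply: cvgB; [exact: cvg_cst|exact: cvg_id].
    - exact: continuous_surv_time.
    - exact: cvg_cst.
  have dB r : is_derive r (1 : R) (fun r => - (surv r z * (M2 * (s - r)))) (I2 r).
    have d0 := is_deriveB (is_derive_cst s r (1 : R)) (is_derive_id r (1 : R)).
    have dM : is_derive r (1 : R) (fun r => M2 * (s - r)) (- M2).
      by apply: (is_derive_eq (is_deriveZ M2 d0)); rewrite /GRing.scale/=; ring.
    apply: (is_derive_eq (is_deriveN (is_deriveM (is_derive_surv m r z) dM))).
    by rewrite /I2 /GRing.scale/=; ring.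
  have intI2 : \int[mu]_(r in `[0, s]) I2 r = M2 * s.
    rewrite (Rintegral_primitive s0 cI2 dB) surv0; ring.
  rewrite (transition_mild z mfk cf ck fC s0).
  pose q := Q * rho ^+ n.
  have q0 : 0 <= q by rewrite mulr_ge0// exprn_ge0.
  have idq : mu.-integrable `[0, s] (EFin \o (fun r => dens r z * q)).
    apply: continuous_integrable_itv => r.
    by apply: cvgM; [exact: continuous_dens_time|exact: cvg_cst].
  have iI2 : mu.-integrable `[0, s] (EFin \o I2) by exact: continuous_integrable_itv.
  apply: (@le_trans _ _ (\int[mu]_(r in `[0, s]) (I2 r + dens r z * q))).
    apply: le_Rintegral => //.
    - exact: integrable_transition_mild fC.
    - by refine (integrableD _ iI2 idq).
    move=> r /=; rewrite in_itv/= => /andP[r0 rs].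
    rewrite /I2 addrAC -mulrDr lerD//.
      rewrite ler_wpM2l ?dens_ge0//; apply: IH.
        by apply/andP; split; lra.
      have := flow_dist a r z; rewrite (ger0_norm r0) (gtr0_norm (speed_gt0 m)) => e.
      have := ler_distD z.1 (flow r z).1 x.1; rewrite e /jump_point /=.
      move=> h; apply: (le_trans h); rewrite !mulrBr in zx *; lra.
    rewrite ler_wpM2l ?surv_ge0//; apply: kM.
    have := flow_dist a r z; rewrite (ger0_norm r0) (gtr0_norm (speed_gt0 m)) => e.
    have := ler_distD z.1 (flow r z).1 x.1; rewrite e => h; apply: (le_trans h).
    have : a * r <= a * s by rewrite ler_wpM2l// ltW// speed_gt0.
    by rewrite mulrBr in zx; lra.
  rewrite RintegralD// intI2 lerD2l RintegralZr//; last first.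
    exact/continuous_integrable_itv/continuous_dens_time.
  have -> : Q * rho ^+ n.+1 = rho * q by rewrite /q exprS; ring.
  rewrite integral_dens// ler_wpM2r// /rho lerD2l lerN2.
  have zc : `|z.1| + a * s <= `|x.1| + a * t.
    have := ler_distD x.1 z.1 0; rewrite !subr0 mulrBr in zx * => h; lra.
  apply: le_trans (surv_ge s0 hM zc).
  by rewrite ler_expR lerN2 ler_wpM2l// ltW.
apply/ler_addgt0Pr => e e0.
have [n hn] := geometric_small Q rho0 rho1 e0.
have hx : `|x.1 - x.1| <= a * (t - t) by rewrite !subrr normr0 mulr0.
apply: (le_trans (excess n t x _ hx)); first by rewrite t0 lexx.
by rewrite lerD2l.
Qed.

Lemma mildN f k : continuous f -> continuous k -> mild f k ->
  mild (fun y => - f y) (fun y => - k y).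
Proof.
move=> cf ck mfk t x t0; rewrite (mfk t x t0) opprD mulrN; congr (_ + _).
rewrite -[LHS]mulN1r -RintegralZl//.
  by apply: eq_Rintegral => r _; ring.
exact/continuous_integrable_itv/continuous_mild_integrand.
Qed.

Lemma transition_mild_norm_le f k C M2 t x : mild f k -> continuous f -> continuous k ->
  (forall y, `|f y| <= C) -> 0 <= t ->
  (forall y, `|y.1 - x.1| <= a * t -> `|k y| <= M2) -> `|Pt t f x - f x| <= M2 * t.
Proof.
move=> mfk cf ck fC t0 kM; rewrite ler_norml; apply/andP; split; last first.
  apply: (transition_mild_le mfk cf ck fC t0) => y /kM.
  by rewrite ler_norml => /andP[].
have mf := continuous_measurable_state cf.
rewrite lerNl opprB addrC.
have -> : - Pt t f x + f x = Pt t (fun y => - f y) x - - f x.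
  by rewrite (transitionN m Z t x mf fC) opprK.
apply: (@transition_mild_le _ (fun y => - k y) C) => //.
- exact: mildN.
- by move=> y; apply: cvgN; exact: cf.
- by move=> y; apply: cvgN; exact: ck.
- by move=> y; rewrite normrN.
- by move=> y /kM; rewrite ler_norml => /andP[+ _]; rewrite lerNl.
Qed.

End Generator.

Section RealFacts.
Context {R : realType}.

Lemma uniform_continuity_segment (g : R -> R) (N e : R) : continuous g -> 0 < e ->
  exists2 dlt, 0 < dlt & forall x y, `|x| <= N -> `|y - x| <= dlt -> `|g y - g x| <= e.
Proof.
move=> cg e0.
have cov : near_covering `[- N, N] by apply/compact_near_coveringP; exact: segment_compact.
pose Q (dlt x : R) := forall y, `|y - x| <= dlt -> `|g y - g x| <= e.
have [|r /= r0 hr] := cov R (0^'+) Q _.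
  move=> x _; have e2 : 0 < e / 2 by rewrite divr_gt0.
  have /cvgrPdist_le /(_ _ e2) [r /= r0 hr] := cg x.
  have r2 : 0 < r / 2 by rewrite divr_gt0.
  exists ([set x' | `|x - x'| < r / 2], [set dlt | dlt < r / 2]) => /=.
    split; last exact: nbhs_right_lt.
    by exists (r / 2).
  move=> [x' dlt] /= [xx' dltr] y yx'.
  have h1 : `|g x - g x'| <= e / 2 by apply: hr => /=; lra.
  have h2 : `|g x - g y| <= e / 2.
    apply: hr; rewrite /ball_ /=; have := ler_distD x' x y; rewrite (distrC x' y); lra.
  have := ler_distD (g x) (g y) (g x'); rewrite (distrC (g y) (g x)); lra.
exists (r / 2); first by rewrite divr_gt0.
move=> x y xN yx; apply: (hr (r / 2)) yx => /=.
- by rewrite sub0r normrN gtr0_norm ?divr_gt0//; lra.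
- by rewrite divr_gt0.
- by rewrite in_itv/= -ler_norml.
Qed.

Lemma is_derive_approx (G : R -> R) (t d e : R) : is_derive t (1 : R) G d -> 0 < e ->
  exists2 dlt, 0 < dlt & forall h, 0 < h < dlt -> `|G (t + h) - G t - h * d| <= h * e.
Proof.
move=> [dG dGE] e0.
have : h^-1 *: (G (h *: (1 : R) + t) - G t) @[h --> 0^'] --> d by rewrite -dGE.
move=> /cvgrPdist_le /(_ e e0) [r /= r0 hr].
exists r => // h /andP[h0 hr'].
have := hr h; rewrite /= sub0r normrN gtr0_norm// => /(_ hr').
rewrite gt_eqF// => /(_ isT); rewrite /GRing.scale/= mulr1 [h + t]addrC => hh.
have -> : G (t + h) - G t - h * d = - (h * (d - h^-1 * (G (t + h) - G t))).
  by rewrite mulrBr mulrA divff ?gt_eqF// mul1r; ring.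
by rewrite normrN normrM gtr0_norm// ler_wpM2l// ltW.
Qed.

Lemma uniform_cvg_right (T : choiceType) (F : R -> T -> R) (g : T -> R) :
  {uniform, F h @[h --> 0^'+] --> g} <->
  forall e, 0 < e -> exists2 dlt, 0 < dlt &
    forall h, 0 < h < dlt -> forall x, `|F h x - g x| <= e.
Proof.
split=> [Fg e e0|h P].
  have /Fg : nbhs (g : {uniform T -> R}) [set k | forall x, `|g x - k x| < e].
    apply/uniform_nbhs; exists [set xy | ball xy.1 e xy.2]; split.
      by rewrite -entourage_ballE; exists e.
    by move=> k hk x; exact: hk.
  move=> [r /= r0 hr]; exists r => // h /andP[h0 hr'] x.
  rewrite distrC ltW//; apply: hr => //=.
  by rewrite sub0r normrN gtr0_norm.
move=> /uniform_nbhs [B [entB BP]].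
move: entB; rewrite -entourage_ballE => -[e /= e0 eB].
have e2 : 0 < e / 2 by rewrite divr_gt0.
have [dlt dlt0 hd] := h _ e2.
exists dlt => //= t /=; rewrite sub0r normrN => td t0; apply: BP => x _.
apply: eB => /=; rewrite /ball/= distrC; apply: le_lt_trans (hd t _ x) _; last lra.
by rewrite t0 /= (le_lt_trans (ler_norm _) td).
Qed.

End RealFacts.

Section GeneratorIdentification.
Context {R : realType} (m : zigzag_rates R).
Local Notation E := (R * bool)%type.
Local Notation mu := (@lebesgue_measure R).
Local Notation a := (speed m).
Local Notation lam := (rate m).
Local Notation flow := (flow a).
Local Notation surv := (surv m).
Local Notation dens := (dens m).
Local Notation jump_point := (jump_point m).
Local Notation mild := (mild m).
Context {d : measure_display} (Omega : E -> measurableType d)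
  (P : forall x, probability (Omega x) R) (Z : forall x, nat -> {RV (P x) >-> R}).
Hypothesis Z_law : forall x, waiting_times a lam x (Z x).
Local Notation Xx x := (zigzag a x (Z x)).
Local Notation Pt := (transition P (fun x => Xx x)).

Lemma small_bound (B e : R) : 0 <= B -> 0 < e -> exists2 dlt, 0 < dlt &
  forall h, 0 < h < dlt -> B * h <= e.
Proof.
move=> B0 e0; exists (e / (B + 1)); first by rewrite divr_gt0//; lra.
move=> h /andP[h0 hd]; rewrite ltr_pdivlMr in hd; last lra.
lra.
Qed.

Lemma uniform_continuity_state (k : E -> R) (N e : R) : continuous k -> 0 < e ->
  exists2 dlt, 0 < dlt & forall (x : E) (y : R), `|x.1| <= N -> `|y - x.1| <= dlt ->
    `|k (y, x.2) - k x| <= e.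
Proof.
move=> /continuous_branchP ck e0.
have [d1 d10 h1] := uniform_continuity_segment N (ck true) e0.
have [d2 d20 h2] := uniform_continuity_segment N (ck false) e0.
exists (Num.min d1 d2); first by rewrite lt_min d10.
by move=> [z []] y /= zN; rewrite le_min => /andP[hy1 hy2]; [exact: h1|exact: h2].
Qed.

(** Far out k is small, and so is (P_h f - f) / h by transition_mild_norm_le.  On a
    compact set the rates are bounded, so a jump within time h changes the integrand
    of transition_mild by O(h) only. *)
Lemma mild_generator f k : C0 f -> C0 k -> mild f k -> forall e, 0 < e ->
  exists2 dlt, 0 < dlt & forall h, 0 < h < dlt -> forall x,
    `|h^-1 * (Pt h f x - f x) - k x| <= e.
Proof.
move=> Cf Ck mfk e e0.
have cf := C0_continuous Cf; have ck := C0_continuous Ck.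
have [C C_ge0 fC] := C0_bounded Cf; have [K K0 kK] := C0_bounded Ck.
have e2 : 0 < e / 2 by rewrite divr_gt0.
have [N N0 kN] := C0_vanish Ck e2.
have [M M0 hM] := rate_bounded m (N + 2).
have [d1 d10 hd1] := uniform_continuity_state (N + 1) ck e2.
have [d2 d20 hd2] := small_bound (ltW (speed_gt0 m)) d10.
have [d3 d30 hd3] := small_bound (ltW (speed_gt0 m)) ltr01.
have B0 : 0 <= M * K + M * K by rewrite addr_ge0// mulr_ge0// ltW.
have [d4 d40 hd4] := small_bound B0 e2.
exists (Num.min (Num.min d2 d3) d4); first by rewrite !lt_min d20 d30 d40.
move=> h; rewrite !lt_min => /andP[h0 /andP[/andP[hh2 hh3] hh4]] x.
have ah1 : a * h <= 1 by apply: hd3; rewrite h0.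
have ahd : a * h <= d1 by apply: hd2; rewrite h0.
have Bh : (M * K + M * K) * h <= e / 2 by apply: hd4; rewrite h0.
have h_ge0 := ltW h0.
suff hs : `|Pt h f x - f x - h * k x| <= h * e.
  have -> : h^-1 * (Pt h f x - f x) - k x = h^-1 * (Pt h f x - f x - h * k x).
    by rewrite [RHS]mulrBr mulrA mulVf ?gt_eqF// mul1r.
  by rewrite normrM gtr0_norm ?invr_gt0// ler_pdivrMl.
have [xN|xN] := leP (N + 1) `|x.1|.
  have h1 : `|Pt h f x - f x| <= e / 2 * h.
    apply: (transition_mild_norm_le Z_law mfk cf ck fC h_ge0) => y yx.
    apply: kN; have := ler_distD y.1 x.1 0; rewrite !subr0 distrC; lra.
  have h2 : `|k x| <= e / 2 by apply: kN; lra.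
  rewrite (le_trans (ler_normB _ _))// normrM (gtr0_norm h0).
  have : h * `|k x| <= h * (e / 2) by rewrite ler_wpM2l.
  lra.
rewrite (transition_mild Z_law x mfk cf ck fC h_ge0).
apply: Rintegral_near_cst => //.
  exact: (integrable_transition_mild Z_law _ _ cf ck fC).
move=> r /andP[r0 rh].
have xc : `|x.1| + a * h <= N + 2 by lra.
have densM : dens r x <= M by apply: (dens_le hM _ xc); rewrite r0.
have arh : a * r <= a * h by rewrite ler_wpM2l// ltW// speed_gt0.
have h1 : `|dens r x * (Pt (h - r) f (jump_point r x) - f (jump_point r x))| <= M * (K * h).
  rewrite normrM (ger0_norm (dens_ge0 _ _ _)); apply: ler_pM => //; first exact: dens_ge0.
  have hr0 : 0 <= h - r by rewrite subr_ge0.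
  apply: le_trans (transition_mild_norm_le Z_law mfk cf ck fC hr0 (fun y _ => kK y)) _.
  by rewrite ler_wpM2l// gerBl.
have h2 : `|k (flow r x) - k x| <= e / 2.
  have := flow_dist a r x; rewrite (ger0_norm r0) (gtr0_norm (speed_gt0 m)) => fx.
  apply: (hd1 x (flow r x).1); first exact: ltW.
  by rewrite fx; lra.
have xr : `|x.1| + a * r <= N + 2 by lra.
have /andP[s0 sM] := surv_dist r0 hM xr.
have h3 : `|(1 - surv r x) * k x| <= M * (K * h).
  rewrite normrM (ger0_norm s0) [K * h]mulrC mulrA; apply: ler_pM => //.
  by apply: (le_trans sM); rewrite ler_wpM2l// ltW.
have h4 : `|surv r x * (k (flow r x) - k x)| <= e / 2.
  rewrite normrM (ger0_norm (surv_ge0 _ _ _)) -[leRHS]mul1r.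
  by apply: ler_pM; rewrite ?surv_ge0// surv_le1.
set u := dens r x * _ in h1 *.
have -> : u + surv r x * k (flow r x) - k x =
  u + surv r x * (k (flow r x) - k x) - (1 - surv r x) * k x by ring.
rewrite (le_trans (ler_normB _ _))//.
have := ler_normD u (surv r x * (k (flow r x) - k x)); lra.
Qed.

(** After a jump within time h, a second jump has probability O(h) and the flow
    moves by at most a h, so P_(h - r) f is close to f(flip x) at the point reached. *)
Lemma transition_after_jump f C (x : E) e : continuous f ->
  (forall y, `|f y| <= C) -> 0 < e ->
  exists2 dlt, 0 < dlt & forall h, 0 < h < dlt ->
    `|\int[mu]_(r in `[0, h]) (dens r x * Pt (h - r) f (jump_point r x)) -
      h * (lam x * f (flip x))| <= h * e.
Proof.
move=> cf fC e0; have mf := continuous_measurable_state cf.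
have C0 : 0 <= C by apply: le_trans (fC x).
have [M M0 hM] := rate_bounded m (`|x.1| + 1).
(* M bounds the density and C bounds f; the errors in both are to be at most
   eta. *)
pose eta := e / (2 * (M + C + 1)).
have den0 : 0 < 2 * (M + C + 1) by lra.
have eta0 : 0 < eta by rewrite divr_gt0.
have etaE : (M + C) * eta <= e / 2.
  have h1 : eta * (2 * (M + C + 1)) = e by rewrite /eta divfK// gt_eqF.
  nra.
have cfj : continuous (fun y => f (y, ~~ x.2)) by have /continuous_branchP := cf; exact.
have /cvgrPdist_le /(_ _ eta0) [d1 /= d10 hd1] := cfj x.1.
have cd := @continuous_dens_time _ m x.
have /cvgrPdist_le /(_ _ eta0) [d2 /= d20 hd2] := cd 0.
have d12 : 0 < d1 / 2 by rewrite divr_gt0.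
have [d3 d30 hd3] := small_bound (ltW (speed_gt0 m)) d12.
have [d4 d40 hd4] := small_bound (ltW (speed_gt0 m)) ltr01.
have B0 : 0 <= M * (C * M + C * M) by rewrite !(mulr_ge0, addr_ge0)// ltW.
have e2 : 0 < e / 2 by rewrite divr_gt0.
have [d5 d50 hd5] := small_bound B0 e2.
exists (Num.min (Num.min d2 d3) (Num.min d4 d5)).
  by rewrite !lt_min d20 d30 d40 d50.
move=> h; rewrite !lt_min => /andP[h0 /andP[/andP[hh2 hh3] /andP[hh4 hh5]]].
have ah1 : a * h <= 1 by apply: hd4; rewrite h0.
have ahd : a * h <= d1 / 2 by apply: hd3; rewrite h0.
have Bh : M * (C * M + C * M) * h <= e / 2 by apply: hd5; rewrite h0.
apply: Rintegral_near_cst; first exact: ltW.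
  apply: (@integrable_dens_mul _ _ _ C).
    exact: measurable_transition_time mf fC.
  by move=> r /andP[r0 rt]; apply: (transition_bounded Z_law _ mf fC); rewrite subr_ge0.
move=> r /andP[r0 rh].
have xc : `|x.1| + a * h <= `|x.1| + 1 by rewrite lerD2l.
have densM : dens r x <= M by apply: (dens_le hM _ xc); rewrite r0.
set y := jump_point r x; set s := h - r.
have s0 : 0 <= s by rewrite subr_ge0.
have yc : `|y.1| + a * s <= `|x.1| + 1.
  have := flow_bound xc r0; rewrite -/s /y /jump_point /=; exact.
have /andP[sv0 svM] := surv_dist s0 hM yc.
have MsMh : M * s <= M * h by rewrite ler_wpM2l ?(ltW M0)// gerBl.
have h1 : `|Pt s f y - surv s y * f (flow s y)| <= C * (M * h).
  apply: le_trans (renewal_dist Z_law y mf fC s0) _.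
  by rewrite ler_wpM2l// (le_trans svM).
have h2 : `|(1 - surv s y) * f (flow s y)| <= C * (M * h).
  rewrite normrM (ger0_norm sv0) mulrC; apply: ler_pM => //.
  exact: le_trans MsMh.
have h3 : `|f (flow s y) - f (flip x)| <= eta.
  rewrite distrC; apply: (hd1 (flow s y).1).
  rewrite /ball_ /=.
  have -> : x.1 - ((flow r x).1 + a * vel R (~~ x.2) * s) =
    a * vel R x.2 * (s - r).
    by rewrite /flow /vel /=; case: (x.2) => /=; ring.
  rewrite !normrM gtr0_norm ?speed_gt0//.
  have -> : `|vel R x.2| = 1 by rewrite /vel; case: x.2; rewrite ?normrN normr1.
  rewrite mulr1.
  have : `|s - r| <= h by rewrite /s ler_norml; apply/andP; split; lra.
  move=> hs; have : a * `|s - r| <= a * h by rewrite ler_wpM2l// ltW// speed_gt0.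
  lra.
have h4 : `|dens r x - lam x| <= eta.
  have := hd2 r; rewrite /ball_ /= sub0r normrN (ger0_norm r0).
  move=> /(_ (le_lt_trans rh hh2)).
  by rewrite distrC {2}/dens flow0 surv0 mulr1.
have h5 : `|Pt s f y - f (flip x)| <= C * (M * h) + C * (M * h) + eta.
  have -> : Pt s f y - f (flip x) = (Pt s f y - surv s y * f (flow s y)) -
    (1 - surv s y) * f (flow s y) + (f (flow s y) - f (flip x)) by ring.
  apply: (le_trans (ler_normD _ _)); rewrite lerD//.
  by apply: (le_trans (ler_normB _ _)); rewrite lerD.
have -> : dens r x * Pt s f y - lam x * f (flip x) =
  dens r x * (Pt s f y - f (flip x)) + (dens r x - lam x) * f (flip x) by ring.
have h6 : `|dens r x * (Pt s f y - f (flip x))| <= M * (C * (M * h) + C * (M * h) + eta).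
  by rewrite normrM (ger0_norm (dens_ge0 _ _ _)); apply: ler_pM; rewrite ?dens_ge0.
have h7 : `|(dens r x - lam x) * f (flip x)| <= eta * C.
  by rewrite normrM; apply: ler_pM.
apply: (le_trans (ler_normD _ _)).
have -> : e = e / 2 + e / 2 by field.
have e1 : M * (C * (M * h) + C * (M * h) + eta) + eta * C =
  M * (C * M + C * M) * h + (M + C) * eta by ring.
lra.
Qed.

(** Along the flow, t |-> surv t x * f(flow t x) has the right derivative that the
    mild equation prescribes: expand P_h f by its renewal equation.  A continuous
    function is determined by its right derivative, so nothing has to be known
    about differentiability of f beforehand. *)
Lemma generator_mild f k : C0 f -> C0 k ->
  (forall x e, 0 < e -> exists2 dlt, 0 < dlt & forall h, 0 < h < dlt ->
    `|h^-1 * (Pt h f x - f x) - k x| <= e) -> mild f k.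
Proof.
move=> Cf Ck gen t0 x t00.
have cf := C0_continuous Cf; have ck := C0_continuous Ck.
have mf := continuous_measurable_state cf.
have [C C_ge0 fC] := C0_bounded Cf.
have cb := @continuous_mild_integrand _ m f k x cf ck.
have [B dB] := continuous_primitive cb.
rewrite (Rintegral_primitive t00 cb dB).
pose v t := surv t x * f (flow t x) + B t.
suff : v t0 = v 0 by rewrite /v surv0 flow0 mul1r => h; lra.
apply: right_derivative0_cst => //.
  move=> t; apply: cvgD; last exact: (is_derive_continuous dB).
  by apply: cvgM; [exact: continuous_surv_time|exact: (continuous_along_flow cf)].
move=> t /andP[t_ge0 _] e e0; set z := flow t x.
have e3 : 0 < e / 3 by rewrite divr_gt0.
have [d1 d10 hd1] := gen z _ e3.
have [d2 d20 hd2] := transition_after_jump z cf fC e3.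
have [d3 d30 hd3] := is_derive_approx (dB t) e3.
exists (Num.min (Num.min d1 d2) d3); first by rewrite !lt_min d10 d20 d30.
move=> h; rewrite !lt_min => /andP[h0 /andP[/andP[hh1 hh2] hh3]].
have h_ge0 := ltW h0.
have k1 : `|Pt h f z - f z - h * k z| <= h * (e / 3).
  have := hd1 h; rewrite h0 => /(_ hh1) hh.
  have -> : Pt h f z - f z - h * k z = h * (h^-1 * (Pt h f z - f z) - k z).
    by rewrite [RHS]mulrBr mulrA divff ?gt_eqF// mul1r.
  by rewrite normrM gtr0_norm// ler_wpM2l.
have k2 := hd2 h; rewrite h0 in k2; have {}k2 := k2 hh2.
have k3 := hd3 h; rewrite h0 in k3; have {}k3 := k3 hh3.
have ren := renewal Z_law z mf fC h_ge0.
move: k2 ren; set I := Rintegral _ _ _ => k2 ren.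
pose dB' := dens t x * f (jump_point t x) - surv t x * k z.
have dBE : dB' = surv t x * (lam z * f (flip z) - k z).
  by rewrite /dB' /dens /jump_point -/z; ring.
have -> : v (t + h) - v t =
    surv t x * ((Pt h f z - f z - h * k z) - (I - h * (lam z * f (flip z)))) +
    (B (t + h) - B t - h * dB').
  by rewrite /v survD flowD -/z dBE ren; ring.
set A := Pt h f z - f z - _ in k1 *; set A' := I - _ in k2 *.
have k4 : `|surv t x * (A - A')| <= h * (e / 3) + h * (e / 3).
  rewrite normrM (ger0_norm (surv_ge0 _ _ _)) -[leRHS]mul1r.
  apply: ler_pM => //; [exact: surv_ge0|exact: surv_le1|].
  by rewrite (le_trans (ler_normB _ _))// lerD.
apply: (le_trans (ler_normD _ _)).
have -> : e * h = h * (e / 3) + h * (e / 3) + h * (e / 3) by field.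
exact: lerD.
Qed.

End GeneratorIdentification.

Section HasGenerator.
Context {R : realType} (m : zigzag_rates R).
Local Notation E := (R * bool)%type.
Local Notation a := (speed m).
Local Notation lam := (rate m).
Local Notation mild := (mild m).
Context {d : measure_display} (Omega : E -> measurableType d)
  (P : forall x, probability (Omega x) R) (Z : forall x, nat -> {RV (P x) >-> R}).
Hypothesis Z_law : forall x, waiting_times a lam x (Z x).
Local Notation Xx x := (zigzag a x (Z x)).
Local Notation Pt := (transition P (fun x => Xx x)).

Lemma C0_intro (phi : E -> R) : continuous phi ->
  (forall e, 0 < e -> exists N, forall x, N <= `|x.1| -> `|phi x| <= e) -> C0 phi.
Proof.
move=> cphi van j; split.
- by have /continuous_branchP := cphi; exact.
- apply/cvgrPdist_le => e e0; have [N hN] := van e e0.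
  near=> y; rewrite sub0r normrN; apply: hN => /=.
  apply: le_trans (ler_norm _).
  by near: y; apply: nbhs_pinfty_ge; exact: num_real.
- apply/cvgrPdist_le => e e0; have [N hN] := van e e0.
  near=> y; rewrite sub0r normrN; apply: hN => /=.
  rewrite -normrN; apply: le_trans (ler_norm _).
  by rewrite lerNr; near: y; apply: nbhs_ninfty_le; exact: num_real.
Unshelve. all: by end_near. Qed.

(** Within time t the process moves by at most a t, so P_t f is as small as f at
    points that are a t further out. *)
Lemma transition_C0 t f : 0 <= t -> C0 f -> C0 (Pt t f).
Proof.
move=> t0 Cf; have cf := C0_continuous Cf; have [C C_ge0 fC] := C0_bounded Cf.
apply: C0_intro; first exact: (continuous_transition Z_law cf fC t0).
move=> e e0; have [N N0 hN] := C0_vanish Cf e0.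
exists (N + a * t) => x xN.
apply: (transition_norm_le Z_law (continuous_measurable_state cf) fC t0) => y yx.
by apply: hN; have := ler_distD y.1 x.1 0; rewrite !subr0 distrC; lra.
Qed.

Lemma op_closure_approx (G : @op_graph R) p e : closure G p -> 0 < e ->
  exists q, [/\ G q, forall x, `|p.1 x - q.1 x| <= e & forall x, `|p.2 x - q.2 x| <= e].
Proof.
move=> clp e0.
have nb (k : {uniform E -> R}) : nbhs k [set k' | forall x, `|k x - k' x| < e].
  apply/uniform_nbhs; exists [set xy | ball xy.1 e xy.2]; split.
    by rewrite -entourage_ballE; exists e.
  by move=> k' hk x; exact: hk.
have /clp[q [Gq [h1 h2]]] : nbhs p
    [set q | (forall x, `|p.1 x - q.1 x| < e) /\ (forall x, `|p.2 x - q.2 x| < e)].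
  exists ([set k' | forall x, `|p.1 x - k' x| < e],
          [set k' | forall x, `|p.2 x - k' x| < e]) => /=.
    by split; exact: nb.
  by move=> q [].
by exists q; split=> // x; apply: ltW; [exact: h1|exact: h2].
Qed.

(** Limits of pairs in the graph of L satisfy the mild equation, solutions of the
    mild equation belong to the generator of the semigroup, and pairs in the generator
    satisfy the mild equation, hence belong to the graph of L.  In particular L is
    closed. *)
Theorem zigzag_has_generator : has_generator P (fun x => Xx x) (op_closure (L_graph a lam)).
Proof.
split=> [t f|]; first exact: transition_C0.
apply/seteqP; split=> -[f k] /= [Cf Ck].
  move=> clfk; split=> //; apply/uniform_cvg_right => e e0.
  apply: (mild_generator Z_law Cf Ck _ e0).
  have cf := C0_continuous Cf; have ck := C0_continuous Ck.
  apply: mild_closed => // eta eta0.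
  have [[f' k'] /= [[domf' k'E] ff' kk']] := op_closure_approx clfk eta0.
  exists f', k'; split=> //.
  - exact: L_graph_mild.
  - by case: domf' => /C0_continuous.
  - by rewrite (k'E : k' = _); case: domf' => _ _ /C0_continuous.
move=> /uniform_cvg_right gen; split=> //.
have mfk : mild f k.
  apply: (generator_mild Z_law Cf Ck) => x e e0.
  by have [dlt dlt0 hd] := gen e e0; exists dlt => // h /hd; exact.
have [domf kE] := mild_L_graph Cf Ck mfk.
by apply: subset_closure; split.
Qed.

End HasGenerator.

(** * Random times and stopping times *)

Section Grid.
Context {R : realType}.

Lemma grid_subproof (n : nat) (r : R) : exists k : nat, r <= k%:R / n.+1%:R.
Proof.
exists (Num.trunc (`|r| * n.+1%:R)).+1; rewrite ler_pdivlMr ?ltr0n//.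
apply: (@le_trans _ _ (`|r| * n.+1%:R)); last exact/ltW/truncnS_gt.
by rewrite ler_wpM2r// ler_norm.
Qed.

(** Times are rounded up, since this keeps them stopping times. *)
Definition grid (n : nat) (r : R) : nat := ex_minn (grid_subproof n r).

Definition grid_pt (n k : nat) : R := k%:R / n.+1%:R.

Lemma grid_pt_ge0 n k : 0 <= grid_pt n k.
Proof. by rewrite divr_ge0. Qed.

Lemma grid_ge n r : r <= grid_pt n (grid n r).
Proof. by rewrite /grid; case: ex_minnP. Qed.

Lemma grid_eq0 n r : grid n r = 0%N <-> r <= 0.
Proof.
rewrite /grid; case: ex_minnP => k hk kmin; split=> [k0|r0].
  by move: hk; rewrite k0 mul0r.
by apply/eqP; rewrite -leqn0; apply: kmin; rewrite mul0r.
Qed.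

Lemma grid_eqS n r k : grid n r = k.+1 <-> grid_pt n k < r <= grid_pt n k.+1.
Proof.
rewrite /grid /grid_pt; case: ex_minnP => l hl lmin; split=> [lk|/andP[kr rk]].
  rewrite -lk hl andbT ltNge; apply/negP => /lmin.
  by rewrite lk ltnn.
apply/eqP; rewrite eqn_leq lmin//= ltnNge; apply/negP => lk.
have : grid_pt n l <= grid_pt n k by rewrite ler_wpM2r ?invr_ge0// ler_nat.
by rewrite leNgt => /negP; apply; exact: lt_le_trans hl.
Qed.

Lemma grid_le n r : 0 <= r -> grid_pt n (grid n r) <= r + n.+1%:R^-1.
Proof.
move=> r0; case E : (grid n r) => [|k].
  by rewrite /grid_pt mul0r addr_ge0// invr_ge0.
have /andP[kr _] := (grid_eqS n r k).1 E.
rewrite /grid_pt -natr1 mulrDl mul1r lerD2r; exact: ltW.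
Qed.

(** The grid points approach r from the right, or are equal to r. *)
Lemma cvg_grid (u : R -> R) (r : R) : 0 <= r -> u s @[s --> r^'+] --> u r ->
  u (grid_pt n (grid n r)) @[n --> \oo] --> u r.
Proof.
move=> r0 /cvgrPdist_le ur; apply/cvgrPdist_le => e e0.
have [dlt /= dlt0 hd] := ur e e0.
near=> n; have := grid_ge n r; rewrite le_eqVlt => /predU1P[<-|rg].
  by rewrite subrr normr0 ltW.
apply: hd => //; rewrite /ball_ /= distrC ger0_norm ?subr_ge0 ?ltW//.
rewrite ltrBlDl; apply: (le_lt_trans (grid_le n r0)); rewrite ltrD2l.
by near: n; exact: (near_infty_natSinv_lt (PosNum dlt0)).
Unshelve. all: by end_near. Qed.

End Grid.

Section RandomTime.
Context {R : realType}.
Local Notation E := (R * bool)%type.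

Definition bool_val (y : E) : R := y.2%:R.

Lemma continuous_bool_val : continuous bool_val.
Proof. by apply/continuous_branchP => j y; exact: cvg_cst. Qed.

Lemma continuous_fst_state : continuous (fst : E -> R).
Proof. by apply/continuous_branchP => j y; exact: cvg_id. Qed.

Lemma measurable_state d (T : measurableType d) (Y : T -> E) :
  measurable_fun setT (fun w => (Y w).1) ->
  measurable_fun setT (fun w => bool_val (Y w)) -> measurable_fun setT Y.
Proof.
move=> m1 m2; have -> : Y = fun w => ((Y w).1, (Y w).2).
  by apply/funext => w; case: (Y w).
apply: measurable_fun_pair => //; apply: (measurable_fun_bool true).
rewrite setTI; have -> : (fun w => (Y w).2) @^-1` [set true] =
    (fun w => bool_val (Y w)) @^-1` `]0, +oo[%classic.
  by apply/seteqP; split=> w /=; rewrite in_itv/= andbT /bool_val ltr0n lt0b.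
by rewrite -[X in measurable X]setTI; exact: m2.
Qed.

Lemma measurable_gridding d (T : measurableType d) (rho : T -> R) n k :
  measurable_fun setT rho -> measurable [set w | grid n (rho w) = k].
Proof.
move=> mr; case: k => [|k].
  have -> : [set w | grid n (rho w) = 0%N] = rho @^-1` `]-oo, 0]%classic.
    by apply/seteqP; split=> w /=; rewrite in_itv/= => /grid_eq0.
  by rewrite -[X in measurable X]setTI; exact: mr.
have -> : [set w | grid n (rho w) = k.+1] = rho @^-1` `]grid_pt n k, grid_pt n k.+1]%classic.
  by apply/seteqP; split=> w /=; rewrite in_itv/= => /grid_eqS.
by rewrite -[X in measurable X]setTI; exact: mr.
Qed.

(** Sampled at rounded times the process is measurable, because the rounded times
    take countably many values; then the grid is refined. *)
Lemma measurable_random_time d (T : measurableType d) (Y : R -> T -> E) (rho : T -> R) :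
  (forall s, 0 <= s -> measurable_fun setT (Y s)) ->
  (forall w s, Y r w @[r --> s^'+] --> Y s w) ->
  measurable_fun setT rho -> (forall w, 0 <= rho w) ->
  measurable_fun setT (fun w => Y (rho w) w).
Proof.
move=> mY rcY mr r0.
have mn n : measurable_fun setT (fun w => Y (grid_pt n (grid n (rho w))) w).
  move=> _ B mB; rewrite setTI.
  have -> : (fun w => Y (grid_pt n (grid n (rho w))) w) @^-1` B =
    \bigcup_k ([set w | grid n (rho w) = k] `&` Y (grid_pt n k) @^-1` B).
    apply/seteqP; split=> [w /= h|w [k _ /= [<-]]//].
    by exists (grid n (rho w)).
  apply: bigcup_measurable => k _; apply: measurableI; first exact: measurable_gridding.
  by rewrite -[X in measurable X]setTI; apply: mY => //; exact: grid_pt_ge0.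
have mphi (phi : E -> R) : continuous phi -> measurable_fun setT (fun w => phi (Y (rho w) w)).
  move=> cphi.
  refine (@measurable_fun_cvg _ T R setT (fun n w => phi (Y (grid_pt n (grid n (rho w))) w)) _ _ _).
  - by move=> n; apply: measurableT_comp (mn n); exact: continuous_measurable_state.
  - move=> w _; apply: (@cvg_grid _ (fun s => phi (Y s w))) => //.
    by apply: continuous_cvg; [exact: cphi|exact: rcY].
by apply: measurable_state; apply: mphi;
  [exact: continuous_fst_state|exact: continuous_bool_val].
Qed.

End RandomTime.

Section RealTimes.
Context {R : realType}.

Lemma measurable_time d (T : measurableType d) (rho : T -> R) :
  (forall w, 0 <= rho w) -> (forall c, 0 <= c -> measurable [set w | rho w <= c]) ->
  measurable_fun setT rho.
Proof.
move=> r0 h; apply: (measurability _ (@RGenOInfty.measurableE R)).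
move=> _ [_ [c ->] <-]; rewrite setTI; case: (ltP c 0) => c0.
  rewrite (_ : _ @^-1` _ = setT)//; apply/seteqP; split=> w //= _.
  by rewrite in_itv/= andbT (lt_le_trans c0).
have -> : rho @^-1` `]c, +oo[%classic = ~` [set w | rho w <= c].
  apply/seteqP; split=> w /=; rewrite in_itv/= andbT ltNge; first by move/negP.
  by move=> /negP.
by apply: measurableC; exact: h.
Qed.

Lemma right_continuous_shift (U : topologicalType) (u : R -> U) s t :
  (forall r, u q @[q --> r^'+] --> u r) -> u (q + t) @[q --> s^'+] --> u (s + t).
Proof.
move=> uc B /uc[e /= e0 he]; exists e => // q /= qe sq; apply: he => /=.
  by rewrite opprD addrACA subrr addr0.
by rewrite ltrD2r.
Qed.

Lemma right_continuous_min (U : topologicalType) (u : R -> U) s t :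
  (forall r, u q @[q --> r^'+] --> u r) -> u (Num.min q t) @[q --> s^'+] --> u (Num.min s t).
Proof.
move=> uc; case: (ltP s t) => st.
  move=> B /uc[e /= e0 he].
  have d0 : 0 < Num.min e (t - s) by rewrite lt_min e0 subr_gt0.
  exists (Num.min e (t - s)) => // q /=; rewrite lt_min => /andP[qe qt] sq.
  change (B (u (Num.min q t))); rewrite min_l; first by apply: he.
  by move: qt; rewrite distrC gtr0_norm ?subr_gt0// ltrD2r => /ltW.
move=> B /nbhs_singleton Bt; exists 1 => [|q _ sq]; first exact: ltr01.
by change (B (u (Num.min q t))); rewrite min_r// (le_trans st)// ltW.
Qed.

End RealTimes.

Section StoppingTimes.
Context {R : realType} {d} {T : measurableType d}.
Local Notation E := (R * bool)%type.
Variables (X : R -> T -> E) (tau : T -> \bar R).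
Local Notation Fil := (natural_filtration X).
Hypothesis X_right : forall w s, X r w @[r --> s^'+] --> X s w.
Hypothesis tauF : stopping_time Fil tau.

Let tau0 w : (0 <= tau w)%E. Proof. by case: tauF. Qed.
Let Ftau t : 0 <= t -> Fil t [set w | (tau w <= t%:E)%E]. Proof. by case: tauF => _; exact. Qed.

Local Notation past t :=
  (g_sigma_algebraType (\bigcup_(s in `[0%R, t]) preimage_set_system setT (X s) measurable)).
Local Notation capped t w := (fine (mine (tau w) t%:E)).

Lemma capped_ge0 t w : 0 <= t -> 0 <= capped t w.
Proof. by move=> t0; rewrite fine_ge0// le_min tau0. Qed.

(** The process s |-> X (min s t) is right-continuous and consists of F_t-measurable
    variables, and so is the time min(tau, t); hence measurable_random_time applies
    on the sigma-algebra F_t. *)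
Lemma measurable_capped_state t : 0 <= t ->
  @measurable_fun _ _ (past t) E setT (fun w => X (capped t w) w).
Proof.
move=> t0; pose Y s (w : past t) := X (Num.min s t) w.
have capt w : capped t w <= t.
  rewrite -lee_fin fineK ?ge_min ?lexx ?orbT//.
  rewrite ge0_fin_numE; first by rewrite gt_min ltry orbT.
  by rewrite le_min tau0.
have -> : (fun w => X (capped t w) w) = fun w => Y (capped t w) w.
  by apply/funext => w; rewrite /Y (min_l (capt w)).
have := @measurable_random_time R _ (past t) Y (fun w => capped t w); apply.
- move=> s s0 _ B mB; rewrite setTI; apply: (@filtration_adapted _ _ _ X (Num.min s t) t).
  + by rewrite le_min s0.
  + by rewrite ge_min lexx orbT.
  + by exists B => //; rewrite setTI.
- by move=> w s; exact: (@right_continuous_min _ _ (fun s => X s w)).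
- apply: (@measurable_time R _ (past t)) => [w|c c0]; first exact: capped_ge0.
  case: (leP t c) => tc.
    have -> : [set w | capped t w <= c] = setT.
      by apply/seteqP; split=> w //= _; exact: le_trans tc.
    exact: (@measurableT _ (past t)).
  have -> : [set w | capped t w <= c] = [set w | (tau w <= c%:E)%E]; last first.
    exact: (filtration_le (ltW tc) (Ftau c0)).
  apply/seteqP; split=> w /=.
    rewrite -lee_fin fineK ?ge_min ?lee_fin.
      by case/orP=> //; rewrite leNgt tc.
    rewrite ge0_fin_numE; first by rewrite gt_min ltry orbT.
    by rewrite le_min tau0.
  move=> h; rewrite min_l; last by apply: (le_trans h); rewrite lee_fin ltW.
  rewrite -lee_fin fineK// ge0_fin_numE//.
  by apply: (le_lt_trans h); exact: ltry.
- by move=> w; exact: capped_ge0.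
Qed.

Lemma stopping_ltoo : [set w | (tau w < +oo)%E] = \bigcup_n [set w | (tau w <= n%:R%:E)%E].
Proof.
apply/seteqP; split=> w /=; last by move=> [n _ /= h]; apply: (le_lt_trans h); exact: ltry.
move=> too; exists (Num.trunc (fine (tau w))).+1 => //=.
rewrite -[leLHS]fineK ?ge0_fin_numE// lee_fin; exact/ltW/truncnS_gt.
Qed.

Lemma stopped_sigma_preimage (V : T -> R) :
  (forall t B, 0 <= t -> measurable B ->
    Fil t (V @^-1` B `&` [set w | (tau w <= t%:E)%E])) ->
  (forall w, tau w = +oo%E -> V w = 0) ->
  preimage_set_system setT V measurable `<=` stopped_sigma Fil tau.
Proof.
move=> hV V0 _ [B mB <-]; rewrite setTI; split; last by move=> t t0; exact: hV.
set Foo := (X in X (V @^-1` B)).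
have [Foo0 FooC FooU] : sigma_algebra setT Foo by exact: smallest_sigma_algebra.
have sub t A : 0 <= t -> Fil t A -> Foo A.
  by move=> t0 FA; apply: sub_sigma_algebra; exists t => //=; rewrite in_itv/= t0.
have Foofin : Foo [set w | (tau w < +oo)%E].
  by rewrite stopping_ltoo; apply: FooU => n; apply: (@sub n%:R) => //; exact: Ftau.
(* The index 0 stands for the event that tau is infinite, where V is 0, and k.+1 for
   the event that tau is at most k. *)
pose F_ n := if n is k.+1 then V @^-1` B `&` [set w | (tau w <= k%:R%:E)%E]
  else if `[< B 0 >] then setT `\` [set w | (tau w < +oo)%E] else set0.
have -> : V @^-1` B = \bigcup_n F_ n.
  apply/seteqP; split=> w /=; last first.
    move=> [[|n] _ /=]; last by case.
    case: asboolP => // B0 [_ /=]; rewrite ltey => /negP; rewrite negbK => /eqP tauoo.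
    by rewrite V0.
  move=> Bw; case: (boolP (tau w < +oo)%E) => too.
    have : [set w | (tau w < +oo)%E] w by [].
    by rewrite stopping_ltoo => -[n _ /= h]; exists n.+1.
  exists 0%N => //=; case: asboolP => [_|]; first by split => //; exact/negP.
  move: too; rewrite ltey negbK => /eqP too.
  by move: Bw; rewrite V0.
apply: FooU => -[|n] /=; last by apply: (@sub n%:R) => //; exact: hV.
by case: asboolP => _ //; exact: FooC.
Qed.

Lemma stopped_sigma_state (g : E -> R) : measurable_fun setT g ->
  preimage_set_system setT
    (fun w => \1_[set w | (tau w < +oo)%E] w * g (X (fine (tau w)) w)) measurable
  `<=` stopped_sigma Fil tau.
Proof.
move=> mg; apply: stopped_sigma_preimage => [t B t0 mB|w too]; last first.
  by rewrite indicE memNset ?mul0r//= too.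
have -> : (fun w => \1_[set w | (tau w < +oo)%E] w * g (X (fine (tau w)) w)) @^-1` B
    `&` [set w | (tau w <= t%:E)%E] =
    (fun w => g (X (capped t w) w)) @^-1` B `&` [set w | (tau w <= t%:E)%E].
  apply/seteqP; split=> w /= [Bw h]; split=> //; move: Bw;
    by rewrite indicE mem_set ?mul1r ?min_l//=; apply: (le_lt_trans h); exact: ltry.
apply: (@measurableI _ (past t)); last exact: Ftau.
rewrite -[X in measurable X]setTI.
by apply: (measurableT_comp mg (measurable_capped_state t0)).
Qed.

Hypothesis mX : forall s, measurable_fun setT (X s).

Lemma measurable_stopping t : 0 <= t -> measurable [set w | (tau w <= t%:E)%E].
Proof. by move=> t0; exact: filtration_measurable (Ftau t0). Qed.

Lemma measurable_stopping_ltoo : measurable [set w | (tau w < +oo)%E].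
Proof.
by rewrite stopping_ltoo; apply: bigcup_measurable => n _; exact: measurable_stopping.
Qed.

Lemma measurable_fine_stopping : measurable_fun setT (fine \o tau).
Proof.
apply: measurable_time => [w|c c0]; first by rewrite fine_ge0.
have -> : [set w | (fine \o tau) w <= c] =
    [set w | (tau w <= c%:E)%E] `|` ~` [set w | (tau w < +oo)%E].
  apply/seteqP; split=> w /=; have := tau0 w; case: (tau w) => [r| |] //=.
  - by rewrite lee_fin; left.
  - by right; rewrite ltxx.
  - by rewrite lee_fin => _ [//|]; rewrite ltry.
by apply: measurableU; [exact: measurable_stopping|exact/measurableC/measurable_stopping_ltoo].
Qed.

Lemma measurable_state_after t : 0 <= t ->
  measurable_fun setT (fun w => X (fine (tau w) + t) w).
Proof.
move=> t0; apply: (@measurable_random_time R _ T (fun s w => X (s + t) w)) => //.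
- by move=> w s; exact: (@right_continuous_shift _ _ (fun s => X s w)).
- exact: measurable_fine_stopping.
- by move=> w; rewrite fine_ge0.
Qed.

Variable A : set T.
Hypothesis FA : stopped_sigma Fil tau A.

Lemma stopped_sigma_measurable : measurable A.
Proof.
case: FA => + _; apply: smallest_sub; first exact: sigma_algebra_measurable.
by move=> B [t _]; exact: filtration_measurable.
Qed.

Definition finite_part := A `&` [set w | (tau w < +oo)%E].

Lemma measurable_finite_part : measurable finite_part.
Proof.
by apply: measurableI; [exact: stopped_sigma_measurable|exact: measurable_stopping_ltoo].
Qed.

(** As times are rounded up, the event that the rounded time is the k-th grid point
    is a difference of events (tau <= q) for grid points q up to the k-th. *)
Lemma filtration_grid n k :
  Fil (grid_pt n k) (finite_part `&` [set w | grid n (fine (tau w)) = k]).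
Proof.
have fineE w (c : R) : (tau w < +oo)%E -> (fine (tau w) <= c) = (tau w <= c%:E)%E.
  by move=> too; rewrite -lee_fin fineK// ge0_fin_numE.
have leoo w (c : R) : (tau w <= c%:E)%E -> (tau w < +oo)%E.
  by move=> h; apply: (le_lt_trans h); exact: ltry.
case: k => [|k].
  have -> : finite_part `&` [set w | grid n (fine (tau w)) = 0%N] =
      A `&` [set w | (tau w <= (grid_pt n 0)%:E)%E].
    rewrite /grid_pt mul0r; apply/seteqP; split=> w /=.
      by move=> [[Aw too] /grid_eq0]; rewrite fineE.
    move=> [Aw h]; have too := leoo _ _ h; split=> //; apply/grid_eq0.
    by rewrite fineE.
  by case: FA => _; apply; exact: grid_pt_ge0.
have -> : finite_part `&` [set w | grid n (fine (tau w)) = k.+1] =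
    (A `&` [set w | (tau w <= (grid_pt n k.+1)%:E)%E]) `\`
    (A `&` [set w | (tau w <= (grid_pt n k)%:E)%E]).
  apply/seteqP; split=> w /=.
    move=> [[Aw too] /grid_eqS/andP[]]; rewrite fineE// => h1 h2; split=> // -[_].
    by rewrite -fineE// leNgt h1.
  move=> [[Aw h] nh]; have too := leoo _ _ h; split=> //; apply/grid_eqS.
  rewrite fineE// h andbT ltNge; apply/negP; rewrite fineE// => h1; exact: nh.
have Fk : Fil (grid_pt n k.+1) (A `&` [set w | (tau w <= (grid_pt n k)%:E)%E]).
  apply: (@filtration_le _ _ _ X (grid_pt n k)).
    by rewrite ler_wpM2r ?invr_ge0// ler_nat.
  by case: FA => _; apply; exact: grid_pt_ge0.
apply: (@measurableD _ (past (grid_pt n k.+1))); last exact: Fk.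
by case: FA => _; apply; exact: grid_pt_ge0.
Qed.

End StoppingTimes.

(** * Functionals determined by continuous functions *)

Section ContinuousFunctions.
Context {R : realType}.
Local Notation E := (R * bool)%type.
Implicit Types (I : (E -> \bar R) -> \bar R) (h : E -> \bar R).

Definition on_branch (j : bool) (u : R -> \bar R) (y : E) : \bar R :=
  ((y.2 == j)%:R%:E * u y.1)%E.

Lemma measurable_eq_branch j : measurable_fun setT (fun y : E => (y.2 == j)%:R : R).
Proof.
have c : continuous (fun y : E => (y.2 == j)%:R : R).
  by apply/continuous_branchP => k y; exact: cvg_cst.
exact: continuous_measurable_state c.
Qed.

Lemma ge0_measurable_on_branch j u : ge0_measurable u -> ge0_measurable (on_branch j u).
Proof.
move=> [mu u0]; split=> [|y]; last by rewrite mule_ge0// lee_fin.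
apply: emeasurable_funM; first by apply/measurable_EFinP; exact: measurable_eq_branch.
exact: measurableT_comp mu measurable_fst.
Qed.

Lemma countably_linear_on_branch I j : countably_linear I ->
  countably_linear (fun u => I (on_branch j u)).
Proof.
move=> [I0 IZ Is]; split=> [u u0|c u c0 mu|u mu].
- by apply: I0 => y; rewrite mule_ge0// lee_fin.
- rewrite -IZ//; last exact: ge0_measurable_on_branch.
  by congr I; apply/funext => y; rewrite /on_branch muleCA.
- rewrite -Is; last by move=> n; exact: ge0_measurable_on_branch.
  congr I; apply/funext => y; rewrite /on_branch nneseriesZl// => n _.
  by case: (mu n).
Qed.

Definition ramp (c : R) (n : nat) (y : R) : R := Num.min 1 (n%:R * Num.max 0 (y - c)).

Lemma ramp_ge0 c n y : 0 <= ramp c n y.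
Proof. by rewrite le_min ler01 mulr_ge0// le_max lexx. Qed.

Lemma ramp_le1 c n y : ramp c n y <= 1.
Proof. by rewrite ge_min lexx. Qed.

Lemma continuous_ramp c n : continuous (ramp c n).
Proof.
move=> y; apply: (@continuous_min _ _ (fun=> 1) (fun y => n%:R * Num.max 0 (y - c))).
  exact: cvg_cst.
apply: cvgM; first exact: cvg_cst.
apply: (@continuous_max _ _ (fun=> 0) (fun y => y - c)); first exact: cvg_cst.
by apply: cvgB; [exact: cvg_id|exact: cvg_cst].
Qed.

Lemma cvg_ramp c y : (ramp c n y)%:E @[n --> \oo] --> (\1_`]c, +oo[%classic y : R)%:E.
Proof.
apply: cvg_EFin; first by near=> n.
rewrite indicE; case: (ltP c y) => cy.
  rewrite mem_set/= ?in_itv/= ?cy//.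
  apply: cvg_near_cst.
  near=> n; rewrite /ramp /= max_r ?subr_ge0 ?ltW//; apply/min_idPl.
  rewrite -ler_pdivrMr ?subr_gt0//; near: n; exact: nbhs_infty_ger.
rewrite memNset/=; last by rewrite in_itv/= andbT; apply/negP; rewrite -leNgt.
apply: cvg_near_cst.
near=> n; rewrite /ramp /= max_l ?subr_le0// mulr0; exact/min_idPr.
Unshelve. all: by end_near. Qed.

(** On each branch continuous ramps increase to the indicator of an open ray, and
    rays determine the functional. *)
Lemma countably_linear_eq_continuous I1 I2 :
  countably_linear I1 -> countably_linear I2 -> (I1 (fun=> 1%E) < +oo)%E ->
  (forall f : E -> R, continuous f -> (forall y, 0 <= f y <= 1) ->
    I1 (EFin \o f) = I2 (EFin \o f)) ->
  forall h, ge0_measurable h -> I1 h = I2 h.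
Proof.
move=> l1 l2 I1oo I12 h mh.
have branchE j u : ge0_measurable u -> I1 (on_branch j u) = I2 (on_branch j u).
  have k1 := countably_linear_on_branch j l1.
  have k2 := countably_linear_on_branch j l2.
  have ray (c : R) : I1 (on_branch j (fun y => (\1_`]c, +oo[%classic y)%:E)) =
      I2 (on_branch j (fun y => (\1_`]c, +oo[%classic y)%:E)).
    have lim (K : (R -> \bar R) -> \bar R) : countably_linear K ->
        K (fun y => (\1_`]c, +oo[%classic y)%:E) = limn (fun n => K (EFin \o ramp c n)).
      move=> lK; apply: (countably_linear_nondecreasing lK) => [n|n y|y].
      - split=> [|y]; last by rewrite lee_fin ramp_ge0.
        apply/measurable_EFinP.
        exact: (continuous_measurable_fun (@continuous_ramp c n)).
      - rewrite /ramp le_min ge_min lexx/= ge_min; apply/orP; right.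
        by rewrite ler_wpM2r ?le_max ?lexx// ler_nat.
      - exact: cvg_ramp.
    rewrite (lim _ k1) (lim _ k2); congr (limn _); apply/funext => n.
    have -> : on_branch j (EFin \o ramp c n) =
        EFin \o (fun y => (y.2 == j)%:R * ramp c n y.1) by apply/funext.
    apply: I12 => [|y].
      apply/continuous_branchP => k y; apply: cvgM; first exact: cvg_cst.
      exact: continuous_ramp.
    by case: (y.2 == j); rewrite ?mul0r ?mul1r ?lexx ?ler01 ?ramp_ge0 ?ramp_le1.
  apply: (countably_linear_unique_rays k1 k2 ray).
  move=> c; set g := on_branch _ _; have mg : ge0_measurable g.
    by apply: ge0_measurable_on_branch; exact: ge0_measurable_indic.
  apply: le_lt_trans I1oo.
  have -> : (fun=> 1%E) = (fun y : E => g y + (1 - g y))%E.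
    apply/funext => y; rewrite /g /on_branch indicE -EFinM -EFinB -EFinD.
    by rewrite addrC subrK.
  rewrite (countably_linearD l1 mg).
    rewrite leeDl//; case: l1 => + _ _; apply => y.
    rewrite /g /on_branch indicE -EFinM -EFinB lee_fin.
    by case: (_ == _); case: (_ \in _); rewrite ?mul1r ?mul0r ?subrr ?subr0.
  split=> [|y]; first by apply: emeasurable_funB => //; case: mg.
  rewrite /g /on_branch indicE -EFinM -EFinB lee_fin.
  by case: (_ == _); case: (_ \in _); rewrite ?mul1r ?mul0r ?subrr ?subr0.
have mhj j : ge0_measurable (fun r => h (r, j)).
  by split=> [|r]; [exact: measurableT_comp mh.1 (measurable_pair2 _)|case: mh].
have -> : h = fun y => (on_branch true (fun r => h (r, true)) y +
    on_branch false (fun r => h (r, false)) y)%E.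
  apply/funext => -[r [|]]; rewrite /on_branch /= ?mul0e ?mul1e ?adde0 ?add0e//.
by rewrite !countably_linearD ?branchE//; exact: ge0_measurable_on_branch.
Qed.

End ContinuousFunctions.

(** * The strong Markov property *)

Section StrongMarkov.
Context {R : realType} (m : zigzag_rates R).
Local Notation E := (R * bool)%type.
Local Notation a := (speed m).
Local Notation lam := (rate m).
Local Notation evolve := (evolve m).
Context {d : measure_display} (Omega : E -> measurableType d)
  (P : forall x, probability (Omega x) R) (Z : forall x, nat -> {RV (P x) >-> R}).
Hypothesis Z_law : forall x, waiting_times a lam x (Z x).
Local Notation Xx x := (zigzag a x (Z x)).
Local Notation Pt := (transition P (fun x => Xx x)).

Let evolveE t (f : E -> R) C y : measurable_fun setT f ->
  (forall y, 0 <= f y <= C) -> 0 <= t -> evolve (EFin \o f) (t, y) = (Pt t f y)%:E.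
Proof.
move=> mf fC; apply: (@evolve_transition _ m _ _ _ _ Z_law t f C) => // z.
  by case/andP: (fC z).
by rewrite ger0_norm; case/andP: (fC z).
Qed.

Variables (x : E) (tau : Omega x -> \bar R).
Local Notation X := (Xx x).
Local Notation Fil := (natural_filtration X).
Hypothesis tauF : stopping_time Fil tau.
Variable A : set (Omega x).
Hypothesis FA : stopped_sigma Fil tau A.
Variable t : R.
Hypothesis t0 : 0 <= t.

Let mX s : measurable_fun setT (X s) := measurable_zigzag m x (Z x) s.
Let X_right w s : X r w @[r --> s^'+] --> X s w.
Proof. exact: (@path_right_continuous _ m). Qed.
Let tau0 w : (0 <= tau w)%E. Proof. by case: tauF. Qed.
Local Notation T w := (fine (tau w)).
Local Notation Tn n w := (grid_pt n (grid n (fine (tau w)))).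
Local Notation A' := (finite_part tau A).
Let mA' : measurable A' := measurable_finite_part tauF mX FA.
Let T0 w : 0 <= T w. Proof. by rewrite fine_ge0. Qed.

Let mT : measurable_fun setT (fun w => T w) := measurable_fine_stopping tauF mX.

Let mXT s : 0 <= s -> measurable_fun setT (fun w => X (T w + s) w).
Proof. exact: measurable_state_after. Qed.

Let mXT0 : measurable_fun setT (fun w => X (T w) w).
Proof. by apply: eq_measurable_fun (mXT (lexx 0)) => w _; rewrite addr0. Qed.

Let mgrid n k : measurable [set w | grid n (T w) = k].
Proof. exact: measurable_gridding. Qed.

Let mXgrid n s : measurable_fun setT (fun w => X (Tn n w + s) w).
Proof.
move=> _ B mB; rewrite setTI.
have -> : (fun w => X (Tn n w + s) w) @^-1` B =
    \bigcup_k ([set w | grid n (T w) = k] `&` X (grid_pt n k + s) @^-1` B).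
  apply/seteqP; split=> [w /= h|w [k _ /= [<-]]//].
  by exists (grid n (T w)).
apply: bigcup_measurable => k _; apply: measurableI => //.
by rewrite -[U in measurable U]setTI; exact: mX.
Qed.

(** The rounded time takes countably many values q, and the event that it equals q
    belongs to F_q, where the Markov property at the fixed time q applies. *)
Let markov_grid n f : ge0_measurable f ->
  (\int[P x]_(w in A') f (X (Tn n w + t)%R w) =
   \int[P x]_(w in A') evolve f (t, X (Tn n w) w))%E.
Proof.
move=> mf; have [me e0] := ge0_measurable_evolve m mf.
have A'E : A' = \bigcup_k (A' `&` [set w | grid n (T w) = k]).
  by apply/seteqP; split=> [w Aw|w [k _ []]//]; exists (grid n (T w)).
have tF : trivIset setT (fun k => A' `&` [set w | grid n (T w) = k]).
  by move=> i j _ _ [w [[_ /= <-] [_ /= <-]]].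
have mFk k : measurable (A' `&` [set w | grid n (T w) = k]) by exact: measurableI.
have m1 : measurable_fun setT (fun w => f (X (Tn n w + t)%R w)).
  exact: (measurableT_comp mf.1 (mXgrid n t)).
have m2 : measurable_fun setT (fun w => evolve f (t, X (Tn n w) w)).
  apply: (measurableT_comp me (g := fun w => (t, X (Tn n w) w))).
  apply: measurable_fun_pair => //.
  by apply: eq_measurable_fun (mXgrid n 0) => w _; rewrite addr0.
rewrite A'E !ge0_integral_bigcup//; [|exact: measurable_funTS..|by move=> w _; case: mf].
apply: eq_eseriesr => k _.
transitivity (\int[P x]_(w in A' `&` [set w | grid n (T w) = k])
    f (X (grid_pt n k + t)%R w))%E.
  by apply: eq_integral => w; rewrite inE => -[_ /= ->].
rewrite (markov_property (Z_law x) mf (grid_pt_ge0 n k) t0); last exact: filtration_grid.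
by apply: eq_integral => w; rewrite inE => -[_ /= ->].
Qed.

Let PA'oo : (P x A' < +oo)%E.
Proof. by rewrite (le_lt_trans (probability_le1 _ _)) ?ltry. Qed.

Let cvg_bounded (u : nat -> Omega x -> R) (v : Omega x -> R) C :
  (forall n, measurable_fun setT (u n)) -> measurable_fun setT v ->
  (forall n w, 0 <= u n w <= C) -> (forall w, u n w @[n --> \oo] --> v w) ->
  (\int[P x]_(w in A') (u n w)%:E @[n --> \oo] --> \int[P x]_(w in A') (v w)%:E)%E.
Proof.
move=> mu mv uC uv.
apply: (@dominated_cvg _ _ _ (P x) A' mA' (fun n w => (u n w)%:E) _ (fun=> C%:E)) => //.
- by move=> n; apply/measurable_EFinP; exact: measurable_funTS.
- by move=> w _; apply: cvg_EFin => //; [by near=> n|exact: uv].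
- exact: finite_measure_integrable_cst.
- move=> n w _; rewrite /= lee_fin ger0_norm; by case/andP: (uC n w).
Unshelve. all: by end_near. Qed.

(** The grid is refined.  The left-hand sides converge as paths are right-continuous,
    the right-hand sides because moreover P_t f is continuous. *)
Let markov_continuous (f : E -> R) : continuous f -> (forall y, 0 <= f y <= 1) ->
  (\int[P x]_(w in A') (f (X (T w + t)%R w))%:E =
   \int[P x]_(w in A') evolve (EFin \o f) (t, X (T w) w))%E.
Proof.
move=> cf f01; have mf := continuous_measurable_state cf.
have fN y : `|f y| <= 1 by rewrite ger0_norm; case/andP: (f01 y).
have gmf : ge0_measurable (EFin \o f).
  by split => [|y]; [exact/measurable_EFinP|rewrite lee_fin; case/andP: (f01 y)].
have P01 y : 0 <= Pt t f y <= 1.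
  rewrite -!lee_fin -(evolveE y mf f01 t0); apply/andP; split.
    by case: (ge0_measurable_evolve m gmf).
  rewrite (evolveE y mf f01 t0) lee_fin (le_trans (ler_norm _))//.
  exact: (transition_bounded Z_law).
have cP := continuous_transition Z_law cf fN t0.
have mP := continuous_measurable_state cP.
under [RHS]eq_integral do rewrite (evolveE _ mf f01 t0).
have cl : (\int[P x]_(w in A') (f (X (Tn n w + t)%R w))%:E @[n --> \oo] -->
    \int[P x]_(w in A') (f (X (T w + t)%R w))%:E)%E.
  apply: (@cvg_bounded (fun n w => f (X (Tn n w + t) w)) (fun w => f (X (T w + t) w)) 1).
  - by move=> n; exact: (measurableT_comp mf (mXgrid n t)).
  - exact: (measurableT_comp mf (mXT t0)).
  - by move=> n w; exact: f01.
  - move=> w; apply: (@cvg_grid _ (fun s => f (X (s + t) w))) => //.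
    apply: continuous_cvg; first exact: cf.
    exact: (@right_continuous_shift _ _ (fun s => X s w)).
have cr : (\int[P x]_(w in A') (Pt t f (X (Tn n w) w))%:E @[n --> \oo] -->
    \int[P x]_(w in A') (Pt t f (X (T w) w))%:E)%E.
  apply: (@cvg_bounded (fun n w => Pt t f (X (Tn n w) w)) (fun w => Pt t f (X (T w) w)) 1).
  - move=> n; apply: (measurableT_comp mP).
    by apply: eq_measurable_fun (mXgrid n 0) => w _; rewrite addr0.
  - exact: (measurableT_comp mP mXT0).
  - by move=> n w; exact: P01.
  - move=> w; apply: (@cvg_grid _ (fun s => Pt t f (X s w))) => //.
    by apply: continuous_cvg; [exact: cP|exact: X_right].
rewrite -(cvg_lim (@ereal_hausdorff R) cl) -(cvg_lim (@ereal_hausdorff R) cr).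
congr (limn _); apply/funext => n; rewrite (markov_grid n gmf).
by apply: eq_integral => w _; rewrite (evolveE _ mf f01 t0).
Qed.

(** Both sides are countably linear in f and agree for continuous f. *)
Lemma strong_markov_ge0 (f : E -> \bar R) : ge0_measurable f ->
  (\int[P x]_(w in A') f (X (T w + t)%R w) =
   \int[P x]_(w in A') evolve f (t, X (T w) w))%E.
Proof.
move=> mf.
pose J (h : E -> \bar R) y := (\int[P y]_w h (Xx y t w))%E.
have JE h y : ge0_measurable h -> J h y = evolve h (t, y).
  by move=> mh; rewrite -(expectation_evolve mh (Z_law y)).
have mJ h : ge0_measurable h -> measurable_fun setT (fun w => J h (X (T w) w)).
  move=> mh; under eq_fun do rewrite JE//.
  have [me _] := ge0_measurable_evolve m mh.
  apply: (measurableT_comp me (g := fun w => (t, X (T w) w))).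
  exact: measurable_fun_pair.
have J0 h y : (forall y, 0 <= h y)%E -> (0 <= J h y)%E.
  by move=> h0; exact: integral_ge0.
transitivity (\int[P x]_(w in A') J f (X (T w) w))%E; last first.
  by apply: eq_integral => w _; exact: JE.
apply: (@countably_linear_eq_continuous R
  (fun f => \int[P x]_(w in A') f (X (T w + t)%R w))%E
  (fun f => \int[P x]_(w in A') J f (X (T w) w))%E) => //.
- by apply: countably_linear_integral => //; exact: mXT.
- have lJ y : countably_linear (fun h => J h y).
    by apply: countably_linear_integral => //; exact: measurable_zigzag.
  split=> [h h0|c h c0 mh|h mh].
  + by apply: integral_ge0 => w _; exact: J0.
  + rewrite -ge0_integralZl//; last 2 first.
    * by apply: measurable_funTS; exact: mJ.
    * by move=> w _; apply: J0; case: mh.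
    by apply: eq_integral => w _; case: (lJ (X (T w) w)) => _ lz _; rewrite lz.
  + rewrite -integral_nneseries//; last 2 first.
    * by move=> n; apply: measurable_funTS; exact: mJ.
    * by move=> n w _; apply: J0; case: (mh n).
    by apply: eq_integral => w _; case: (lJ (X (T w) w)) => _ _ ls; rewrite ls.
- by rewrite integral_cst// mul1e; exact: PA'oo.
- move=> g cg g01; rewrite (markov_continuous cg g01).
  apply: eq_integral => w _; rewrite JE//; split=> [|y].
    by apply/measurable_EFinP; exact: continuous_measurable_state.
  by rewrite lee_fin; case/andP: (g01 y).
Qed.

(** Adding a constant to f makes it nonnegative. *)
Lemma strong_markov_bounded (f : E -> R) C : measurable_fun setT f ->
  (forall y, `|f y| <= C) ->
  (\int[P x]_(w in A') (Pt t f (X (T w) w))%:E =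
   \int[P x]_(w in A') (f (X (T w + t)%R w))%:E)%E.
Proof.
move=> mf fC; pose g y := f y + C.
have gC y : 0 <= g y <= 2 * C.
  have := fC y; rewrite ler_norml /g => /andP[? ?]; apply/andP; split; lra.
have mg : measurable_fun setT g by apply: measurable_funD.
have gmg : ge0_measurable (EFin \o g).
  by split => [|y]; [exact/measurable_EFinP|rewrite lee_fin; case/andP: (gC y)].
have mP := measurable_transition Z_law mf fC t0.
have int_bounded (u : Omega x -> R) : measurable_fun setT u -> (forall w, `|u w| <= C) ->
    (P x).-integrable A' (EFin \o u).
  move=> mu uC; apply: measurable_bounded_integrable => //; first exact: measurable_funTS.
  by exists C; split; [exact: num_real|move=> N CN w _ /=; rewrite (le_trans (uC _))// ltW].
have iC : (P x).-integrable A' (EFin \o (fun=> C)) by exact: finite_measure_integrable_cst.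
have intD (u : Omega x -> R) : measurable_fun setT u -> (forall w, `|u w| <= C) ->
    (\int[P x]_(w in A') (u w + C)%:E =
     \int[P x]_(w in A') (u w)%:E + \int[P x]_(w in A') C%:E)%E.
  by move=> mu uC; rewrite -(integralD mA' (int_bounded _ mu uC) iC).
have := strong_markov_ge0 gmg.
under [RHS]eq_integral do
  rewrite (evolveE _ mg gC t0) (transitionDc m Z t _ C mf fC).
have m1 : measurable_fun setT (fun w => f (X (T w + t) w)).
  exact: (measurableT_comp mf (mXT t0)).
have m2 : measurable_fun setT (fun w => Pt t f (X (T w) w)).
  exact: (measurableT_comp mP mXT0).
rewrite (intD (fun w => f (X (T w + t) w)))// (intD (fun w => Pt t f (X (T w) w)))//; last first.
  by move=> w; exact: (transition_bounded Z_law).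
move=> /esym /(congr1 (fun u => u - \int[P x]_(w in A') C%:E)%E).
have fC' : (\int[P x]_(w in A') C%:E)%E \is a fin_num by exact: integrable_fin_num iC.
by rewrite !addeK.
Qed.

End StrongMarkov.

Section StrongMarkovProcess.
Context {R : realType} (m : zigzag_rates R).
Local Notation E := (R * bool)%type.
Local Notation a := (speed m).
Local Notation lam := (rate m).
Context {d : measure_display} (Omega : E -> measurableType d)
  (P : forall x, probability (Omega x) R) (Z : forall x, nat -> {RV (P x) >-> R}).
Hypothesis Z_law : forall x, waiting_times a lam x (Z x).
Local Notation Xx x := (zigzag a x (Z x)).

Lemma strong_markov_zigzag x :
  strong_markov P (fun x => Xx x) (natural_filtration (Xx x)).
Proof.
have mX s : measurable_fun setT (Xx x s) := measurable_zigzag m x (Z x) s.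
have X_right w s : Xx x r w @[r --> s^'+] --> Xx x s w.
  exact: (@path_right_continuous _ m).
have bnd (f : E -> R) : bounded_fun f -> exists C, forall y, `|f y| <= C.
  move=> [M [_ hM]]; exists (M + 1) => y; apply: hM => //.
  by rewrite ltrDl.
split=> [t t0|t f t0 mf /bnd[C fC]|tau tauF t f t0 mf /bnd[C fC]].
- exact: filtration_adapted.
- exact: (measurable_transition Z_law mf fC t0).
have mP := measurable_transition Z_law mf fC t0.
have moo := measurable_stopping_ltoo tauF mX.
have int_part (u : Omega x -> R) : measurable_fun setT u -> (forall w, `|u w| <= C) ->
    (P x).-integrable setT (EFin \o (fun w => \1_[set w | (tau w < +oo)%E] w * u w)).
  move=> mu uC; apply: measurable_bounded_integrable => //.
  - by rewrite [U in (U < _)%E](@probability_setT _ _ _ (P x)) ltry.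
  - by apply: measurable_funM => //; exact: measurable_indic.
  - exists C; split; first exact: num_real.
    move=> N CN w _ /=; rewrite indicE normrM (le_trans _ (ltW CN))//.
    rewrite (le_trans _ (uC w))// ler_piMl// normr_nat.
    by case: (_ \in _).
have mXT s : 0 <= s -> measurable_fun setT (fun w => Xx x (fine (tau w) + s) w).
  exact: measurable_state_after.
have mXT0 : measurable_fun setT (fun w => Xx x (fine (tau w)) w).
  by apply: eq_measurable_fun (mXT 0 (lexx 0)) => w _; rewrite addr0.
split.
- by apply: int_part => //; exact: (measurableT_comp mf (mXT t t0)).
- apply: int_part; first exact: (measurableT_comp mP mXT0).
  by move=> w; exact: (transition_bounded Z_law).
- exact: (stopped_sigma_state X_right tauF mP).
- move=> A FA.
  have part (u : Omega x -> R) :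
      (\int[P x]_(w in A) (\1_[set w | (tau w < +oo)%E] w * u w)%:E =
       \int[P x]_(w in finite_part tau A) (u w)%:E)%E.
    rewrite /finite_part integral_mkcondr; apply: eq_integral => w _.
    by rewrite patchE indicE; case: (_ \in _); rewrite ?mul1r ?mul0r.
  by rewrite !part; exact: strong_markov_bounded.
Qed.

End StrongMarkovProcess.

(** * Strong Markov property and generator of the zig-zag process *)

Theorem proposition3 (R : realType) (a : R) (lam : R * bool -> R)
    (y0 lam_min : R)
    (d : measure_display) (Omega : R * bool -> measurableType d)
    (P : forall x : R * bool, probability (Omega x) R)
    (Z : forall x : R * bool, nat -> {RV (P x) >-> R})
    (a_gt0 : 0 < a)
    (lam_continuous : continuous lam)
    (lam_ge0 : forall x, 0 <= lam x)
    (y0_ge0 : 0 <= y0)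
    (lam_min_gt0 : 0 < lam_min)
    (lam_ge_min : forall y j, y0 <= vel R j * y -> lam_min <= lam (y, j))
    (Z_law : forall x : R * bool, waiting_times a lam x (Z x)) :
  let X := fun x : R * bool => zigzag a x (Z x) in
  (forall x : R * bool,
     non_explosive a (P x) x (Z x) /\
     strong_markov P X (natural_filtration (X x))) /\
  has_generator P X (op_closure (L_graph a lam)).
Proof.
have prim (j : bool) : exists G : R -> R, forall y, is_derive y (1 : R) G (lam (y, j)).
  apply: continuous_primitive.
  by have /continuous_branchP := lam_continuous; exact.
have /choice[G hG] := prim.
pose m := ZigzagRates a_gt0 lam_continuous lam_ge0 hG lam_min_gt0 lam_ge_min.
move=> X; split=> [x|].
  split; first exact: (@non_explosive_zigzag _ m _ _ _ _ _ (Z_law x)).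
  exact: (@strong_markov_zigzag _ m _ _ _ _ Z_law).
exact: (@zigzag_has_generator _ m _ _ _ _ Z_law).
Qed.
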